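(* Let $X$ be a germ at $0\in\mathbb{R}^2$ of a real analytic vector field having first jet at $0$ of the form $X_1 = x_2\frac{\partial}{\partial x_1} - x_1\frac{\partial}{\partial x_2}$. Then the following conditions are equivalent: (i) The orbits of $X$ are closed subsets in some neighborhood of the origin. (ii) $X$ has a center type singularity at the origin. (iii) $X$ admits a real analytic first integral (in a neighborhood of the origin). (iv) $X$ is analytically almost linearizable, i.e., $X$ is a multiple (by a function) of a linear vector field after an analytic local change of coordinates.
   Context: The first jet of $X$ at $0$ is its Taylor polynomial of order one: $X-X_1$ has coefficients vanishing to order at least two at $0$. $X$ has a center type singularity at the origin if all (nonsingular) orbits in some punctured neighborhood of the origin are periodic (diffeomorphic to the circle). A real analytic first integral is a non-constant real analytic function germ $f$ at $0$ with $X(f)=0$, i.e. $f$ is constant on each orbit of $X$. *)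

(* Defs.v *)
From Stdlib Require Import Reals.
From Coquelicot Require Import Coquelicot.
Open Scope R_scope.

Definition origin : R * R := (0, 0).

(** [f] is, near [p], the sum of the absolutely convergent double power series
    [sum_{i,j} a i j (x - p_1)^i (y - p_2)^j]; the terms are grouped by total
    degree [n = i + j], which is harmless by absolute convergence. *)
Definition has_power_series (a : nat -> nat -> R) (p : R * R)
    (f : R * R -> R) : Prop :=
  locally p (fun q : R * R =>
    let u := fst q - fst p in
    let v := snd q - snd p in
    ex_series (fun n => sum_n (fun i =>
      Rabs (a i (n - i)%nat * u ^ i * v ^ (n - i))) n) /\
    is_series (fun n => sum_n (fun i =>
      a i (n - i)%nat * u ^ i * v ^ (n - i)) n) (f q)).

Definition analytic_at (f : R * R -> R) (p : R * R) : Prop :=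
  exists a, has_power_series a p f.

Definition vanishes_to_order (k : nat) (f : R * R -> R) (p : R * R) : Prop :=
  exists a, has_power_series a p f /\
    forall i j, (i + j < k)%nat -> a i j = 0.

(** Analytic maps of the plane; a vector field is identified with the map
    [p |-> (coefficient of d/dx_1 at p, coefficient of d/dx_2 at p)]. *)
Definition analytic_map_at (F : R * R -> R * R) (p : R * R) : Prop :=
  analytic_at (fun q => fst (F q)) p /\ analytic_at (fun q => snd (F q)) p.

(** [x_2 d/dx_1 - x_1 d/dx_2] *)
Definition rotation_field (p : R * R) : R * R := (snd p, - fst p).

Definition has_first_jet (X X1 : R * R -> R * R) : Prop :=
  vanishes_to_order 2 (fun p => fst (X p) - fst (X1 p)) origin /\
  vanishes_to_order 2 (fun p => snd (X p) - snd (X1 p)) origin.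

(** The function [X(f)]. Only used for [f] differentiable near the points of
    interest, where the total operator [Derive] is the partial derivative. *)
Definition lie_derivative (X : R * R -> R * R) (f : R * R -> R)
    (p : R * R) : R :=
  fst (X p) * Derive (fun t => f (t, snd p)) (fst p) +
  snd (X p) * Derive (fun t => f (fst p, t)) (snd p).

(** A germ at the origin is given by a representative defined on the whole
    plane, of which only the behaviour on such neighbourhoods [U] is used. *)
Definition germ_domain (X : R * R -> R * R) (U : R * R -> Prop) : Prop :=
  open U /\ U origin /\ forall p, U p -> analytic_map_at X p.

Definition integral_curve (X : R * R -> R * R) (U : R * R -> Prop)
    (a b : Rbar) (c : R -> R * R) : Prop :=
  forall t : R, Rbar_lt a t -> Rbar_lt t b ->
    U (c t) /\ is_derive c t (X (c t)).

(** The orbit of [p] for the restriction of [X] to [U], i.e. the image of the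
    maximal integral curve in [U] through [p], obtained as the union of the
    images of all integral curves in [U] through [p]. *)
Definition orbit (X : R * R -> R * R) (U : R * R -> Prop) (p q : R * R) : Prop :=
  exists (a b : Rbar) (c : R -> R * R) (t : R),
    Rbar_lt a 0 /\ Rbar_lt 0 b /\ Rbar_lt a t /\ Rbar_lt t b /\
    integral_curve X U a b c /\ c 0 = p /\ c t = q.

Definition closed_in (U A : R * R -> Prop) : Prop :=
  exists F : R * R -> Prop, closed F /\ forall q, A q <-> U q /\ F q.

Definition orbits_closed (X : R * R -> R * R) : Prop :=
  exists U, germ_domain X U /\ forall p, U p -> closed_in U (orbit X U p).

(** For [X p <> (0, 0)] the curve [c] is not constant, and the orbit is then
    an embedded circle. *)
Definition periodic_orbit (X : R * R -> R * R) (V : R * R -> Prop)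
    (p : R * R) : Prop :=
  exists (c : R -> R * R) (T : R),
    integral_curve X V m_infty p_infty c /\ c 0 = p /\
    0 < T /\ forall t, c (t + T) = c t.

Definition center (X : R * R -> R * R) : Prop :=
  exists U, germ_domain X U /\
    let V := fun p => U p /\ p <> origin in
    forall p, V p -> X p <> (0, 0) -> periodic_orbit X V p.

Definition analytic_first_integral (X : R * R -> R * R) (f : R * R -> R) : Prop :=
  analytic_at f origin /\
  ~ locally origin (fun p => f p = f origin) /\
  locally origin (fun p => lie_derivative X f p = 0).

Definition analytic_coordinate_change (phi : R * R -> R * R) : Prop :=
  analytic_map_at phi origin /\ phi origin = origin /\
  exists psi : R * R -> R * R,
    analytic_map_at psi origin /\ psi origin = origin /\
    locally origin (fun p => psi (phi p) = p) /\
    locally origin (fun p => phi (psi p) = p).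

(** In the coordinates [y = phi x] the components of [X] are [X(phi_1)] and
    [X(phi_2)], expressed as functions of [y]. *)
Definition almost_linearizable (X : R * R -> R * R) : Prop :=
  exists (phi L : R * R -> R * R) (g : R * R -> R),
    analytic_coordinate_change phi /\ is_linear L /\ analytic_at g origin /\
    locally origin (fun p =>
      (lie_derivative X (fun q => fst (phi q)) p,
       lie_derivative X (fun q => snd (phi q)) p)
      = scal (g (phi p)) (L (phi p))).

(* Main.v *)
(** In the complex coordinate [z = x + i y] the field is [X z = - i z + ...]. For any such field
    there are a convergent change of variables [psi], tangent to the identity, and convergent real
    series [b], [e] with
      [dpsi_y ((1 + b(|y|^2)) (- i y)) = X (psi y) + e(|y|^2) y].
    The coefficients are found degree by degree; the resonant ones are split into a real part, which
    enters [b], and an imaginary part, the counterterm [e]. Since [b] is real, the remaining equation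
    only involves bounded operators on weighted l^1 spaces of coefficients, and its formal solution
    converges.

    If [e = 0], then in the coordinate [y] the field is [(1 + b(|y|^2)) (- i y)]: it is a multiple of
    the rotation field, its orbits are circles and [|y|^2] is a first integral. Otherwise [e] has a
    strict sign on a punctured neighbourhood and [|y|^2] is strictly monotone along the orbits. Then an
    orbit near the origin cannot be closed, since a point of it minimizing [|y|] could be moved
    further inwards; and a first integral is constant, by a maximum principle on small disks.
    Finally, comparing linear parts in an almost linear form [g L] shows that [L] is
    conjugate to a multiple of the rotation field, so that it has a quadratic first integral. *)
Require Import Defs.
From Stdlib Require Import Reals Lra Lia Classical ClassicalEpsilon.
From Coquelicot Require Import Coquelicot.
From Corelib Require Import ssreflect.
Open Scope R_scope.

(** * Real double series *)

Notation rsum := sum_f_R0.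

Lemma le_Rmin_l {x a b} : x <= Rmin a b -> x <= a.
Proof. by move=> h; apply: Rle_trans h (Rmin_l _ _). Qed.

Lemma le_Rmin_r {x a b} : x <= Rmin a b -> x <= b.
Proof. by move=> h; apply: Rle_trans h (Rmin_r _ _). Qed.

Lemma lt_Rmin_l {x a b} : x < Rmin a b -> x < a.
Proof. by move=> h; apply: Rlt_le_trans h (Rmin_l _ _). Qed.

Lemma lt_Rmin_r {x a b} : x < Rmin a b -> x < b.
Proof. by move=> h; apply: Rlt_le_trans h (Rmin_r _ _). Qed.

Lemma rsum_ext f g n : (forall k, (k <= n)%nat -> f k = g k) -> rsum f n = rsum g n.
Proof. exact: sum_eq. Qed.

Lemma rsum_le f g n : (forall k, (k <= n)%nat -> f k <= g k) -> rsum f n <= rsum g n.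
Proof. exact: sum_Rle. Qed.

Lemma rsum_plus f g n : rsum (fun k => f k + g k) n = rsum f n + rsum g n.
Proof. exact: sum_plus. Qed.

Lemma rsum_scal c f n : rsum (fun k => c * f k) n = c * rsum f n.
Proof. by elim: n => [|n IH] //=; rewrite IH; ring. Qed.

Lemma rsum_0 n : rsum (fun _ => 0) n = 0.
Proof. by elim: n => [|n IH] //=; rewrite IH; ring. Qed.

Lemma rsum_ge0 f n : (forall k, 0 <= f k) -> 0 <= rsum f n.
Proof. by move=> h; elim: n => [|n IH] //=; move: (h (S n)); lra. Qed.

Lemma rsum_mono f m n : (forall k, 0 <= f k) -> (m <= n)%nat -> rsum f m <= rsum f n.
Proof. by move=> h; elim: n / => [|n hn IH] /=; [lra|move: (h (S n)); lra]. Qed.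

Lemma rsum_term f k n : (forall k, 0 <= f k) -> (k <= n)%nat -> f k <= rsum f n.
Proof.
move=> h hk; apply: Rle_trans (rsum_mono f k n h hk).
case: k {hk} => [|k] /=; first lra.
by move: (rsum_ge0 f k h); lra.
Qed.

Lemma rsum_switch (x : nat -> nat -> R) m n :
  rsum (fun i => rsum (x i) n) m = rsum (fun j => rsum (fun i => x i j) m) n.
Proof.
elim: m => [|m IH] /=; first by apply: rsum_ext.
by rewrite IH -rsum_plus.
Qed.

Lemma rsum_shift f n : rsum f (S n) = f 0%nat + rsum (fun k => f (S k)) n.
Proof. by elim: n => [|n IH] //=; rewrite -Rplus_assoc -IH. Qed.

Lemma is_series_rsum (a : nat -> R) (l : R) : is_series a l <-> is_lim_seq (rsum a) l.
Proof.
rewrite /is_series /is_lim_seq.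
split=> h; apply: filterlim_ext h => n; by rewrite sum_n_Reals.
Qed.

Lemma ex_series_bounded (a : nat -> R) M :
  (forall n, 0 <= a n) -> (forall N, rsum a N <= M) -> ex_series a.
Proof.
move=> h0 hM.
case: (ex_finite_lim_seq_incr (rsum a) M) => [n||l hl] //.
  by move=> /=; move: (h0 (S n)); lra.
by exists l; apply/is_series_rsum.
Qed.

Lemma rsum_lim (a : nat -> R) : ex_series a -> is_lim_seq (rsum a) (Series a).
Proof. by move=> h; apply/is_series_rsum; apply: Series_correct. Qed.

Lemma Series_bounded (a : nat -> R) M :
  (forall n, 0 <= a n) -> (forall N, rsum a N <= M) -> Series a <= M.
Proof.
move=> h0 hM; have hex := ex_series_bounded a M h0 hM.
by have := is_lim_seq_le _ _ _ _ hM (rsum_lim a hex) (is_lim_seq_const M).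
Qed.

Lemma rsum_le_Series (a : nat -> R) N :
  (forall n, 0 <= a n) -> ex_series a -> rsum a N <= Series a.
Proof.
move=> h0 hex.
apply: (is_lim_seq_incr_compare (rsum a)); first exact: rsum_lim.
by move=> n /=; move: (h0 (S n)); lra.
Qed.

Lemma is_lim_seq_rsum (x : nat -> nat -> R) (l : nat -> R) J :
  (forall j, (j <= J)%nat -> is_lim_seq (x j) (l j)) ->
  is_lim_seq (fun k => rsum (fun j => x j k) J) (rsum l J).
Proof.
elim: J => [|J IH] h /=; first exact: h.
apply: is_lim_seq_plus'; last exact: h.
by apply: IH => j hj; apply: h; lia.
Qed.

Lemma is_series_switch (x : nat -> nat -> R) J :
  (forall j, (j <= J)%nat -> ex_series (x j)) ->
  is_series (fun k => rsum (fun j => x j k) J) (rsum (fun j => Series (x j)) J).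
Proof.
move=> h; apply/is_series_rsum.
apply: (is_lim_seq_ext (fun K => rsum (fun j => rsum (x j) K) J)).
  by move=> K; rewrite rsum_switch.
by apply: is_lim_seq_rsum => j hj; apply: rsum_lim; apply: h.
Qed.

Definition sq (x : nat -> nat -> R) N := rsum (fun j => rsum (x j) N) N.
Definition diag (x : nat -> nat -> R) n := rsum (fun i => x i (n - i)%nat) n.
Definition S2 (x : nat -> nat -> R) := Series (fun j => Series (x j)).

Lemma sq_mono x m n : (forall j k, 0 <= x j k) -> (m <= n)%nat -> sq x m <= sq x n.
Proof.
move=> h hmn; rewrite /sq.
apply: (Rle_trans _ (rsum (fun j => rsum (x j) n) m)).
  by apply: rsum_le => k _; apply: rsum_mono.
by apply: rsum_mono => // k; apply: rsum_ge0.
Qed.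

Lemma rect_le_sq x J K N : (forall j k, 0 <= x j k) -> (J <= N)%nat -> (K <= N)%nat ->
  rsum (fun j => rsum (x j) K) J <= sq x N.
Proof.
move=> h hJ hK; rewrite /sq.
apply: (Rle_trans _ (rsum (fun j => rsum (x j) N) J)).
  by apply: rsum_le => k _; apply: rsum_mono.
by apply: rsum_mono => // k; apply: rsum_ge0.
Qed.

Lemma tri_rows x N :
  rsum (diag x) N = rsum (fun j => rsum (x j) (N - j)) N.
Proof.
elim: N => [|N IH] //.
rewrite tech5 IH [in RHS]tech5 Nat.sub_diag /diag tech5 Nat.sub_diag -Rplus_assoc -rsum_plus.
congr (_ + _).
apply: rsum_ext => j hj.
by rewrite (_ : (S N - j)%nat = S (N - j)); last lia.
Qed.

Lemma tri_le_sq x N : (forall j k, 0 <= x j k) -> rsum (diag x) N <= sq x N.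
Proof.
move=> h; rewrite tri_rows; apply: rsum_le => j hj.
by apply: rsum_mono => //; lia.
Qed.

Lemma sq_le_tri x N : (forall j k, 0 <= x j k) -> sq x N <= rsum (diag x) (2 * N).
Proof.
move=> h; rewrite tri_rows.
apply: (Rle_trans _ (rsum (fun j => rsum (x j) (2 * N - j)) N)).
  by apply: rsum_le => j hj; apply: rsum_mono => //; lia.
by apply: rsum_mono; [move=> k; apply: rsum_ge0|lia].
Qed.

Definition dsummable (x : nat -> nat -> R) (l : R) :=
  (forall j, ex_series (x j)) /\ is_series (fun j => Series (x j)) l /\
  is_lim_seq (sq x) l /\ is_series (diag x) l.

Lemma dsummable_pos x M : (forall j k, 0 <= x j k) -> (forall N, sq x N <= M) ->
  exists l, dsummable x l.
Proof.
move=> h0 hM.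
have hr j : ex_series (x j).
  apply: (ex_series_bounded _ M) => // K.
  apply: Rle_trans (hM (Nat.max j K)).
  apply: (Rle_trans _ (rsum (fun j => rsum (x j) K) j)).
    by apply: (rsum_term (fun j => rsum (x j) K)) => // k; apply: rsum_ge0.
  by apply: rect_le_sq => //; lia.
case: (ex_finite_lim_seq_incr (sq x) M) => [n||l hl] //.
  by apply: sq_mono => //; lia.
have hle N : sq x N <= l.
  by apply: (is_lim_seq_incr_compare (sq x)) => // n; apply: sq_mono => //; lia.
have hS j : 0 <= Series (x j).
  by apply: Rle_trans (rsum_le_Series _ 0 _ _) => //=.
exists l; split => //; split; last split => //.
- apply/is_series_rsum.
  apply: (is_lim_seq_le_le (sq x) _ (fun _ => l)) => // [J|]; last exact: is_lim_seq_const.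
  split; first by apply: rsum_le => j _; apply: rsum_le_Series.
  rewrite -(is_series_unique _ _ (is_series_switch x J (fun j _ => hr j))).
  apply: Series_bounded => [n|N]; first exact: rsum_ge0.
  rewrite -rsum_switch; apply: Rle_trans (hle (Nat.max J N)).
  by apply: rect_le_sq => //; lia.
- have hd n : 0 <= diag x n by apply: rsum_ge0 => k.
  apply/is_series_rsum.
  have hex : ex_series (diag x).
    apply: (ex_series_bounded _ l) => // N.
    exact: Rle_trans (tri_le_sq x N h0) (hle N).
  have hlim := rsum_lim _ hex.
  suff -> : l = Series (diag x) by [].
  apply: Rle_antisym.
    have : Rbar_le l (Series (diag x)).
      apply: (is_lim_seq_le (sq x) (fun N => rsum (diag x) (2 * N))) => //.
        by move=> n; apply: sq_le_tri.
      by apply: (is_lim_seq_subseq _ _ (fun n => (2 * n)%nat)) => //; apply: eventually_subseq => n; lia.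
    by [].
  apply: Series_bounded => // N.
  exact: Rle_trans (tri_le_sq x N h0) (hle N).
Qed.

Lemma sq_lin x y c d N : sq (fun j k => c * x j k + d * y j k) N = c * sq x N + d * sq y N.
Proof.
rewrite /sq -!rsum_scal -rsum_plus; apply: rsum_ext => j _.
by rewrite rsum_plus !rsum_scal.
Qed.

Lemma sq_scal c x N : sq (fun j k => c * x j k) N = c * sq x N.
Proof. by rewrite /sq -rsum_scal; apply: rsum_ext => j _; apply: rsum_scal. Qed.

Lemma dsummable_lin x y c d l m : dsummable x l -> dsummable y m ->
  dsummable (fun j k => c * x j k + d * y j k) (c * l + d * m).
Proof.
move=> [a1 [a2 [a3 a4]]] [b1 [b2 [b3 b4]]]; split; last split; last split.
- move=> j; apply: (ex_series_plus (fun k => c * x j k) (fun k => d * y j k)).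
    exact: ex_series_scal_l.
  exact: ex_series_scal_l.
- apply: (is_series_ext (fun j => c * Series (x j) + d * Series (y j))).
    move=> j; rewrite Series_plus ?Series_scal_l //; exact: (ex_series_scal_l).
  by apply: is_series_plus; apply: is_series_scal_l.
- apply: (is_lim_seq_ext (fun N => c * sq x N + d * sq y N)).
    by move=> N; rewrite sq_lin.
  by apply: is_lim_seq_plus'; apply: (is_lim_seq_scal_l _ _ (Finite _)).
- apply: (is_series_ext (fun j => c * diag x j + d * diag y j)).
    by move=> n; rewrite /diag rsum_plus !rsum_scal.
  by apply: is_series_plus; apply: is_series_scal_l.
Qed.

Lemma dsummable_ext x y l : (forall j k, x j k = y j k) -> dsummable x l -> dsummable y l.
Proof.
move=> h [a1 [a2 [a3 a4]]]; split; last split; last split.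
- by move=> j; apply: ex_series_ext (a1 j) => k.
- by apply: is_series_ext a2 => j; apply: Series_ext.
- apply: is_lim_seq_ext a3 => N; rewrite /sq.
  by apply: rsum_ext => j _; apply: rsum_ext.
- by apply: is_series_ext a4 => n; apply: rsum_ext.
Qed.

Lemma dsummable_unique x l : dsummable x l -> l = S2 x.
Proof. by move=> [_ [h _]]; rewrite /S2 (is_series_unique _ _ h). Qed.

Lemma dsummable_abs x M : (forall N, sq (fun j k => Rabs (x j k)) N <= M) ->
  dsummable x (S2 x).
Proof.
move=> hM.
have [l hl] := dsummable_pos (fun j k => Rabs (x j k)) M (fun _ _ => Rabs_pos _) hM.
have [m hm] : exists m, dsummable (fun j k => 1 * Rabs (x j k) + 1 * x j k) m.
  apply: (dsummable_pos _ (2 * M)) => [j k|N].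
    by rewrite /Rabs; case: Rcase_abs; lra.
  rewrite sq_lin.
  have : sq x N <= sq (fun j k => Rabs (x j k)) N.
    by apply: rsum_le => j _; apply: rsum_le => k _; apply: Rle_abs.
  by move: (hM N); lra.
have h := dsummable_lin _ _ 1 (-1) _ _ hm hl.
have h' := dsummable_ext _ x _ _ h.
have /h' {}h : forall j k, 1 * (1 * Rabs (x j k) + 1 * x j k) + -1 * Rabs (x j k) = x j k.
  by move=> j k; ring.
by rewrite -(dsummable_unique _ _ h).
Qed.

Lemma sq_transpose x N : sq (fun j k => x k j) N = sq x N.
Proof. by rewrite /sq rsum_switch. Qed.

Lemma S2_transpose x M : (forall N, sq (fun j k => Rabs (x j k)) N <= M) ->
  S2 (fun j k => x k j) = S2 x.
Proof.
move=> hM.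
have [_ [_ [h1 _]]] := dsummable_abs _ _ hM.
have [_ [_ [h2 _]]] : dsummable (fun j k => x k j) (S2 (fun j k => x k j)).
  apply: (dsummable_abs _ M) => N.
  by rewrite (sq_transpose (fun j k => Rabs (x j k))).
have h3 : is_lim_seq (sq x) (S2 (fun j k => x k j)).
  by apply: is_lim_seq_ext h2 => N; rewrite sq_transpose.
by move: (is_lim_seq_unique _ _ h3); rewrite (is_lim_seq_unique _ _ h1) => -[].
Qed.

(** * Complex series *)

Definition csum (f : nat -> C) n : C :=
  (rsum (fun k => fst (f k)) n, rsum (fun k => snd (f k)) n).
Definition CS (f : nat -> C) : C :=
  (Series (fun k => fst (f k)), Series (fun k => snd (f k))).
Definition CS2 (x : nat -> nat -> C) : C := CS (fun j => CS (x j)).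
Definition summ (f : nat -> C) := ex_series (fun k => Cmod (f k)).
Definition conv (f g : nat -> C) n := csum (fun k => (f k * g (n - k)%nat)%C) n.

Lemma Ceq (z w : C) : fst z = fst w -> snd z = snd w -> z = w.
Proof. by case: z w => [a b] [c d] /= -> ->. Qed.

Ltac Cring := apply: Ceq => /=; ring.

Lemma Csub_add (z w : C) : z = ((z - w) + w)%C.
Proof. ring. Qed.

Lemma Cmod_le_dist (y z : C) : Cmod z <= Cmod y + Cmod (y - z)%C.
Proof.
have {1}-> : z = (y + - (y - z))%C by ring.
by apply: Rle_trans (Cmod_triangle _ _) _; rewrite Cmod_opp; lra.
Qed.

Lemma Cplus_origin (h : C) : (origin + h)%C = h.
Proof. by Cring. Qed.

Lemma csumS f n : csum f (S n) = (csum f n + f (S n))%C.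
Proof. by []. Qed.

Lemma csum_ext f g n : (forall k, (k <= n)%nat -> f k = g k) -> csum f n = csum g n.
Proof. by move=> h; apply: Ceq => /=; apply: rsum_ext => k hk; rewrite h. Qed.

Lemma csum_scal c f n : csum (fun k => c * f k)%C n = (c * csum f n)%C.
Proof.
elim: n => [|n IH]; first by apply: Ceq.
by rewrite !csumS IH; ring.
Qed.

Lemma csum_0 n : csum (fun _ => RtoC 0) n = 0%C.
Proof. by apply: Ceq => /=; apply: rsum_0. Qed.

Lemma csum_eq0 (f : nat -> C) n : (forall k, (k <= n)%nat -> f k = 0%C) -> csum f n = 0%C.
Proof. by move=> h; rewrite -(csum_0 n); apply: csum_ext. Qed.

Lemma Cmod_csum f n : Cmod (csum f n) <= rsum (fun k => Cmod (f k)) n.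
Proof.
elim: n => [|n IH]; first by apply: Req_le; congr Cmod; apply: Ceq.
rewrite csumS /=; apply: Rle_trans (Cmod_triangle _ _) _; lra.
Qed.

Lemma csum_single (f : nat -> C) n k : (k <= n)%nat -> (forall i, (i <= n)%nat -> i <> k -> f i = 0%C) ->
  csum f n = f k.
Proof.
elim: n => [|n IH] hk h.
  have -> : k = 0%nat by lia.
  exact: Ceq.
rewrite csumS; case: (Nat.eq_dec k (S n)) => [ek|hne].
  rewrite ek.
  rewrite csum_eq0; first by ring.
  by move=> i hi; apply: h; lia.
rewrite IH; [|lia|by move=> i hi; apply: h; lia].
by rewrite (h (S n)) //; [ring|lia].
Qed.

Lemma fst_le_Cmod (z : C) : Rabs (fst z) <= Cmod z.
Proof. exact: Rle_trans (Rmax_l _ _) (Rmax_Cmod z). Qed.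

Lemma snd_le_Cmod (z : C) : Rabs (snd z) <= Cmod z.
Proof. exact: Rle_trans (Rmax_r _ _) (Rmax_Cmod z). Qed.

Lemma ex_series_dom (a b : nat -> R) : (forall n, Rabs (a n) <= b n) -> ex_series b ->
  ex_series (fun n => Rabs (a n)).
Proof.
move=> h; apply: ex_series_le => n.
by rewrite /norm /= /abs /= Rabs_Rabsolu.
Qed.

Lemma summ_fst f : summ f -> ex_series (fun k => Rabs (fst (f k))).
Proof. by apply: ex_series_dom => n; apply: fst_le_Cmod. Qed.

Lemma summ_snd f : summ f -> ex_series (fun k => Rabs (snd (f k))).
Proof. by apply: ex_series_dom => n; apply: snd_le_Cmod. Qed.

Lemma CS_ext f g : (forall k, f k = g k) -> CS f = CS g.
Proof. by move=> h; apply: Ceq; apply: Series_ext => k; rewrite h. Qed.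

Lemma CS2_ext x y : (forall j k, x j k = y j k) -> CS2 x = CS2 y.
Proof. by move=> h; apply: CS_ext => j; apply: CS_ext. Qed.

Lemma summ_bounded f M : (forall N, rsum (fun k => Cmod (f k)) N <= M) -> summ f.
Proof. by move=> h; apply: (ex_series_bounded _ M) => // n; apply: Cmod_ge_0. Qed.

Lemma CS_plus f g : summ f -> summ g -> CS (fun k => f k + g k)%C = (CS f + CS g)%C.
Proof.
move=> hf hg; apply: Ceq => /=; apply: Series_plus; apply: ex_series_Rabs;
  by [apply: summ_fst|apply: summ_snd].
Qed.

Lemma CS_scal c f : summ f -> CS (fun k => c * f k)%C = (c * CS f)%C.
Proof.
move=> hf.
have h1 := ex_series_Rabs _ (summ_fst _ hf).
have h2 := ex_series_Rabs _ (summ_snd _ hf).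
apply: Ceq => /=.
  rewrite Series_minus ?Series_scal_l //; exact: (ex_series_scal_l).
rewrite Series_plus ?Series_scal_l //; exact: (ex_series_scal_l).
Qed.

Lemma CS_csum (x : nat -> nat -> C) J : (forall j, (j <= J)%nat -> summ (x j)) ->
  CS (fun k => csum (fun j => x j k) J) = csum (fun j => CS (x j)) J.
Proof.
move=> h; apply: Ceq => /=; apply: is_series_unique;
  apply: (is_series_switch (fun j k => _ (x j k))) => j hj; apply: ex_series_Rabs;
  by [apply: summ_fst; apply: h|apply: summ_snd; apply: h].
Qed.

Lemma Series_fin (f : nat -> R) n : (forall k, (n < k)%nat -> f k = 0) -> Series f = rsum f n.
Proof.
move=> h; apply: is_series_unique; apply/is_series_rsum.
apply: is_lim_seq_ext_loc (is_lim_seq_const _); exists n => m hm.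
elim: m / hm => [//|m hm IH].
by rewrite tech5 -IH h; [ring|lia].
Qed.

Lemma CS_fin (f : nat -> C) n : (forall k, (n < k)%nat -> f k = 0%C) -> CS f = csum f n.
Proof. by move=> h; apply: Ceq => /=; apply: Series_fin => k hk; rewrite h. Qed.

Lemma is_series_conv_R (a b : nat -> R) : ex_series (fun n => Rabs (a n)) ->
  ex_series (fun n => Rabs (b n)) ->
  is_series (fun n => rsum (fun k => a k * b (n - k)%nat) n) (Series a * Series b).
Proof.
move=> ha hb.
apply: is_series_mult => //; apply: Series_correct; exact: ex_series_Rabs.
Qed.

Lemma CS_conv f g : summ f -> summ g -> CS (conv f g) = (CS f * CS g)%C.
Proof.
move=> hf hg.
have f1 := summ_fst _ hf. have f2 := summ_snd _ hf.
have g1 := summ_fst _ hg. have g2 := summ_snd _ hg.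
apply: Ceq => /=.
  rewrite -(is_series_unique _ _ (is_series_conv_R _ _ f1 g1)).
  rewrite -(is_series_unique _ _ (is_series_conv_R _ _ f2 g2)).
  rewrite -Series_minus.
  - apply: Series_ext => n; exact: minus_sum.
  - eexists; exact: (is_series_conv_R _ _ f1 g1).
  - eexists; exact: (is_series_conv_R _ _ f2 g2).
rewrite -(is_series_unique _ _ (is_series_conv_R _ _ f1 g2)).
rewrite -(is_series_unique _ _ (is_series_conv_R _ _ f2 g1)).
rewrite -Series_plus.
- apply: Series_ext => n; exact: rsum_plus.
- eexists; exact: (is_series_conv_R _ _ f1 g2).
- eexists; exact: (is_series_conv_R _ _ f2 g1).
Qed.

Lemma rconv_le (a b : nat -> R) N : (forall n, 0 <= a n) -> (forall n, 0 <= b n) ->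
  rsum (fun n => rsum (fun k => a k * b (n - k)%nat) n) N <= rsum a N * rsum b N.
Proof.
move=> ha hb.
have := tri_le_sq (fun i j => a i * b j) N.
rewrite /diag /sq => h; apply: Rle_trans (h _) _; first by move=> j k; apply: Rmult_le_pos.
apply: Req_le.
rewrite (rsum_ext _ (fun j => rsum b N * a j)).
  by rewrite rsum_scal; ring.
by move=> k _; rewrite rsum_scal; ring.
Qed.

Lemma is_lim_seq_Cmod (u : nat -> C) (l : C) :
  is_lim_seq (fun n => fst (u n)) (fst l) -> is_lim_seq (fun n => snd (u n)) (snd l) ->
  is_lim_seq (fun n => Cmod (u n)) (Cmod l).
Proof.
move=> h1 h2; rewrite /Cmod.
apply: is_lim_seq_continuous.
  by apply: continuity_pt_sqrt; nra.
by rewrite /=; apply: is_lim_seq_plus'; apply: is_lim_seq_mult' => //;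
  apply: is_lim_seq_mult' => //; apply: is_lim_seq_const.
Qed.

Definition csq (x : nat -> nat -> C) N := csum (fun j => csum (x j) N) N.
Definition sqb (M : R) (x : nat -> nat -> C) := forall N, sq (fun j k => Cmod (x j k)) N <= M.

Lemma sq_le x y N : (forall j k, x j k <= y j k) -> sq x N <= sq y N.
Proof. by move=> h; apply: rsum_le => j _; apply: rsum_le. Qed.

Lemma Cmod_csq x N : Cmod (csq x N) <= sq (fun j k => Cmod (x j k)) N.
Proof.
apply: Rle_trans (Cmod_csum _ _) _; apply: rsum_le => j _; exact: Cmod_csum.
Qed.

Section Sqb.
Variables (M : R) (x : nat -> nat -> C).
Hypothesis hx : sqb M x.

Lemma sqb_fst : dsummable (fun j k => fst (x j k)) (fst (CS2 x)).
Proof.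
apply: (dsummable_abs _ M) => N; apply: Rle_trans (hx N).
apply: sq_le => j k; exact: fst_le_Cmod.
Qed.

Lemma sqb_snd : dsummable (fun j k => snd (x j k)) (snd (CS2 x)).
Proof.
apply: (dsummable_abs _ M) => N; apply: Rle_trans (hx N).
apply: sq_le => j k; exact: snd_le_Cmod.
Qed.

Lemma sqb_lim : is_lim_seq (fun N => fst (csq x N)) (fst (CS2 x)) /\
  is_lim_seq (fun N => snd (csq x N)) (snd (CS2 x)).
Proof.
have [_ [_ [h1 _]]] := sqb_fst; have [_ [_ [h2 _]]] := sqb_snd; by split.
Qed.

Lemma sqb_lim_Cmod : is_lim_seq (fun N => Cmod (csq x N)) (Cmod (CS2 x)).
Proof. by have [h1 h2] := sqb_lim; apply: is_lim_seq_Cmod. Qed.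

Lemma sqb_bound : Cmod (CS2 x) <= M.
Proof.
have h N : Cmod (csq x N) <= M by apply: Rle_trans (Cmod_csq x N) (hx N).
by have := is_lim_seq_le _ _ _ _ h sqb_lim_Cmod (is_lim_seq_const M).
Qed.

Lemma sqb_row j : summ (x j).
Proof.
have [l [h _]] := dsummable_pos _ _ (fun j k => Cmod_ge_0 (x j k)) hx.
exact: h.
Qed.

Lemma sqb_rows : summ (fun j => CS (x j)).
Proof.
apply: (summ_bounded _ M) => N.
have h1 K : rsum (fun j => Cmod (csum (x j) K)) N <= M.
  apply: Rle_trans (hx (Nat.max N K)).
  apply: Rle_trans (rect_le_sq (fun j k => Cmod (x j k)) N K _ _ _ _).
  - by apply: rsum_le => j _; apply: Cmod_csum.
  - by move=> j k; apply: Cmod_ge_0.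
  - lia.
  - lia.
have h2 : is_lim_seq (fun K => rsum (fun j => Cmod (csum (x j) K)) N)
    (rsum (fun j => Cmod (CS (x j))) N).
  apply: is_lim_seq_rsum => j _; apply: is_lim_seq_Cmod; apply: rsum_lim;
    apply: ex_series_Rabs.
    by apply: summ_fst; apply: sqb_row.
  by apply: summ_snd; apply: sqb_row.
by have := is_lim_seq_le _ _ _ _ h1 h2 (is_lim_seq_const M).
Qed.

Lemma CS2_transpose : CS2 (fun j k => x k j) = CS2 x.
Proof.
apply: Ceq.
  apply: (S2_transpose (fun j k => fst (x j k)) M) => N; apply: Rle_trans (hx N).
  by apply: sq_le => j k; exact: fst_le_Cmod.
apply: (S2_transpose (fun j k => snd (x j k)) M) => N; apply: Rle_trans (hx N).
by apply: sq_le => j k; exact: snd_le_Cmod.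
Qed.

Lemma CS2_scal c : CS2 (fun j k => c * x j k)%C = (c * CS2 x)%C.
Proof.
rewrite /CS2 -CS_scal; last exact: sqb_rows.
by apply: CS_ext => j; apply: CS_scal; apply: sqb_row.
Qed.
End Sqb.

Lemma CS2_plus M M' x y : sqb M x -> sqb M' y ->
  CS2 (fun j k => x j k + y j k)%C = (CS2 x + CS2 y)%C.
Proof.
move=> hx hy; rewrite /CS2 -CS_plus; [|exact: sqb_rows hx|exact: sqb_rows hy].
by apply: CS_ext => j; apply: CS_plus; [exact: sqb_row hx j|exact: sqb_row hy j].
Qed.

Lemma CS2_fin (x : nat -> nat -> C) n : (forall j k, (n < j + k)%nat -> x j k = 0%C) -> CS2 x = csq x n.
Proof.
move=> h; rewrite /CS2 (CS_fin _ n).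
  by apply: csum_ext => j hj; apply: CS_fin => k hk; apply: h; lia.
move=> j hj; rewrite (CS_fin _ 0) => [|k hk]; last by apply: h; lia.
by apply: csum_eq0 => k hk; apply: h; lia.
Qed.

(** * Power series in two variables *)

Notation PS := (nat -> nat -> C).

(* The norm [sum |a j k| s^(j + k)] is at most [M]. *)
Definition bnd (s M : R) (a : PS) := forall N, sq (fun j k => Cmod (a j k) * s ^ (j + k)) N <= M.
(* [sum a j k z^j w^k], with a junk value where the series does not converge absolutely. *)
Definition ev (a : PS) (z w : C) : C := CS2 (fun j k => a j k * (z ^ j * w ^ k))%C.

Definition padd (a b : PS) : PS := fun j k => (a j k + b j k)%C.
Definition pscal (c : C) (a : PS) : PS := fun j k => (c * a j k)%C.
Definition pmul (a b : PS) : PS := fun j k =>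
  csum (fun p => csum (fun q => a p q * b (j - p)%nat (k - q)%nat)%C k) j.
Definition pconst (c : C) : PS := fun j k => match j, k with 0%nat, 0%nat => c | _, _ => 0%C end.
Definition pX : PS := fun j k => match j, k with 1%nat, 0%nat => 1%C | _, _ => 0%C end.
Definition pY : PS := fun j k => match j, k with 0%nat, 1%nat => 1%C | _, _ => 0%C end.
Fixpoint pw (u : PS) (m : nat) : PS :=
  match m with 0%nat => pconst 1 | S m => pmul u (pw u m) end.
Definition Comp (F u v : PS) : PS := fun j k =>
  CS2 (fun m i => F m i * pmul (pw u m) (pw v i) j k)%C.

Lemma sq_ext x y N : (forall j k, x j k = y j k) -> sq x N = sq y N.
Proof. by move=> h; apply: rsum_ext => j _; apply: rsum_ext => k _. Qed.

Lemma bnd_ext s M a b : (forall j k, a j k = b j k) -> bnd s M a -> bnd s M b.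
Proof.
move=> h ha N; apply: Rle_trans (ha N); apply: Req_le; apply: sq_ext => j k.
by rewrite h.
Qed.

Lemma ev_ext a b z w : (forall j k, a j k = b j k) -> ev a z w = ev b z w.
Proof. by move=> h; apply: CS2_ext => j k; rewrite h. Qed.

Lemma bnd_le s M s' M' a : 0 <= s' <= s -> M <= M' -> bnd s M a -> bnd s' M' a.
Proof.
move=> hs hM ha N; apply: Rle_trans hM; apply: Rle_trans (ha N).
apply: sq_le => j k; apply: Rmult_le_compat_l; first exact: Cmod_ge_0.
by apply: pow_incr.
Qed.

Lemma bnd_ge0 s M a : 0 <= s -> bnd s M a -> 0 <= M.
Proof.
move=> hs ha; apply: Rle_trans (ha 0%nat); rewrite /sq /=.
apply: Rmult_le_pos; [exact: Cmod_ge_0|lra].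
Qed.

Lemma bnd_dom s M a b : 0 <= s -> (forall j k, Cmod (b j k) <= Cmod (a j k)) ->
  bnd s M a -> bnd s M b.
Proof.
move=> hs h ha N; apply: Rle_trans (ha N); apply: sq_le => j k.
by apply: Rmult_le_compat_r; [apply: pow_le|apply: h].
Qed.

Lemma bnd_coef s M a j k : 0 <= s -> bnd s M a -> Cmod (a j k) * s ^ (j + k) <= M.
Proof.
move=> hs ha; apply: Rle_trans (ha (Nat.max j k)).
have h0 p q : 0 <= Cmod (a p q) * s ^ (p + q).
  by apply: Rmult_le_pos; [exact: Cmod_ge_0|apply: pow_le].
apply: Rle_trans (rect_le_sq (fun j k => Cmod (a j k) * s ^ (j + k)) j k _ h0 _ _); try lia.
apply: Rle_trans (rsum_term (fun j => rsum (fun k => Cmod (a j k) * s ^ (j + k)) k) j j _ _) => //.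
  by apply: (rsum_term (fun q => Cmod (a j q) * s ^ (j + q)) k k).
by move=> p; apply: rsum_ge0.
Qed.

Lemma bnd_padd s M M' a b : 0 <= s -> bnd s M a -> bnd s M' b -> bnd s (M + M') (padd a b).
Proof.
move=> hs ha hb N; move: (ha N) (hb N).
have h := sq_lin (fun j k => Cmod (a j k) * s ^ (j + k)) (fun j k => Cmod (b j k) * s ^ (j + k))
  1 1 N.
suff : sq (fun j k => Cmod (padd a b j k) * s ^ (j + k)) N <=
 sq (fun j k => 1 * (Cmod (a j k) * s ^ (j + k)) + 1 * (Cmod (b j k) * s ^ (j + k))) N by lra.
apply: sq_le => j k; have := Cmod_triangle (a j k) (b j k).
have := pow_le s (j + k) hs; rewrite /padd; nra.
Qed.

Arguments bnd_padd {s M M' a b}.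
Lemma bnd_pscal s M c a : bnd s M a -> bnd s (Cmod c * M) (pscal c a).
Proof.
move=> ha N.
rewrite (sq_ext _ (fun j k => Cmod c * (Cmod (a j k) * s ^ (j + k)))).
  by rewrite sq_scal; apply: Rmult_le_compat_l => //; apply: Cmod_ge_0.
by move=> j k; rewrite /pscal Cmod_mult; ring.
Qed.

Lemma pow_term_le s (z w : C) j k : Cmod z <= s -> Cmod w <= s ->
  Cmod (z ^ j * w ^ k)%C <= s ^ (j + k).
Proof.
move=> hz hw; rewrite Cmod_mult !Cmod_pow pow_add.
apply: Rmult_le_compat; try (apply: pow_le; exact: Cmod_ge_0);
  apply: pow_incr; by split=> //; apply: Cmod_ge_0.
Qed.

Lemma bnd_sqb s M a (z w : C) : Cmod z <= s -> Cmod w <= s -> bnd s M a ->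
  sqb M (fun j k => a j k * (z ^ j * w ^ k))%C.
Proof.
move=> hz hw ha N; apply: Rle_trans (ha N); apply: sq_le => j k.
rewrite Cmod_mult; apply: Rmult_le_compat_l; first exact: Cmod_ge_0.
exact: pow_term_le.
Qed.

Section Ev.
Variables (s : R) (z w : C).
Hypotheses (hz : Cmod z <= s) (hw : Cmod w <= s).

Lemma ev_bound M a : bnd s M a -> Cmod (ev a z w) <= M.
Proof. by move=> ha; apply: sqb_bound; apply: bnd_sqb ha. Qed.

Lemma ev_padd M M' a b : bnd s M a -> bnd s M' b ->
  ev (padd a b) z w = (ev a z w + ev b z w)%C.
Proof.
move=> ha hb; rewrite /ev -(CS2_plus _ _ _ _ (bnd_sqb _ _ _ _ _ hz hw ha) (bnd_sqb _ _ _ _ _ hz hw hb)).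
by apply: CS2_ext => j k; rewrite /padd; ring.
Qed.

Lemma ev_pscal M c a : bnd s M a -> ev (pscal c a) z w = (c * ev a z w)%C.
Proof.
move=> ha; rewrite /ev -(CS2_scal _ _ (bnd_sqb _ _ _ _ _ hz hw ha)).
by apply: CS2_ext => j k; rewrite /pscal; ring.
Qed.

Lemma Cpow_split (x : C) p j : (p <= j)%nat -> (x ^ j = x ^ p * x ^ (j - p))%C.
Proof.
move=> h; rewrite {1}(_ : j = (p + (j - p))%nat); last lia.
move: (j - p)%nat => d; elim: p {h} => [|p IH]; first by rewrite /=; ring.
by rewrite /= IH; ring.
Qed.

Lemma ev_pmul M M' a b : bnd s M a -> bnd s M' b ->
  ev (pmul a b) z w = (ev a z w * ev b z w)%C.
Proof.
move=> ha hb.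
have hA := bnd_sqb _ _ _ _ _ hz hw ha; have hB := bnd_sqb _ _ _ _ _ hz hw hb.
rewrite /ev /CS2 -CS_conv; [|exact: sqb_rows hA|exact: sqb_rows hB].
apply: CS_ext => j; rewrite /conv.
set al := (fun j k => (a j k * (z ^ j * w ^ k))%C).
set be := (fun j k => (b j k * (z ^ j * w ^ k))%C).
rewrite (CS_ext _ (fun k => csum (fun p => conv (al p) (be (j - p)%nat) k) j)).
  rewrite CS_csum.
    apply: csum_ext => p hp; apply: CS_conv; [exact: sqb_row hA p|exact: sqb_row hB _].
  move=> p hp.
  have ea := sqb_row _ _ hA p; have eb := sqb_row _ _ hB (j - p)%nat.
  apply: (summ_bounded _ (Series (fun k => Cmod (al p k)) * Series (fun k => Cmod (be (j - p)%nat k)))) => N.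
  apply: (Rle_trans _ (rsum (fun k => Cmod (al p k)) N * rsum (fun k => Cmod (be (j - p)%nat k)) N)).
    apply: Rle_trans (rconv_le (fun k => Cmod (al p k)) (fun k => Cmod (be (j - p)%nat k)) N _ _).
    - apply: rsum_le => n _; apply: Rle_trans (Cmod_csum _ _) _; apply: Req_le.
      by apply: rsum_ext => k _; rewrite Cmod_mult.
    - by move=> n; apply: Cmod_ge_0.
    - by move=> n; apply: Cmod_ge_0.
  apply: Rmult_le_compat.
  - by apply: rsum_ge0 => n; apply: Cmod_ge_0.
  - by apply: rsum_ge0 => n; apply: Cmod_ge_0.
  - by apply: rsum_le_Series => // n; apply: Cmod_ge_0.
  - by apply: rsum_le_Series => // n; apply: Cmod_ge_0.
move=> k; rewrite /pmul Cmult_comm -csum_scal; apply: csum_ext => p hp.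
rewrite /conv -csum_scal; apply: csum_ext => q hq.
by rewrite /al /be (Cpow_split z p j hp) (Cpow_split w q k hq); ring.
Qed.
End Ev.

Arguments ev_padd {s z w} hz hw {M M' a b}.
Arguments ev_pmul {s z w} hz hw {M M' a b}.
Arguments ev_pscal {s z w} hz hw {M c a}.
Arguments ev_bound {s z w} hz hw {M a}.
Lemma bnd_pmul s M M' a b : 0 <= s -> bnd s M a -> bnd s M' b -> bnd s (M * M') (pmul a b).
Proof.
move=> hs ha hb N.
set al := (fun j k => Cmod (a j k) * s ^ (j + k)).
set be := (fun j k => Cmod (b j k) * s ^ (j + k)).
have h0 (c : PS) j k : 0 <= Cmod (c j k) * s ^ (j + k).
  by apply: Rmult_le_pos; [exact: Cmod_ge_0|apply: pow_le].
apply: (Rle_trans _ (sq al N * sq be N)); last first.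
  apply: Rmult_le_compat => //; try (apply: rsum_ge0 => j; apply: rsum_ge0 => k; exact: h0).
rewrite {2 3}/sq.
apply: Rle_trans (rconv_le (fun j => rsum (al j) N) (fun j => rsum (be j) N) N _ _);
  try (move=> j; apply: rsum_ge0 => k; exact: h0).
apply: rsum_le => j _.
apply: (Rle_trans _ (rsum (fun k => rsum (fun p => rsum (fun q => al p q * be (j - p)%nat (k - q)%nat) k) j) N)).
  apply: rsum_le => k _.
  rewrite Rmult_comm; apply: (Rle_trans _ (s ^ (j + k) * rsum (fun p => rsum (fun q => Cmod (a p q) * Cmod (b (j - p)%nat (k - q)%nat)) k) j)).
    apply: Rmult_le_compat_l; first exact: pow_le.
    apply: Rle_trans (Cmod_csum _ _) _; apply: rsum_le => p _.
    apply: Rle_trans (Cmod_csum _ _) _; apply: rsum_le => q _.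
    by rewrite Cmod_mult; lra.
  apply: Req_le; rewrite -rsum_scal; apply: rsum_ext => p hp.
  rewrite -rsum_scal; apply: rsum_ext => q hq; rewrite /al /be.
  have -> : (j + k = (p + q) + ((j - p) + (k - q)))%nat by lia.
  rewrite pow_add; ring.
rewrite rsum_switch; apply: rsum_le => p _.
apply: (rconv_le (al p) (be (j - p)%nat)) => k; exact: h0.
Qed.

Arguments bnd_pmul {s M M' a b}.
Lemma csq_tail0 (x : nat -> nat -> C) : (forall j k, (1 < j + k)%nat -> x j k = 0%C) ->
  CS2 x = (x 0%nat 0%nat + x 1%nat 0%nat + x 0%nat 1%nat)%C.
Proof.
move=> h; rewrite (CS2_fin _ 1) // /csq /csum /=.
rewrite (h 1%nat 1%nat); last lia.
by Cring.
Qed.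

Lemma ev_pconst c z w : ev (pconst c) z w = c.
Proof.
rewrite /ev csq_tail0; first by rewrite /=; ring.
by case=> [|j] [|k] hjk /=; try ring; exfalso; lia.
Qed.

Lemma ev_pX z w : ev pX z w = z.
Proof.
rewrite /ev csq_tail0; first by rewrite /=; ring.
by case=> [|[|j]] [|k] hjk /=; try ring; exfalso; lia.
Qed.

Lemma ev_pY z w : ev pY z w = w.
Proof.
rewrite /ev csq_tail0; first by rewrite /=; ring.
by case=> [|j] [|[|k]] hjk /=; try ring; exfalso; lia.
Qed.

Lemma bnd_deg1 s M (a : PS) : 0 <= s -> (forall j k, (1 < j + k)%nat -> a j k = 0%C) ->
  Cmod (a 0%nat 0%nat) + s * Cmod (a 1%nat 0%nat) + s * Cmod (a 0%nat 1%nat) <= M -> bnd s M a.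
Proof.
move=> hs h hM N; apply: Rle_trans hM.
set x := (fun j k => Cmod (a j k) * s ^ (j + k)).
have hx0 j k : 0 <= x j k by apply: Rmult_le_pos; [exact: Cmod_ge_0|apply: pow_le].
have hx j k : (1 < j + k)%nat -> x j k = 0 by move=> hjk; rewrite /x h // Cmod_0; ring.
apply: Rle_trans (sq_le_tri _ _ hx0) _.
have -> : Cmod (a 0%nat 0%nat) + s * Cmod (a 1%nat 0%nat) + s * Cmod (a 0%nat 1%nat)
  = rsum (diag x) 1 by rewrite /diag /x /=; ring.
have hd n : (1 < n)%nat -> diag x n = 0.
  move=> hn; rewrite /diag (rsum_ext _ (fun _ => 0)) ?rsum_0 // => k hk.
  by apply: hx; lia.
have hd0 n : 0 <= diag x n by apply: rsum_ge0.
have : forall m, rsum (diag x) m <= rsum (diag x) 1.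
  elim=> [|m IH]; first by apply: rsum_mono; auto.
  case: m IH => [|m] IH; first lra.
  by rewrite tech5 (hd (S (S m))); [lra|lia].
exact.
Qed.

Lemma bnd_pconst s c : 0 <= s -> bnd s (Cmod c) (pconst c).
Proof.
move=> hs; apply: bnd_deg1 => //.
  by case=> [|j] [|k] hjk //=; exfalso; lia.
by rewrite /= !Cmod_0; lra.
Qed.

Lemma bnd_pX s : 0 <= s -> bnd s s pX.
Proof.
move=> hs; apply: bnd_deg1 => //.
  by case=> [|[|j]] [|k] hjk //=; exfalso; lia.
by rewrite /= !Cmod_0 Cmod_1; lra.
Qed.

Lemma bnd_pY s : 0 <= s -> bnd s s pY.
Proof.
move=> hs; apply: bnd_deg1 => //.
  by case=> [|j] [|[|k]] hjk //=; exfalso; lia.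
by rewrite /= !Cmod_0 Cmod_1; lra.
Qed.

Lemma bnd_pw s R u m : 0 <= s -> bnd s R u -> bnd s (R ^ m) (pw u m).
Proof.
move=> hs hu; elim: m => [|m IH] /=; last exact: bnd_pmul.
by have := bnd_pconst s 1 hs; rewrite Cmod_1.
Qed.

Lemma ev_pw s R u m z w : Cmod z <= s -> Cmod w <= s -> bnd s R u ->
  ev (pw u m) z w = (ev u z w ^ m)%C.
Proof.
move=> hz hw hu; have hs : 0 <= s by apply: Rle_trans (Cmod_ge_0 z) hz.
elim: m => [|m IH] /=; first exact: ev_pconst.
by rewrite (@ev_pmul s z w hz hw R (R ^ m)) ?IH //; apply: bnd_pw.
Qed.

Section Comp.
Variables (s R M : R) (F u v : PS).
Hypotheses (hs : 0 < s) (hu : bnd s R u) (hv : bnd s R v).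

Let W m i := pmul (pw u m) (pw v i).

Lemma bnd_W m i : bnd s (R ^ (m + i)) (W m i).
Proof. by rewrite pow_add; apply: bnd_pmul; try lra; apply: bnd_pw => //; lra. Qed.

Lemma comp_sqb j k : bnd R M F -> sqb (M / s ^ (j + k)) (fun m i => F m i * W m i j k)%C.
Proof.
move=> hF N; have hsp := pow_lt s (j + k) hs.
apply: (Rmult_le_reg_r (s ^ (j + k))) => //.
rewrite /Rdiv Rmult_assoc Rinv_l ?Rmult_1_r; last lra.
apply: Rle_trans (hF N).
rewrite Rmult_comm -sq_scal; apply: sq_le => m i.
rewrite Cmod_mult.
have := bnd_coef s _ _ j k (Rlt_le _ _ hs) (bnd_W m i).
have := Cmod_ge_0 (F m i); nra.
Qed.

Lemma bnd_Comp : bnd R M F -> bnd s M (Comp F u v).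
Proof.
move=> hF N.
have hlim : is_lim_seq (fun L => sq (fun j k => Cmod (csq (fun m i => F m i * W m i j k)%C L) * s ^ (j + k)) N)
   (sq (fun j k => Cmod (Comp F u v j k) * s ^ (j + k)) N).
  apply: (is_lim_seq_rsum (fun j L => rsum (fun k => Cmod (csq (fun m i => F m i * W m i j k)%C L) * s ^ (j + k)) N)) => j _.
  apply: (is_lim_seq_rsum (fun k L => Cmod (csq (fun m i => F m i * W m i j k)%C L) * s ^ (j + k))) => k _.
  apply: is_lim_seq_mult'; last exact: is_lim_seq_const.
  exact: (sqb_lim_Cmod _ _ (comp_sqb j k hF)).
apply: (is_lim_seq_le _ _ _ _ _ hlim (is_lim_seq_const M)) => L.
apply: Rle_trans (hF L).
have hs0 := Rlt_le _ _ hs.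
apply: (Rle_trans _ (sq (fun j k => sq (fun m i => Cmod (F m i) * (Cmod (W m i j k) * s ^ (j + k))) L) N)).
  apply: sq_le => j k.
  apply: Rle_trans (Rmult_le_compat_r _ _ _ (pow_le _ _ hs0) (Cmod_csq _ _)) _.
  rewrite Rmult_comm -sq_scal; apply: sq_le => m i; rewrite Cmod_mult; lra.
have -> : sq (fun j k => sq (fun m i => Cmod (F m i) * (Cmod (W m i j k) * s ^ (j + k))) L) N
  = sq (fun m i => Cmod (F m i) * sq (fun j k => Cmod (W m i j k) * s ^ (j + k)) N) L.
  rewrite /sq.
  rewrite (rsum_ext _ (fun j => rsum (fun m => rsum (fun k => rsum (fun i => Cmod (F m i) * (Cmod (W m i j k) * s ^ (j + k))) L) N) L)).
    rewrite rsum_switch; apply: rsum_ext => m _.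
    rewrite (rsum_ext _ (fun j => rsum (fun i => rsum (fun k => Cmod (F m i) * (Cmod (W m i j k) * s ^ (j + k))) N) L)).
      rewrite rsum_switch; apply: rsum_ext => i _.
      by rewrite -rsum_scal; apply: rsum_ext => j _; rewrite -rsum_scal.
    by move=> j _; rewrite rsum_switch.
  by move=> j _; rewrite rsum_switch.
apply: sq_le => m i; apply: Rmult_le_compat_l; first exact: Cmod_ge_0.
exact: bnd_W.
Qed.
End Comp.

Definition trunc (F : PS) (L : nat) : PS := fun m i => if (m + i <=? L)%nat then F m i else 0%C.
Definition tail (F : PS) (L : nat) : PS := fun m i => if (m + i <=? L)%nat then RtoC 0 else F m i.

Lemma trunc_tail F L m i : F m i = padd (trunc F L) (tail F L) m i.
Proof. by rewrite /padd /trunc /tail; case: (_ <=? _)%nat; ring. Qed.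

Lemma bnd_trunc s M F L : 0 <= s -> bnd s M F -> bnd s M (trunc F L).
Proof.
move=> hs; apply: bnd_dom => // j k; rewrite /trunc; case: (_ <=? _)%nat; first lra.
by rewrite Cmod_0; apply: Cmod_ge_0.
Qed.

Lemma bnd_tail s M F L : 0 <= s -> bnd s M F -> bnd s M (tail F L).
Proof.
move=> hs; apply: bnd_dom => // j k; rewrite /tail; case: (_ <=? _)%nat; last lra.
by rewrite Cmod_0; apply: Cmod_ge_0.
Qed.

Lemma tail_small s M F eps : 0 <= s -> 0 < eps -> bnd s M F -> exists L, bnd s eps (tail F L).
Proof.
move=> hs heps hF.
pose x (G : PS) := fun j k => Cmod (G j k) * s ^ (j + k).
have x0 G j k : 0 <= x G j k by apply: Rmult_le_pos; [exact: Cmod_ge_0|apply: pow_le].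
have [l [_ [_ [hl _]]]] := dsummable_pos (x F) M (x0 F) hF.
have hle N : sq (x F) N <= l.
  by apply: (is_lim_seq_incr_compare (sq (x F))) => // n; apply: sq_mono => //; lia.
have [N0 hN0] := proj2 (is_lim_seq_spec _ _) hl (mkposreal eps heps).
have {hN0} := hN0 N0 (le_n _) => /= hN0.
exists (2 * N0)%nat => N.
set N1 := Nat.max N N0; set L := (2 * N0)%nat.
have h1 : sq (x (tail F L)) N <= sq (x (tail F L)) N1 by apply: sq_mono => //; lia.
have h2 : sq (x (trunc F L)) N1 + sq (x (tail F L)) N1 = sq (x F) N1.
  have := sq_lin (x (trunc F L)) (x (tail F L)) 1 1 N1; rewrite !Rmult_1_l => <-.
  apply: sq_ext => j k; rewrite /x /trunc /tail.
  by case: (_ <=? _)%nat; rewrite Cmod_0; ring.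
have h3 : sq (x (trunc F L)) N0 <= sq (x (trunc F L)) N1 by apply: sq_mono => //; lia.
have h4 : sq (x (trunc F L)) N0 = sq (x F) N0.
  apply: rsum_ext => j hj; apply: rsum_ext => k hk; rewrite /x /trunc.
  have /Nat.leb_le -> // : (j + k <= L)%nat by rewrite /L; lia.
move: (hle N1) (proj2 (Rabs_def2 _ _ hN0)) => h5 h6.
change (sq (x (tail F L)) N <= eps); lra.
Qed.

Lemma ev_csum s z w (a : nat -> PS) (M : nat -> R) L : Cmod z <= s -> Cmod w <= s ->
  (forall m, bnd s (M m) (a m)) ->
  bnd s (rsum M L) (fun j k => csum (fun m => a m j k) L) /\
  ev (fun j k => csum (fun m => a m j k) L) z w = csum (fun m => ev (a m) z w) L.
Proof.
move=> hz hw ha; have hs : 0 <= s by apply: Rle_trans (Cmod_ge_0 z) hz.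
elim: L => [|L [IH1 IH2]].
  split; first by apply: (bnd_ext _ _ (a 0%nat)); [move=> j k; apply: Ceq|exact: ha].
  rewrite (ev_ext _ (a 0%nat)); first by apply: Ceq.
  by move=> j k; apply: Ceq.
split.
  apply: (bnd_ext _ _ (padd (fun j k => csum (fun m => a m j k) L) (a (S L)))) => //.
  exact: bnd_padd.
rewrite csumS -IH2 -(ev_padd hz hw IH1 (ha (S L))).
by apply: ev_ext.
Qed.

Section EvComp.
Variables (s R M : R) (F u v : PS) (z w : C).
Hypotheses (hs : 0 < s) (hu : bnd s R u) (hv : bnd s R v).
Hypotheses (hz : Cmod z <= s) (hw : Cmod w <= s).

Let hs' : 0 <= s := Rlt_le _ _ hs.
Let hR : 0 <= R := bnd_ge0 _ _ _ hs' hu.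

Lemma ev_Comp_trunc L : bnd R M F ->
  ev (Comp (trunc F L) u v) z w = ev (trunc F L) (ev u z w) (ev v z w).
Proof.
move=> hF.
pose W m i := pmul (pw u m) (pw v i).
have h0 (c : nat -> nat -> C) : CS2 (fun m i => trunc F L m i * c m i)%C =
    csq (fun m i => trunc F L m i * c m i)%C L.
  apply: CS2_fin => m i hmi; rewrite /trunc.
  by have /Nat.leb_gt -> := hmi; ring.
rewrite {2}/ev h0.
rewrite (ev_ext _ (fun j k => csq (fun m i => trunc F L m i * W m i j k)%C L)); last first.
  by move=> j k; rewrite /Comp (h0 (fun m i => W m i j k)).
have hW m i : bnd s (Cmod (trunc F L m i) * R ^ (m + i)) (pscal (trunc F L m i) (W m i)).
  by apply: bnd_pscal; apply: bnd_W.
have h1 m := ev_csum s z w (fun i => pscal (trunc F L m i) (W m i)) _ L hz hw (hW m).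
have [_ ->] := ev_csum s z w (fun m j k => csum (fun i => trunc F L m i * W m i j k)%C L) _ L
  hz hw (fun m => proj1 (h1 m)).
apply: csum_ext => m _; rewrite (proj2 (h1 m)); apply: csum_ext => i _.
rewrite (ev_pscal hz hw (bnd_W s R u v hs hu hv m i)).
rewrite (ev_pmul hz hw (bnd_pw s R u m hs' hu) (bnd_pw s R v i hs' hv)).
by rewrite (ev_pw s R u m z w) // (ev_pw s R v i z w).
Qed.

Lemma ev_Comp : bnd R M F -> ev (Comp F u v) z w = ev F (ev u z w) (ev v z w).
Proof.
move=> hF.
have hU : Cmod (ev u z w) <= R by apply: (@ev_bound s).
have hV : Cmod (ev v z w) <= R by apply: (@ev_bound s).
suff h eps : 0 < eps -> Cmod (ev (Comp F u v) z w - ev F (ev u z w) (ev v z w))%C <= 2 * eps.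
  have h0 : Cmod (ev (Comp F u v) z w - ev F (ev u z w) (ev v z w))%C = 0.
    apply: Rle_antisym; last exact: Cmod_ge_0.
    apply: le_epsilon => eps he; have := h (eps / 2) ltac:(lra); lra.
  move/Cmod_eq_0: h0 => h0.
  by rewrite -(Cplus_0_r (ev F _ _)) -h0; ring.
move=> heps; have [L hL] := tail_small R M F eps hR heps hF.
have hT := bnd_trunc R M F L hR hF.
have e1 : ev F (ev u z w) (ev v z w) =
    (ev (trunc F L) (ev u z w) (ev v z w) + ev (tail F L) (ev u z w) (ev v z w))%C.
  rewrite -(ev_padd hU hV hT hL).
  by apply: ev_ext; apply: trunc_tail.
have e2 : ev (Comp F u v) z w = (ev (Comp (trunc F L) u v) z w + ev (Comp (tail F L) u v) z w)%C.
  rewrite -(@ev_padd s z w hz hw M eps); try exact: bnd_Comp hs hu hv _.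
  apply: ev_ext => j k; rewrite /padd /Comp.
  rewrite -(CS2_plus _ _ _ _ (comp_sqb s R M (trunc F L) u v hs hu hv j k hT)
   (comp_sqb s R eps (tail F L) u v hs hu hv j k hL)).
  by apply: CS2_ext => m i; rewrite {1}(trunc_tail F L) /padd; ring.
rewrite e1 e2 (ev_Comp_trunc L hF).
have b1 := ev_bound hU hV hL.
have b2 := ev_bound hz hw (bnd_Comp s R eps (tail F L) u v hs hu hv hL).
have -> : forall a b c : C, (a + b - (a + c) = b + - c)%C by move=> a b c; ring.
apply: Rle_trans (Cmod_triangle _ _) _; rewrite Cmod_opp; lra.
Qed.
End EvComp.

Definition pd1 (a : PS) : PS := fun j k => (INR (S j) * a (S j) k)%C.
Definition pd2 (a : PS) : PS := fun j k => (INR (S k) * a j (S k))%C.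

Lemma sq_shift1 x N : (forall j k, 0 <= x j k) -> sq (fun j k => x (S j) k) N <= sq x (S N).
Proof.
move=> h; rewrite {2}/sq rsum_shift.
have : 0 <= rsum (x 0%nat) (S N) by apply: rsum_ge0.
suff : sq (fun j k => x (S j) k) N <= rsum (fun k => rsum (x (S k)) (S N)) N by lra.
by apply: rsum_le => j _; apply: rsum_mono => //; lia.
Qed.

Lemma INR_half_pow n : INR n * (/ 2) ^ n <= 1.
Proof.
suff : INR n + 1 <= 2 * 2 ^ n.
  move=> h; rewrite pow_inv.
  have h2 := pow_lt 2 n ltac:(lra).
  apply: (Rmult_le_reg_r (2 ^ n)) => //.
  rewrite Rmult_assoc Rinv_l; last lra.
  suff : INR n <= 2 ^ n by lra.
  elim: n {h h2} => [|n IH]; first by rewrite /=; lra.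
  by rewrite S_INR /=; have := pow_R1_Rle 2 n ltac:(lra); lra.
elim: n => [|n IH]; first by rewrite /=; lra.
rewrite S_INR /=; have := pow_R1_Rle 2 n ltac:(lra); lra.
Qed.

Lemma bnd_deg s M (a b : PS) : 0 <= s -> (forall j k, Cmod (b j k) <= INR (j + k) * Cmod (a j k)) ->
  bnd s M a -> bnd (s / 2) M b.
Proof.
move=> hs h ha N; apply: Rle_trans (ha N); apply: sq_le => j k.
rewrite /Rdiv Rpow_mult_distr.
have h1 := INR_half_pow (j + k); have h2 := pow_le s (j + k) hs.
have h3 := Cmod_ge_0 (a j k); have h4 : 0 <= (/ 2) ^ (j + k) by apply: pow_le; lra.
apply: (Rle_trans _ (INR (j + k) * Cmod (a j k) * (s ^ (j + k) * (/ 2) ^ (j + k)))).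
  by apply: Rmult_le_compat_r; [apply: Rmult_le_pos|].
have -> : INR (j + k) * Cmod (a j k) * (s ^ (j + k) * (/ 2) ^ (j + k)) =
  (Cmod (a j k) * s ^ (j + k)) * (INR (j + k) * (/ 2) ^ (j + k)) by ring.
have : 0 <= Cmod (a j k) * s ^ (j + k) by apply: Rmult_le_pos.
nra.
Qed.

Lemma bnd_shift1 s M (a b : PS) : 0 < s -> (forall j k, b j k = a (S j) k) ->
  bnd s M a -> bnd s (M / s) b.
Proof.
move=> hs h ha N.
apply: (Rmult_le_reg_l s) => //.
have -> : s * (M / s) = M by field; lra.
apply: Rle_trans (ha (S N)).
rewrite -sq_scal.
apply: Rle_trans (sq_shift1 _ _ _) => [|j k].
  by apply: sq_le => j k; rewrite h /=; lra.
by apply: Rmult_le_pos; [exact: Cmod_ge_0|apply: pow_le; lra].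
Qed.

Lemma bnd_transpose s M a : bnd s M a -> bnd s M (fun j k => a k j).
Proof.
move=> ha N; rewrite -sq_transpose; apply: Rle_trans (ha N); apply: Req_le.
by apply: sq_ext => j k; rewrite Nat.add_comm.
Qed.

Lemma bnd_pd1 s M a : 0 < s -> bnd s M a -> bnd (s / 2) (M / (s / 2)) (pd1 a).
Proof.
move=> hs ha.
apply: (bnd_shift1 (s / 2) M (fun j k => (INR j * a j k)%C)) => //; first lra.
apply: bnd_deg ha; first lra.
move=> j k; rewrite Cmod_mult Cmod_R Rabs_pos_eq; last exact: pos_INR.
apply: Rmult_le_compat_r; first exact: Cmod_ge_0.
by apply: le_INR; lia.
Qed.

Lemma bnd_pd2 s M a : 0 < s -> bnd s M a -> bnd (s / 2) (M / (s / 2)) (pd2 a).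
Proof.
move=> hs ha.
by apply: (bnd_transpose _ _ (pd1 (fun j k => a k j))); apply: bnd_pd1 => //; apply: bnd_transpose.
Qed.

Lemma bnd_order s M t d (a : PS) : 0 < s -> 0 <= t <= s ->
  (forall j k, (j + k < d)%nat -> a j k = 0%C) -> bnd s M a -> bnd t (M * (t / s) ^ d) a.
Proof.
move=> hs ht h ha N.
have hq : 0 <= t / s <= 1.
  split; first by apply: Rdiv_le_0_compat; lra.
  by apply: (Rmult_le_reg_r s) => //; rewrite /Rdiv Rmult_assoc Rinv_l; lra.
have hqd := pow_le _ d (proj1 hq).
apply: (Rle_trans _ ((t / s) ^ d * sq (fun j k => Cmod (a j k) * s ^ (j + k)) N)); last first.
  by rewrite Rmult_comm; apply: Rmult_le_compat_r.
rewrite -sq_scal; apply: sq_le => j k.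
case: (Nat.lt_ge_cases (j + k) d) => hjk; first by rewrite h // Cmod_0; lra.
have -> : t ^ (j + k) = s ^ (j + k) * ((t / s) ^ d * (t / s) ^ (j + k - d)).
  rewrite -pow_add (_ : (d + (j + k - d) = j + k)%nat); last lia.
  by rewrite -Rpow_mult_distr; congr (_ ^ _); field; lra.
have h1 : (t / s) ^ (j + k - d) <= 1 by rewrite -(pow1 (j + k - d)); apply: pow_incr.
have h2 : 0 <= Cmod (a j k) * s ^ (j + k) * (t / s) ^ d.
  by apply: Rmult_le_pos => //; apply: Rmult_le_pos; [exact: Cmod_ge_0|apply: pow_le; lra].
nra.
Qed.

Lemma pmul_00 a b : pmul a b 0%nat 0%nat = (a 0%nat 0%nat * b 0%nat 0%nat)%C.
Proof. by rewrite /pmul; apply: Ceq. Qed.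

Lemma pmul_10 a b : pmul a b 1%nat 0%nat =
  (a 0%nat 0%nat * b 1%nat 0%nat + a 1%nat 0%nat * b 0%nat 0%nat)%C.
Proof. by rewrite /pmul; apply: Ceq. Qed.

Lemma pmul_01 a b : pmul a b 0%nat 1%nat =
  (a 0%nat 0%nat * b 0%nat 1%nat + a 0%nat 1%nat * b 0%nat 0%nat)%C.
Proof. by rewrite /pmul; apply: Ceq. Qed.

Definition pvar1 (c : C) : PS := padd (pconst c) pX.
Definition pvar2 (c : C) : PS := padd (pconst c) pY.

Definition npow (c : C) (m : nat) : C := match m with 0%nat => 0%C | S m => (INR (S m) * c ^ m)%C end.

Lemma npowS c m : npow c (S m) = (c * npow c m + c ^ m)%C.
Proof.
case: m => [|m]; first by rewrite /npow /=; ring.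
rewrite {1 2}/npow [INR (S (S m))]S_INR RtoC_plus /=; ring.
Qed.

Lemma pw_var1 c m : pw (pvar1 c) m 0%nat 0%nat = (c ^ m)%C /\
  pw (pvar1 c) m 1%nat 0%nat = npow c m /\ pw (pvar1 c) m 0%nat 1%nat = 0%C.
Proof.
elim: m => [|m [h1 [h2 h3]]] //.
rewrite [pw _ _]/= pmul_00 pmul_10 pmul_01 h1 h2 h3 npowS /pvar1 /padd /=.
by split; [|split]; ring.
Qed.

Lemma pw_var2 c m : pw (pvar2 c) m 0%nat 0%nat = (c ^ m)%C /\
  pw (pvar2 c) m 1%nat 0%nat = 0%C /\ pw (pvar2 c) m 0%nat 1%nat = npow c m.
Proof.
elim: m => [|m [h1 [h2 h3]]] //.
rewrite [pw _ _]/= pmul_00 pmul_10 pmul_01 h1 h2 h3 npowS /pvar2 /padd /=.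
by split; [|split]; ring.
Qed.

Definition recenter (a : PS) (z0 w0 : C) : PS := Comp a (pvar1 z0) (pvar2 w0).

Lemma CS_incr (f : nat -> C) : f 0%nat = 0%C -> CS f = CS (fun k => f (S k)).
Proof. by move=> h; apply: Ceq; apply: Series_incr_1_aux; rewrite h. Qed.

Lemma recenter_00 a z0 w0 : recenter a z0 w0 0%nat 0%nat = ev a z0 w0.
Proof.
apply: CS2_ext => m i; rewrite pmul_00.
by have [-> _] := pw_var1 z0 m; have [-> _] := pw_var2 w0 i.
Qed.

Lemma recenter_10 a z0 w0 : recenter a z0 w0 1%nat 0%nat = ev (pd1 a) z0 w0.
Proof.
rewrite /recenter /Comp (CS2_ext _ (fun m i => a m i * (npow z0 m * w0 ^ i))%C).
  rewrite /CS2 CS_incr.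
    by apply: CS2_ext => m i; rewrite /pd1 /npow; ring.
  rewrite (CS_ext _ (fun _ => 0%C)); last by move=> k; rewrite /=; ring.
  by rewrite (CS_fin _ 0) //; apply: Ceq.
move=> m i; rewrite pmul_10.
have [-> [-> _]] := pw_var1 z0 m; have [-> [-> _]] := pw_var2 w0 i; ring.
Qed.

Lemma recenter_01 a z0 w0 : recenter a z0 w0 0%nat 1%nat = ev (pd2 a) z0 w0.
Proof.
rewrite /recenter /Comp (CS2_ext _ (fun m i => a m i * (z0 ^ m * npow w0 i))%C).
  apply: CS_ext => m; rewrite CS_incr; last by rewrite /=; ring.
  by apply: CS_ext => i; rewrite /pd2 /npow; ring.
move=> m i; rewrite pmul_01.
have [-> [_ ->]] := pw_var1 z0 m; have [-> [_ ->]] := pw_var2 w0 i; ring.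
Qed.

Section Recenter.
Variables (s M r t : R) (a : PS) (z0 w0 : C).
Hypotheses (ht : 0 < t) (hrt : r + t <= s) (hz : Cmod z0 <= r) (hw : Cmod w0 <= r).
Hypothesis ha : bnd s M a.

Lemma bnd_pvar : bnd t s (pvar1 z0) /\ bnd t s (pvar2 w0).
Proof.
have h0 := Rlt_le _ _ ht; split.
  apply: (bnd_le t (Cmod z0 + t)); try lra.
  by apply: bnd_padd => //; [apply: bnd_pconst|apply: bnd_pX].
apply: (bnd_le t (Cmod w0 + t)); try lra.
by apply: bnd_padd => //; [apply: bnd_pconst|apply: bnd_pY].
Qed.

Lemma bnd_recenter : bnd t M (recenter a z0 w0).
Proof.
have [h1 h2] := bnd_pvar.
have hs : 0 <= s by apply: bnd_ge0 h1; lra.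
exact: (bnd_Comp t s).
Qed.

Lemma ev_recenter h k : Cmod h <= t -> Cmod k <= t ->
  ev (recenter a z0 w0) h k = ev a (z0 + h)%C (w0 + k)%C.
Proof.
move=> hh hk; have [h1 h2] := bnd_pvar.
have h0 := Rlt_le _ _ ht.
rewrite (ev_Comp t s M) //.
rewrite (ev_padd hh hk (bnd_pconst t z0 h0) (bnd_pX t h0)).
rewrite (ev_padd hh hk (bnd_pconst t w0 h0) (bnd_pY t h0)).
by rewrite !ev_pconst ev_pX ev_pY.
Qed.
End Recenter.

Lemma ev_linear s M (a : PS) t h k : 0 < s -> bnd s M a -> 0 <= t <= s -> Cmod h <= t -> Cmod k <= t ->
  Cmod (ev a h k - (a 0%nat 0%nat + a 1%nat 0%nat * h + a 0%nat 1%nat * k))%C <= M * (t / s) ^ 2.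
Proof.
move=> hs ha ht hh hk.
have ht0 := proj1 ht.
have hT := bnd_trunc t M a 1 ht0 (bnd_le _ _ _ _ _ ht (Rle_refl _) ha).
have hL : bnd t (M * (t / s) ^ 2) (tail a 1).
  apply: (bnd_order s) => //; last by apply: bnd_tail => //; lra.
  by move=> j i hji; rewrite /tail; have /Nat.leb_le -> : (j + i <= 1)%nat by lia.
have -> : ev a h k = (ev (trunc a 1) h k + ev (tail a 1) h k)%C.
  rewrite -(ev_padd hh hk hT hL).
  by apply: ev_ext; apply: trunc_tail.
have -> : ev (trunc a 1) h k = (a 0%nat 0%nat + a 1%nat 0%nat * h + a 0%nat 1%nat * k)%C.
  rewrite /ev csq_tail0; first by rewrite /trunc /=; ring.
  by move=> j i hji; rewrite /trunc; have /Nat.leb_gt -> := hji; ring.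
have -> : forall x y : C, (x + y - x = y)%C by move=> x y; ring.
exact: (@ev_bound t).
Qed.

Lemma ev_diff s M (a : PS) z0 w0 t h k : 0 < s -> bnd s M a ->
  Cmod z0 <= s / 2 -> Cmod w0 <= s / 2 -> 0 <= t <= s / 2 -> Cmod h <= t -> Cmod k <= t ->
  Cmod (ev a (z0 + h) (w0 + k) - (ev a z0 w0 + ev (pd1 a) z0 w0 * h + ev (pd2 a) z0 w0 * k))%C
  <= M * (t / (s / 2)) ^ 2.
Proof.
move=> hs ha hz hw ht hh hk.
have h2 : 0 < s / 2 by lra.
have h3 : s / 2 + s / 2 <= s by lra.
rewrite -(ev_recenter s M (s / 2) (s / 2) a z0 w0 h2 h3 hz hw ha h k); try lra.
rewrite -(recenter_00 a z0 w0) -(recenter_10 a z0 w0) -(recenter_01 a z0 w0).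
have hb := bnd_recenter s M (s / 2) (s / 2) a z0 w0 h2 h3 hz hw ha.
exact: (ev_linear (s / 2) M _ t h k h2 hb ht hh hk).
Qed.

(** * Formal fixed points *)

Definition agree (n : nat) (a b : PS) := forall j k, (j + k < n)%nat -> a j k = b j k.
Definition ord (d : nat) (a : PS) := forall j k, (j + k < d)%nat -> a j k = RtoC 0.

Lemma ord1 (a : PS) : a 0%nat 0%nat = RtoC 0 -> ord 1 a.
Proof. by move=> h [|j] [|k] hjk //; exfalso; lia. Qed.

Lemma agree_mul n a a' b b' : agree n a a' -> agree n b b' -> agree n (pmul a b) (pmul a' b').
Proof.
move=> ha hb j k hjk; apply: csum_ext => p hp; apply: csum_ext => q hq.
by rewrite ha ?hb //; lia.
Qed.

Lemma agree_mul_ord1l n a a' b b' : ord 1 a -> ord 1 a' -> agree (S n) a a' -> agree n b b' ->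
  agree (S n) (pmul a b) (pmul a' b').
Proof.
move=> oa oa' ha hb j k hjk; apply: csum_ext => p hp; apply: csum_ext => q hq.
case: (Nat.eq_dec (p + q) 0) => hpq.
  by rewrite (oa p q) ?(oa' p q); [ring|lia|lia].
by rewrite ha ?hb //; lia.
Qed.

Lemma agree_mul_ord1 n a a' b b' : ord 1 a -> ord 1 a' -> ord 1 b -> ord 1 b' ->
  agree n a a' -> agree n b b' -> agree (S n) (pmul a b) (pmul a' b').
Proof.
move=> oa oa' ob ob' ha hb j k hjk; apply: csum_ext => p hp; apply: csum_ext => q hq.
case: (Nat.eq_dec (p + q) 0) => hpq.
  by rewrite (oa p q) ?(oa' p q); [ring|lia|lia].
case: (Nat.eq_dec (j - p + (k - q)) 0) => hpq'.
  by rewrite (ob (j - p)%nat (k - q)%nat) ?(ob' (j - p)%nat (k - q)%nat); [ring|lia|lia].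
by rewrite ha ?hb //; lia.
Qed.

Lemma ord_mul d e a b : ord d a -> ord e b -> ord (d + e) (pmul a b).
Proof.
move=> ha hb j k hjk; apply: csum_eq0 => p hp; apply: csum_eq0 => q hq.
case: (Nat.lt_ge_cases (p + q) d) => h; first by rewrite ha //; ring.
by rewrite hb; [ring|lia].
Qed.

Lemma ord_pw u m : ord 1 u -> ord m (pw u m).
Proof. by move=> hu; elim: m => [|m IH] //=; [move=> j k; lia|apply: (ord_mul 1 m)]. Qed.

Lemma ord_le d e a : (d <= e)%nat -> ord e a -> ord d a.
Proof. by move=> h ha j k hjk; apply: ha; lia. Qed.

Lemma agree_pw n u u' m : agree n u u' -> agree n (pw u m) (pw u' m).
Proof. by move=> h; elim: m => [|m IH] //=; apply: agree_mul. Qed.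

Lemma agree_Comp n F u u' v v' : agree n u u' -> agree n v v' ->
  agree n (Comp F u v) (Comp F u' v').
Proof.
move=> hu hv j k hjk; apply: CS2_ext => m i; congr Cmult.
by apply: agree_mul hjk; apply: agree_pw.
Qed.

Lemma agree_pw_S n u u' m : (2 <= m)%nat -> ord 1 u -> ord 1 u' -> agree n u u' ->
  agree (S n) (pw u m) (pw u' m).
Proof.
case: m => [|[|m]] hm hu hu' h; try lia.
apply: (agree_mul_ord1 n u u' (pw u (S m)) (pw u' (S m))) => //.
- by apply: (ord_le _ (S m)); [lia|apply: ord_pw].
- by apply: (ord_le _ (S m)); [lia|apply: ord_pw].
- exact: agree_pw.
Qed.

Lemma agree_Comp_S n F u u' v v' : ord 2 F -> ord 1 u -> ord 1 u' -> ord 1 v -> ord 1 v' ->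
  agree n u u' -> agree n v v' -> agree (S n) (Comp F u v) (Comp F u' v').
Proof.
move=> hF ou ou' ov ov' hu hv j k hjk; apply: CS2_ext => m i.
case: (Nat.lt_ge_cases (m + i) 2) => hmi; first by rewrite hF //; ring.
congr Cmult; move: j k hjk; rewrite -/(agree (S n) _ _).
have o1 x y : ord 1 x -> (1 <= y)%nat -> ord 1 (pw x y).
  by move=> ox hy; apply: (ord_le _ y) => //; apply: ord_pw.
case: (Nat.lt_ge_cases 1 m) => hm.
  apply: agree_mul_ord1l; [apply: o1 => //; lia|apply: o1 => //; lia| |exact: agree_pw].
  by apply: agree_pw_S => //; lia.
case: (Nat.eq_dec m 0) => [hm0|hm0].
  subst m; by apply: agree_mul => //; apply: agree_pw_S => //; lia.
have hm1 : m = 1%nat by lia.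
subst m; apply: agree_mul_ord1; try (apply: o1 => //; lia); exact: agree_pw.
Qed.

Lemma ord_Comp d F u v : ord d F -> ord 1 u -> ord 1 v -> ord d (Comp F u v).
Proof.
move=> hF hu hv j k hjk.
rewrite /Comp (CS2_ext _ (fun _ _ => RtoC 0)).
  by rewrite (CS2_fin _ 0) //; apply: Ceq.
move=> m i; case: (Nat.lt_ge_cases (m + i) d) => hmi; first by rewrite hF //; ring.
by rewrite (ord_mul m i _ _ (ord_pw u m hu) (ord_pw v i hv)); [ring|lia].
Qed.

(* No completeness of the space of series is needed: an operator which improves agreement by one
   degree has a formal fixed point, whose norm is bounded by that of the iterates. *)
Lemma formal_fixpoint (T : PS -> PS) s R : 0 <= s -> 0 <= R ->
  (forall u, ord 1 u -> bnd s R u -> ord 1 (T u) /\ bnd s R (T u)) ->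
  (forall n u v, ord 1 u -> ord 1 v -> agree n u v -> agree (S n) (T u) (T v)) ->
  exists u, ord 1 u /\ bnd s R u /\ forall j k, u j k = T u j k.
Proof.
move=> hs hR hT hA.
pose z : PS := fun _ _ => RtoC 0.
pose it n := Nat.iter n T z.
have h0 n : ord 1 (it n) /\ bnd s R (it n).
  elim: n => [|n [h1 h2]]; last exact: hT.
  split=> // N; apply: Rle_trans hR; apply: Req_le.
  rewrite (sq_ext _ (fun _ _ => 0 * 0)); last by move=> j k; rewrite Cmod_0; ring.
  by rewrite (sq_scal 0); ring.
have hs1 n : agree n (it n) (it (S n)).
  elim: n => [|n IH]; first by move=> j k; lia.
  by apply: hA => //; [exact: (proj1 (h0 n))|exact: (proj1 (h0 (S n)))].
have hst n d : agree n (it n) (it (n + d)%nat).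
  elim: d => [|d IH] j k hjk; first by rewrite Nat.add_0_r.
  by rewrite IH // Nat.add_succ_r (hs1 (n + d)%nat) //; lia.
pose u : PS := fun j k => it (S (j + k)) j k.
have hu n : agree n u (it n).
  move=> j k hjk; rewrite /u (hst (S (j + k)) (n - S (j + k))%nat); last lia.
  by have -> : (S (j + k) + (n - S (j + k)) = n)%nat by lia.
have ou : ord 1 u by move=> j k hjk; rewrite (hu 1%nat j k hjk); exact: (proj1 (h0 1%nat)).
exists u; split => //; split.
  move=> N; apply: Rle_trans (proj2 (h0 (S (N + N))) N); apply: Req_le.
  by apply: rsum_ext => j hj; apply: rsum_ext => k hk; rewrite (hu (S (N + N))) //; lia.
move=> j k; rewrite (hu (S (S (j + k)))); last lia.
rewrite /it /= -/(it _); symmetry.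
apply: (hA (S (j + k)) u (it (S (j + k))) ou (proj1 (h0 _))); [exact: hu|lia].
Qed.

Definition cc (a : PS) : PS := fun j k => Cconj (a j k).
Definition cj (a : PS) : PS := fun j k => Cconj (a k j).

Lemma Cconj_pow z n : Cconj (z ^ n)%C = (Cconj z ^ n)%C.
Proof.
elim: n => [|n IH] /=; first by Cring.
by rewrite -IH; Cring.
Qed.

Lemma Cconj_mult z w : Cconj (z * w)%C = (Cconj z * Cconj w)%C.
Proof. by Cring. Qed.

Lemma Cconj_0 : Cconj (RtoC 0) = RtoC 0.
Proof. by Cring. Qed.

Lemma CS2_conj x : CS2 (fun j k => Cconj (x j k)) = Cconj (CS2 x).
Proof.
apply: Ceq => //=; rewrite -Series_opp; apply: Series_ext => j.
by rewrite -Series_opp.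
Qed.

Lemma ev_cc a z w : ev (cc a) z w = Cconj (ev a (Cconj z) (Cconj w)).
Proof.
rewrite /ev -CS2_conj; apply: CS2_ext => j k.
by rewrite /cc !Cconj_mult !Cconj_pow !Cconj_conj.
Qed.

Lemma ev_cj s M a z : Cmod z <= s -> bnd s M a ->
  ev (cj a) z (Cconj z) = Cconj (ev a z (Cconj z)).
Proof.
move=> hz ha.
have hz' : Cmod (Cconj z) <= s by rewrite Cmod_conj.
rewrite /ev -(CS2_transpose M _ (bnd_sqb s M a z (Cconj z) hz hz' ha)) -CS2_conj.
apply: CS2_ext => j k.
by rewrite /cj !Cconj_mult !Cconj_pow !Cconj_conj; ring.
Qed.

Lemma bnd_cc s M a : 0 <= s -> bnd s M a -> bnd s M (cc a).
Proof. by move=> hs; apply: bnd_dom => // j k; rewrite /cc Cmod_conj; lra. Qed.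

Lemma bnd_cj s M a : 0 <= s -> bnd s M a -> bnd s M (cj a).
Proof. by move=> hs ha; apply: (bnd_transpose _ _ (cc a)); apply: bnd_cc. Qed.

Lemma agree_cc n a b : agree n a b -> agree n (cc a) (cc b).
Proof. by move=> h j k hjk; rewrite /cc h. Qed.

Lemma agree_cj n a b : agree n a b -> agree n (cj a) (cj b).
Proof. by move=> h j k hjk; rewrite /cj h //; lia. Qed.

Lemma ord_cj d a : ord d a -> ord d (cj a).
Proof. by move=> h j k hjk; rewrite /cj h; [Cring|lia]. Qed.

Lemma agree_padd n a a' b b' : agree n a a' -> agree n b b' -> agree n (padd a b) (padd a' b').
Proof. by move=> h h' j k hjk; rewrite /padd h ?h'. Qed.

Lemma ord_padd d a b : ord d a -> ord d b -> ord d (padd a b).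
Proof. by move=> h h' j k hjk; rewrite /padd h ?h' //; ring. Qed.

Lemma ord_pX : ord 1 pX. Proof. exact: ord1. Qed.
Lemma ord_pY : ord 1 pY. Proof. exact: ord1. Qed.

(* The series of [F (psi, conj psi)] for [psi = z + h (z, w)], where [w] stands for [conj z]. *)
Definition near_id_comp (F h : PS) : PS := Comp F (padd pX h) (padd pY (cj h)).

Lemma agree_near_id n F h h' : ord 2 F -> ord 1 h -> ord 1 h' -> agree n h h' ->
  agree (S n) (near_id_comp F h) (near_id_comp F h').
Proof.
move=> hF oh oh' hh.
apply: agree_Comp_S => //; try (apply: ord_padd; [exact: ord_pX|done]);
  try (apply: ord_padd; [exact: ord_pY|exact: ord_cj]).
  exact: agree_padd.
by apply: agree_padd => //; apply: agree_cj.
Qed.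

Lemma ord_near_id F h : ord 2 F -> ord 1 h -> ord 2 (near_id_comp F h).
Proof.
move=> hF oh; apply: ord_Comp => //; apply: ord_padd => //; try exact: ord_pX; try exact: ord_pY.
exact: ord_cj.
Qed.

Lemma bnd_near_id s s0 M F h : 0 < s -> 2 * s <= s0 -> ord 2 F -> bnd s0 M F -> bnd s s h ->
  bnd s (M * (2 * s / s0) ^ 2) (near_id_comp F h).
Proof.
move=> hs hss hF hb hh; have hs' := Rlt_le _ _ hs.
apply: (bnd_Comp s (2 * s)) => //.
- by rewrite Rmult_plus_distr_r Rmult_1_l; apply: bnd_padd => //; apply: bnd_pX.
- rewrite Rmult_plus_distr_r Rmult_1_l; apply: bnd_padd => //; first exact: bnd_pY.
  exact: bnd_cj.
- by apply: bnd_order => //; lra.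
Qed.

Lemma ev_near_id s s0 M F h z : 0 < s -> 2 * s <= s0 -> bnd s0 M F -> bnd s s h -> Cmod z <= s ->
  let y := (z + ev h z (Cconj z))%C in
  Cmod y <= 2 * s /\ ev (near_id_comp F h) z (Cconj z) = ev F y (Cconj y).
Proof.
move=> hs hss hb hh hz y; have hs' := Rlt_le _ _ hs.
have hz' : Cmod (Cconj z) <= s by rewrite Cmod_conj.
have b1 : bnd s (s + s) (padd pX h) by apply: bnd_padd => //; apply: bnd_pX.
have b2 : bnd s (s + s) (padd pY (cj h)).
  by apply: bnd_padd => //; [apply: bnd_pY|apply: bnd_cj].
split.
  have := ev_bound hz hz' hh; have := Cmod_triangle z (ev h z (Cconj z)).
  rewrite /y; lra.
rewrite /near_id_comp (ev_Comp s (s + s) M) //; last by apply: bnd_le hb; lra.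
rewrite (ev_padd hz hz' (bnd_pX s hs') hh).
rewrite (ev_padd hz hz' (bnd_pY s hs') (bnd_cj _ _ _ hs' hh)).
rewrite ev_pX ev_pY (ev_cj s s) // /y; congr ev.
by Cring.
Qed.

Lemma choose_radius s0 M : 0 < s0 -> 0 <= M ->
  exists s, 0 < s /\ 2 * s <= s0 /\ 3 * (M * (2 * s / s0) ^ 2) <= s.
Proof.
move=> hs hM.
have h1 : 0 < 12 * M / s0 + 2 by have := Rdiv_le_0_compat (12 * M) s0 ltac:(lra) hs; lra.
have h12 : 0 <= 12 * M / s0 by apply: Rdiv_le_0_compat; lra.
exists (s0 / (12 * M / s0 + 2)).
have hp : 0 < s0 / (12 * M / s0 + 2) by apply: Rdiv_lt_0_compat.
set s := s0 / _ in hp *.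
have e : s * (12 * M / s0) + 2 * s = s0 by rewrite /s; field; lra.
split => //; split; first by nra.
have -> : 3 * (M * (2 * s / s0) ^ 2) = s * (s * (12 * M / s0)) / s0 by field; lra.
apply: (Rmult_le_reg_r s0) => //; rewrite /Rdiv Rmult_assoc Rinv_l; last lra.
nra.
Qed.

Lemma inverse_series s0 M h : 0 < s0 -> bnd s0 M h -> ord 2 h ->
  exists s k, 0 < s /\ 2 * s <= s0 /\ bnd s s k /\ ord 2 k /\
  forall z, Cmod z <= s -> let y := (z + ev k z (Cconj z))%C in
    Cmod y <= 2 * s /\ (y + ev h y (Cconj y))%C = z.
Proof.
move=> hs0 hb oh.
have hM : 0 <= M by apply: bnd_ge0 hb; lra.
have [s [hs [hss hsm]]] := choose_radius s0 M hs0 hM; have hs' := Rlt_le _ _ hs.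
pose T k := pscal (RtoC (-1)) (near_id_comp h k).
have c1 : Cmod (RtoC (-1)) = 1 by rewrite Cmod_R Rabs_left; lra.
have oT u : ord 1 u -> ord 2 (T u).
  by move=> ou j k hjk; rewrite /T /pscal ord_near_id //; ring.
have [||k [ok [bk ek]]] := formal_fixpoint T s s hs' hs'.
- move=> u ou bu; split; first by apply: (ord_le 1 2); [lia|apply: oT].
  have b := bnd_near_id s s0 M h u hs hss oh hb bu.
  apply: (bnd_le s (Cmod (RtoC (-1)) * (M * (2 * s / s0) ^ 2))); first lra.
    rewrite c1; have := pow2_ge_0 (2 * s / s0); nra.
  exact: bnd_pscal.
- move=> n u v ou ov huv j k hjk; rewrite /T /pscal; congr Cmult.
  exact: agree_near_id hjk.
exists s, k; split => //; split => //; split => //; split.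
  by move=> j i hji; rewrite ek; apply: oT.
move=> z hz y.
have hz' : Cmod (Cconj z) <= s by rewrite Cmod_conj.
have [h1 h2] := ev_near_id s s0 M h k z hs hss hb bk hz.
split => //; rewrite -/y in h2.
rewrite -h2 {1}/y {1}(ev_ext k (T k)) // /T.
rewrite (ev_pscal hz hz' (bnd_near_id s s0 M h k hs hss oh hb bk)); ring.
Qed.

Lemma RtoC_neq0 x : x <> 0 -> RtoC x <> RtoC 0.
Proof. by move=> h [] h'. Qed.

Lemma INRC_neq0 j : RtoC (INR (S j)) <> RtoC 0.
Proof. by apply: RtoC_neq0; apply: not_0_INR. Qed.

Lemma pmul_pX a j k : pmul pX a j k = match j with 0%nat => RtoC 0 | S j => a j k end.
Proof.
case: j => [|j].
  apply: csum_eq0 => p hp; apply: csum_eq0 => q hq.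
  have p0 : p = 0%nat by lia.
  by rewrite p0 /=; ring.
rewrite /pmul (csum_single _ _ 1); [|lia|]; last first.
  move=> p hp hp1; apply: csum_eq0 => q hq.
  by case: p hp hp1 => [|[|p]] hp hp1 //=; ring.
rewrite (csum_single _ _ 0); [|lia|]; last first.
  by move=> q hq hq0; case: q hq hq0 => [|q] hq hq0 //=; ring.
by rewrite /= !Nat.sub_0_r; ring.
Qed.

Lemma pmul_pY a j k : pmul pY a j k = match k with 0%nat => RtoC 0 | S k => a j k end.
Proof.
rewrite /pmul (csum_single _ _ 0); [|lia|]; last first.
  by move=> p hp hp1; apply: csum_eq0 => q hq; case: p hp hp1 => [|p] hp hp1 //=; ring.
case: k => [|k].
  rewrite (csum_single _ _ 0) => [||q hq hq0]; [|lia|exfalso; lia].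
  by rewrite /=; ring.
rewrite (csum_single _ _ 1); [|lia|]; last first.
  by move=> q hq hq1; case: q hq hq1 => [|[|q]] hq hq1 //=; ring.
by rewrite /= !Nat.sub_0_r; ring.
Qed.

Lemma ode_series s M F : 0 < s -> bnd s M F ->
  exists e u, 0 < e /\ bnd e s u /\ ord 1 u /\ forall t : R, Rabs t <= e ->
    ev (pd1 u) t 0 = ev F (ev u t 0) (Cconj (ev u t 0)).
Proof.
move=> hs hF.
have hM : 0 <= M by apply: bnd_ge0 hF; lra.
pose e := s / (M + 1).
have he : 0 < e by apply: Rdiv_lt_0_compat; lra.
have he' := Rlt_le _ _ he; have hs' := Rlt_le _ _ hs.
have heM : e * M <= s.
  have : e * (M + 1) = s by rewrite /e; field; lra.
  nra.
pose N u := Comp F u (cc u).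
pose T u : PS := fun j k => match j with 0%nat => RtoC 0 | S j => (N u j k / INR (S j))%C end.
have hN u : bnd e s u -> bnd e M (N u).
  by move=> bu; apply: (bnd_Comp e s) => //; apply: bnd_cc.
have INRS j : 1 <= INR (S j) by rewrite S_INR; have := pos_INR j; lra.
have [||u [ou [bu eu]]] := formal_fixpoint T e s he' hs'.
- move=> u ou bu; split; first by apply: ord1.
  apply: (bnd_le e (e * M)) => //; first lra.
  have := @bnd_pmul e e M pX (N u) he' (bnd_pX e he') (hN u bu).
  apply: bnd_dom => // j k.
  rewrite pmul_pX.
  case: j => [|j]; first exact: Rle_refl.
  have hj := INRS j.
  rewrite /T Cmod_div; last exact: INRC_neq0.
  rewrite Cmod_R Rabs_pos_eq; last lra.
  apply: (Rmult_le_reg_r (INR (S j))); first lra.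
  rewrite /Rdiv Rmult_assoc Rinv_l; last lra.
  have := Cmod_ge_0 (N u j k); nra.
- move=> n u v ou ov huv [|j] k hjk //=; rewrite /T.
  congr Cdiv; apply: (agree_Comp n F u v (cc u) (cc v)) => //; [exact: agree_cc|lia].
exists e, u; split => //; split => //; split => //.
move=> t ht.
have ht' : Cmod t <= e by rewrite Cmod_R.
have h0 : Cmod 0 <= e by rewrite Cmod_0.
rewrite (ev_ext (pd1 u) (N u)); last first.
  move=> j k; rewrite /pd1 eu /T; have := INRS j => hj.
  field; exact: INRC_neq0.
rewrite /N (ev_Comp e s M) //; last exact: bnd_cc.
have ct : Cconj (RtoC t) = RtoC t by Cring.
by rewrite ev_cc Cconj_0 ct.
Qed.

(** * The normal form with counterterm *)

Definition diagp (b : nat -> R) : PS := fun j k => if (j =? k)%nat then RtoC (b j) else RtoC 0.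

(* [z d/dz - w d/dw] multiplies [z^j w^k] by [weight j k]; the terms with [j = k + 1] are resonant. *)
Definition weight (j k : nat) : R := INR j - INR k.
Definition rho (a : PS) : PS := fun j k =>
  if (j =? S k)%nat then RtoC 0 else (RtoC (/ (weight j k - 1)) * a j k)%C.
Definition kap (a : PS) : PS := fun j k =>
  if (j =? S k)%nat then RtoC 0 else (RtoC (weight j k / (weight j k - 1)) * a j k)%C.
Definition wder (a : PS) : PS := fun j k => (RtoC (weight j k) * a j k)%C.

Lemma weight_cases j k : j <> S k -> weight j k <= 0 \/ 2 <= weight j k.
Proof.
move=> h; rewrite /weight; case: (Nat.le_gt_cases j k) => hjk.
  by left; have := le_INR _ _ hjk; lra.
right; have := le_INR (S (S k)) j ltac:(lia); rewrite !S_INR; lra.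
Qed.

Lemma rho_coef a j k : Cmod (rho a j k) <= Cmod (a j k).
Proof.
rewrite /rho; case: Nat.eqb_spec => [_|/weight_cases h].
  by rewrite Cmod_0; apply: Cmod_ge_0.
have h1 : 1 <= Rabs (weight j k - 1) by rewrite /Rabs; case: Rcase_abs; lra.
rewrite Cmod_mult Cmod_R Rabs_inv.
apply: (Rmult_le_reg_l (Rabs (weight j k - 1))); first lra.
rewrite -Rmult_assoc Rinv_r; last lra.
have := Cmod_ge_0 (a j k); nra.
Qed.

Lemma kap_coef a j k : Cmod (kap a j k) <= 2 * Cmod (a j k).
Proof.
rewrite /kap; case: Nat.eqb_spec => [_|/weight_cases h].
  by rewrite Cmod_0; have := Cmod_ge_0 (a j k); lra.
have h1 : 1 <= Rabs (weight j k - 1) by rewrite /Rabs; case: Rcase_abs; lra.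
have h2 : Rabs (weight j k) <= 2 * Rabs (weight j k - 1).
  by rewrite /Rabs; case: Rcase_abs; case: Rcase_abs; lra.
rewrite Cmod_mult Cmod_R /Rdiv Rabs_mult Rabs_inv.
apply: (Rmult_le_reg_l (Rabs (weight j k - 1))); first lra.
have -> : Rabs (weight j k - 1) * (Rabs (weight j k) * / Rabs (weight j k - 1) * Cmod (a j k)) =
  Rabs (weight j k) * Cmod (a j k) by field; lra.
have := Cmod_ge_0 (a j k); nra.
Qed.

Lemma bnd_kap s M a : 0 <= s -> bnd s M a -> bnd s (2 * M) (kap a).
Proof.
move=> hs ha.
have c2 : Cmod (RtoC 2) = 2 by rewrite Cmod_R Rabs_pos_eq; lra.
have := bnd_pscal s M (RtoC 2) a ha; rewrite c2; apply: bnd_dom => // j k.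
by rewrite /pscal Cmod_mult c2; apply: kap_coef.
Qed.

Lemma weight_diag_mul (b : nat -> R) (h : PS) j k : (forall k, h (S k) k = RtoC 0) ->
  (RtoC (weight j k - 1) * pmul (diagp b) (kap h) j k)%C = pmul (diagp b) (wder h) j k.
Proof.
move=> hres; rewrite /pmul -csum_scal; apply: csum_ext => p hp.
rewrite -csum_scal; apply: csum_ext => q hq.
rewrite /diagp /kap /wder; case: Nat.eqb_spec => [epq|_]; last by ring.
subst q.
case: Nat.eqb_spec => [e|hne]; first by rewrite e hres; ring.
have -> : weight (j - p) (k - p) = weight j k by rewrite /weight !minus_INR //; ring.
have hw : weight j k - 1 <> 0.
  by case: (weight_cases j k) => [e||]; try lra; apply: hne; lia.
rewrite /Rdiv RtoC_mult RtoC_inv //; field; exact: RtoC_neq0.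
Qed.

Lemma diag_mul_res (b : nat -> R) (u : PS) k : (forall k, u (S k) k = RtoC 0) ->
  pmul (diagp b) u (S k) k = RtoC 0.
Proof.
move=> hu; apply: csum_eq0 => p hp; apply: csum_eq0 => q hq.
rewrite /diagp; case: Nat.eqb_spec => [epq|_]; last by ring.
by subst q; rewrite (_ : (S k - p)%nat = S (k - p)) ?hu; [ring|lia].
Qed.

Lemma bnd_diagp s M (N : PS) (b : nat -> R) : 0 < s -> (forall j, Rabs (b j) <= Cmod (N (S j) j)) ->
  bnd s M N -> bnd s (M / s) (diagp b).
Proof.
move=> hs hb hN.
have := bnd_shift1 s M N (fun j k => N (S j) k) hs (fun _ _ => eq_refl) hN.
apply: bnd_dom => [|j k]; first lra.
rewrite /diagp; case: Nat.eqb_spec => [e|_]; first by subst k; rewrite Cmod_R.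
by rewrite Cmod_0; apply: Cmod_ge_0.
Qed.

Lemma agree_diagp n (N N' : PS) : agree (S n) N N' ->
  agree n (diagp (fun j => Re (N (S j) j))) (diagp (fun j => Re (N' (S j) j))).
Proof.
move=> h j k hjk; rewrite /diagp; case: Nat.eqb_spec => // e; subst k.
by rewrite h //=; lia.
Qed.

Lemma ord_diagp (b : nat -> R) : b 0%nat = 0 -> ord 1 (diagp b).
Proof. by move=> h; apply: ord1; rewrite /diagp /= h. Qed.

Lemma agree_kap n a a' : agree n a a' -> agree n (kap a) (kap a').
Proof. by move=> h j k hjk; rewrite /kap h. Qed.

Lemma agree_rho n a a' : agree n a a' -> agree n (rho a) (rho a').
Proof. by move=> h j k hjk; rewrite /rho h. Qed.

Lemma ord_kap d a : ord d a -> ord d (kap a).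
Proof. by move=> h j k hjk; rewrite /kap h //; case: (_ =? _)%nat => //; ring. Qed.

Lemma ord_rho d a : ord d a -> ord d (rho a).
Proof. by move=> h j k hjk; rewrite /rho h //; case: (_ =? _)%nat => //; ring. Qed.

Lemma ev_wder s M a z w : 0 < s -> bnd s M a -> Cmod z <= s / 2 -> Cmod w <= s / 2 ->
  ev (wder a) z w = (z * ev (pd1 a) z w - w * ev (pd2 a) z w)%C.
Proof.
move=> hs ha hz hw.
have b1 := bnd_pd1 s M a hs ha; have b2 := bnd_pd2 s M a hs ha.
have hs2 : 0 <= s / 2 by lra.
have m1 := bnd_pmul hs2 (bnd_pX _ hs2) b1.
have m2 := bnd_pmul hs2 (bnd_pY _ hs2) b2.
rewrite (ev_ext _ (padd (pmul pX (pd1 a)) (pscal (RtoC (-1)) (pmul pY (pd2 a))))).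
  rewrite (ev_padd hz hw m1 (bnd_pscal _ _ _ _ m2)).
  rewrite (ev_pscal hz hw m2).
  rewrite (ev_pmul hz hw (bnd_pX _ hs2) b1).
  rewrite (ev_pmul hz hw (bnd_pY _ hs2) b2).
  rewrite ev_pX ev_pY; ring.
move=> j k; rewrite /padd /pscal pmul_pX pmul_pY /wder /weight RtoC_minus /pd1 /pd2.
case: j => [|j]; case: k => [|k]; rewrite ?[INR 0]/=; ring.
Qed.

Lemma bnd_wder s M a : 0 < s -> bnd s M a -> bnd (s / 2) M (wder a).
Proof.
move=> hs; apply: bnd_deg; first lra.
move=> j k; rewrite /wder Cmod_mult Cmod_R; apply: Rmult_le_compat_r; first exact: Cmod_ge_0.
rewrite plus_INR /weight; have := pos_INR j; have := pos_INR k.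
rewrite /Rabs; case: Rcase_abs; lra.
Qed.

(* The counterterm [e] absorbs the obstructions to linearizing the orbits (the focal values):
   keeping [b] real makes the equation for [h] solvable with bounded operators only, hence
   convergent, whatever the field. *)
Lemma normal_form_series s0 M F : 0 < s0 -> bnd s0 M F -> ord 2 F ->
  exists s h b e, 0 < s /\ 2 * s <= s0 /\ bnd s s h /\ ord 2 h /\
    bnd s 1 (diagp b) /\ bnd s 1 (diagp e) /\ b 0%nat = 0 /\ e 0%nat = 0 /\
  forall z, Cmod z <= s / 2 -> let w := Cconj z in let y := (z + ev h z w)%C in
    ((1 + ev (diagp b) z w) * (z + (z * ev (pd1 h) z w - w * ev (pd2 h) z w)))%C =
    (y + ev F y (Cconj y) + Ci * (z * ev (diagp e) z w))%C.
Proof.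
move=> hs0 hF oF.
have hM : 0 <= M by apply: bnd_ge0 hF; lra.
have [s [hs [hss hsm]]] := choose_radius s0 M hs0 hM; have hs' := Rlt_le _ _ hs.
pose N h := near_id_comp F h.
pose bb h : nat -> R := fun j => Re (N h (S j) j).
pose T h := padd (rho (N h)) (pscal (RtoC (-1)) (pmul (diagp (bb h)) (kap h))).
set Mn := M * (2 * s / s0) ^ 2 in hsm.
have hMn : 0 <= Mn by apply: Rmult_le_pos => //; apply: pow2_ge_0.
have hMs : Mn / s <= 1.
  by apply: (Rmult_le_reg_r s) => //; rewrite /Rdiv Rmult_assoc Rinv_l; lra.
have c1 : Cmod (RtoC (-1)) = 1 by rewrite Cmod_R Rabs_left; lra.
have bN h : bnd s s h -> bnd s Mn (N h) by move=> bh; apply: bnd_near_id.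
have oN h : ord 1 h -> ord 2 (N h) by move=> oh; apply: ord_near_id.
have b0 h : ord 1 h -> bb h 0%nat = 0 by move=> /oN oh; rewrite /bb oh //; lia.
have bB h : bnd s s h -> bnd s (Mn / s) (diagp (bb h)).
  by move=> bh; apply: (bnd_diagp s Mn (N h)) => //; [move=> j; apply: fst_le_Cmod|apply: bN].
have oT h : ord 1 h -> ord 2 (T h).
  move=> oh; apply: ord_padd; first by apply: ord_rho; apply: oN.
  move=> j k hjk; rewrite /pscal (ord_mul 1 1) ?Cmult_0_r //.
    by apply: ord_diagp; apply: b0.
  exact: ord_kap.
have [||h [oh [bh eh]]] := formal_fixpoint T s s hs' hs'.
- move=> u ou bu; split; first by apply: (ord_le 1 2); [lia|apply: oT].
  apply: (bnd_le s (Mn + Cmod (RtoC (-1)) * (Mn / s * (2 * s)))); first lra.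
    by rewrite c1 Rmult_1_l; have -> : Mn / s * (2 * s) = 2 * Mn; [field|]; lra.
  apply: bnd_padd => //.
    apply: (bnd_dom s Mn (N u)) => //; [move=> j k; exact: rho_coef|exact: bN].
  by apply: bnd_pscal; apply: bnd_pmul => //; [apply: bB|apply: bnd_kap].
- move=> n u v ou ov huv.
  have hN : agree (S n) (N u) (N v) by apply: agree_near_id.
  apply: agree_padd; first exact: agree_rho.
  move=> j k hjk; rewrite /pscal; congr Cmult.
  apply: agree_mul_ord1 hjk; try (apply: ord_diagp; exact: b0); try exact: ord_kap.
    exact: agree_diagp.
  exact: agree_kap.
pose e : nat -> R := fun j => - Im (N h (S j) j).
have oh2 : ord 2 h by move=> j k hjk; rewrite eh; apply: oT.
have bE : bnd s (Mn / s) (diagp e).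
  apply: (bnd_diagp s Mn (N h)) => //; last exact: bN.
  by move=> j; rewrite /e Rabs_Ropp; apply: snd_le_Cmod.
have hres k : h (S k) k = RtoC 0.
  rewrite eh /T /padd /rho Nat.eqb_refl /pscal diag_mul_res; first by ring.
  by move=> i; rewrite /kap Nat.eqb_refl.
exists s, h, (bb h), e; do 4 (split => //).
split; first by apply: bnd_le (bB h bh); lra.
split; first by apply: bnd_le bE; lra.
split; first exact: b0.
split; first by rewrite /e (oN h oh) /=; [ring|lia].
move=> z hz w y.
have hz1 : Cmod z <= s by lra.
have hw : Cmod w <= s / 2 by rewrite Cmod_conj.
have hw1 : Cmod w <= s by lra.
have hs2 : 0 <= s / 2 by lra.
have [_ eN] := ev_near_id s s0 M F h z hs hss hF bh hz1.
rewrite -/y -/w -/(N h) in eN; rewrite -eN.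
rewrite -(ev_wder s s h z w hs bh hz hw).
have hhalf c A : bnd s A c -> bnd (s / 2) A c by apply: bnd_le; lra.
have bB2 := hhalf _ _ (bB h bh); have bE2 := hhalf _ _ bE.
have bh2 := hhalf _ _ bh; have bN2 := hhalf _ _ (bN h bh).
have bX := bnd_pX (s / 2) hs2.
have bW := bnd_wder s s h hs bh.
have mBX := bnd_pmul hs2 bX bB2.
have mBW := bnd_pmul hs2 bB2 bW.
have mEX := bnd_pscal _ _ Ci _ (bnd_pmul hs2 bX bE2).
have ident j k : padd (wder h) (padd (pmul pX (diagp (bb h))) (pmul (diagp (bb h)) (wder h))) j k =
    padd h (padd (N h) (pscal Ci (pmul pX (diagp e)))) j k.
  rewrite /padd /pscal !pmul_pX.
  case: (Nat.eq_dec j (S k)) => [ejk|hne].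
    subst j; rewrite diag_mul_res; last by move=> i; rewrite /wder hres; ring.
    rewrite /wder hres /diagp Nat.eqb_refl /bb /e.
    by apply: Ceq; rewrite /= /Re /Im; ring.
  have -> : (match j with 0%nat => RtoC 0 | S j0 => diagp (bb h) j0 k end) = RtoC 0.
    by case: j hne => [|j] hne //; rewrite /diagp; case: Nat.eqb_spec => // ejk; subst j.
  have -> : (match j with 0%nat => RtoC 0 | S j0 => diagp e j0 k end) = RtoC 0.
    by case: j hne => [|j] hne //; rewrite /diagp; case: Nat.eqb_spec => // ejk; subst j.
  rewrite -weight_diag_mul // /wder.
  have hw0 : weight j k - 1 <> 0 by case: (weight_cases j k) => //; lra.
  have key : (RtoC (weight j k - 1) * h j k = N h j k -
      RtoC (weight j k - 1) * pmul (diagp (bb h)) (kap h) j k)%C.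
    rewrite {1}(eh j k) {1}/T /padd /pscal /rho; have /Nat.eqb_neq -> := hne.
    by rewrite RtoC_inv //; field; apply: RtoC_neq0.
  have -> : (RtoC (weight j k) * h j k = RtoC (weight j k - 1) * h j k + h j k)%C.
    by rewrite RtoC_minus; ring.
  rewrite key; ring.
have e1 := ev_ext _ _ z w ident.
rewrite (ev_padd hz hw bW (bnd_padd hs2 mBX mBW)) in e1.
rewrite (ev_padd hz hw mBX mBW) in e1.
rewrite (ev_padd hz hw bh2 (bnd_padd hs2 bN2 mEX)) in e1.
rewrite (ev_padd hz hw bN2 mEX) in e1.
rewrite (ev_pscal hz hw (bnd_pmul hs2 bX bE2)) in e1.
rewrite (ev_pmul hz hw bX bB2) (ev_pmul hz hw bB2 bW) in e1.
rewrite (ev_pmul hz hw bX bE2) ev_pX in e1.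
set W := ev (wder h) z w in e1 *.
set B := ev (diagp (bb h)) z w in e1 *.
have -> : ((1 + B) * (z + W) = z + (W + (z * B + B * W)))%C by ring.
rewrite e1 /y; ring.
Qed.

(** * Analytic functions in complex notation *)

(* [C] is [R * R]: real power series in [(x, y)] become series in [z = x + i y] and its conjugate. *)
Definition zan (G : C -> C) (p : C) :=
  exists a s M, 0 < s /\ bnd s M a /\
    forall h, Cmod h <= s -> G (p + h)%C = ev a h (Cconj h).

Lemma sum_n_rsum (f : nat -> R) n : sum_n f n = rsum f n.
Proof. exact: sum_n_Reals. Qed.

Lemma locally_Cmod (P : C -> Prop) (p : C) :
  @locally (prod_UniformSpace R_UniformSpace R_UniformSpace) p P <->
  exists s, 0 < s /\ forall h, Cmod h <= s -> P (p + h)%C.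
Proof.
split=> [[eps h]|[s [hs h]]].
  have he := cond_pos eps.
  exists (eps / 2); split; first lra.
  move=> k hk; apply: h; have h1 := fst_le_Cmod k; have h2 := snd_le_Cmod k.
  split; rewrite /ball /= /AbsRing_ball /abs /minus /plus /opp /=.
    by have -> : fst p + fst k + - fst p = fst k by [ring]; lra.
  by have -> : snd p + snd k + - snd p = snd k by [ring]; lra.
have hs2 : 0 < s / 2 by lra.
exists (mkposreal _ hs2) => q [h1 h2].
have -> : q = (p + (q - p))%C by Cring.
apply: h.
rewrite /ball /= /AbsRing_ball /abs /minus /plus /opp /= in h1 h2.
apply: Rle_trans (Cmod_2Rmax _) _.
have : Rmax (Rabs (fst (q - p)%C)) (Rabs (snd (q - p)%C)) <= s / 2.
  by apply: Rmax_lub => /=; lra.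
have s2 : 0 <= sqrt 2 <= 2.
  split; first exact: sqrt_pos.
  by rewrite -[X in _ <= X]sqrt_Rsqr; [apply: sqrt_le_1; rewrite /Rsqr; lra|lra].
have := Rle_trans _ _ _ (Rabs_pos _) (Rmax_l (Rabs (fst (q - p)%C)) (Rabs (snd (q - p)%C))).
nra.
Qed.

Lemma Cmod_le_sum z : Cmod z <= Rabs (fst z) + Rabs (snd z).
Proof.
have {1}-> : z = (RtoC (fst z) + Ci * RtoC (snd z))%C by Cring.
apply: Rle_trans (Cmod_triangle _ _) _.
by rewrite Cmod_mult Cmod_Ci !Cmod_R; lra.
Qed.

Lemma RtoC_pow' x n : (RtoC x ^ n)%C = RtoC (x ^ n).
Proof. by elim: n => [|n IH] //=; rewrite IH RtoC_mult. Qed.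

Definition ran (f : C -> R) (p : C) :=
  exists (a : nat -> nat -> R) s M, 0 < s /\ bnd s M (fun j k => RtoC (a j k)) /\
    forall h, Cmod h <= s ->
      RtoC (f (p + h)%C) = ev (fun j k => RtoC (a j k)) (RtoC (fst h)) (RtoC (snd h)).

Lemma term_real (a : nat -> nat -> R) u v j k :
  (RtoC (a j k) * (RtoC u ^ j * RtoC v ^ k))%C = RtoC (a j k * u ^ j * v ^ k).
Proof. by rewrite !RtoC_pow' -!RtoC_mult Rmult_assoc. Qed.

Lemma ev_real (a : nat -> nat -> R) u v :
  ev (fun j k => RtoC (a j k)) (RtoC u) (RtoC v) = RtoC (S2 (fun j k => a j k * u ^ j * v ^ k)).
Proof.
rewrite /ev (CS2_ext _ (fun j k => RtoC (a j k * u ^ j * v ^ k))); last by move=> j k; apply: term_real.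
apply: Ceq => //=.
rewrite (Series_ext _ (fun _ => 0 * 0)); first by rewrite Series_scal_l; ring.
move=> j; rewrite (Series_ext _ (fun _ => 0 * 0)); first by rewrite Series_scal_l; ring.
by move=> k; ring.
Qed.

Lemma dsummable_real (a : nat -> nat -> R) s M u v :
  bnd s M (fun j k => RtoC (a j k)) -> Rabs u <= s -> Rabs v <= s ->
  dsummable (fun j k => a j k * u ^ j * v ^ k) (S2 (fun j k => a j k * u ^ j * v ^ k)) /\
  ex_series (diag (fun j k => Rabs (a j k * u ^ j * v ^ k))).
Proof.
move=> ha hu hv.
have hsq N : sq (fun j k => Rabs (a j k * u ^ j * v ^ k)) N <= M.
  apply: Rle_trans (ha N); apply: sq_le => j k.
  rewrite Cmod_R !Rabs_mult Rmult_assoc pow_add -!RPow_abs.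
  apply: Rmult_le_compat_l; first exact: Rabs_pos.
  apply: Rmult_le_compat; try (apply: pow_le; exact: Rabs_pos);
    apply: pow_incr; split => //; exact: Rabs_pos.
split; first exact: dsummable_abs hsq.
have [l [_ [_ [_ h]]]] := dsummable_pos _ M (fun j k => Rabs_pos _) hsq.
by exists l.
Qed.

Lemma has_power_series_bnd a f p : has_power_series a p f ->
  exists s M, 0 < s /\ bnd s M (fun j k => RtoC (a j k)) /\
    forall h, Cmod h <= s ->
      RtoC (f (p + h)%C) = ev (fun j k => RtoC (a j k)) (RtoC (fst h)) (RtoC (snd h)).
Proof.
move=> /locally_Cmod [s [hs h]].
have hs2 : 0 < s / 2 by lra.
have hM : exists M, bnd (s / 2) M (fun j k => RtoC (a j k)).
  have [|hex _] := h (s / 2, s / 2).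
    apply: Rle_trans (Cmod_le_sum _) _ => /=.
    by rewrite !Rabs_pos_eq; lra.
  exists (Series (diag (fun j k => Rabs (a j k * (s / 2) ^ j * (s / 2) ^ k)))) => N.
  have hex' : ex_series (diag (fun j k => Rabs (a j k * (s / 2) ^ j * (s / 2) ^ k))).
    apply: ex_series_ext hex => n; rewrite sum_n_rsum; apply: rsum_ext => i hi /=.
    have e1 : fst p + s / 2 - fst p = s / 2 by ring.
    have e2 : snd p + s / 2 - snd p = s / 2 by ring.
    by rewrite e1 e2.
  have h0 j k : 0 <= Rabs (a j k * (s / 2) ^ j * (s / 2) ^ k) by apply: Rabs_pos.
  rewrite (sq_ext _ (fun j k => Rabs (a j k * (s / 2) ^ j * (s / 2) ^ k))).
    apply: Rle_trans (sq_le_tri _ _ h0) _; apply: rsum_le_Series => // n.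
    by apply: rsum_ge0.
  move=> j k; rewrite Cmod_R !Rabs_mult pow_add -!RPow_abs.
  by rewrite (Rabs_pos_eq (s / 2)); [ring|lra].
have [M ha] := hM.
exists (s / 2), M; split => //; split => // k hk.
have [|_ hser] := h k; first lra.
rewrite ev_real; congr RtoC.
have [[_ [_ [_ h4]]] _] := dsummable_real a (s / 2) M (fst k) (snd k) ha
  (Rle_trans _ _ _ (fst_le_Cmod k) hk) (Rle_trans _ _ _ (snd_le_Cmod k) hk).
rewrite -(is_series_unique _ _ h4) -(is_series_unique _ _ hser).
apply: Series_ext => n; rewrite sum_n_rsum; apply: rsum_ext => i hi /=.
have e1 : fst p + fst k - fst p = fst k by ring.
have e2 : snd p + snd k - snd p = snd k by ring.
by rewrite e1 e2.
Qed.

Lemma analytic_ran f p : analytic_at f p <-> ran f p.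
Proof.
split=> [[a /has_power_series_bnd [s [M h]]]|[a [s [M [hs [ha h]]]]]]; first by exists a, s, M.
exists a; apply/locally_Cmod; exists s; split => // k hk.
have [[_ [_ [_ h4]]] h5] := dsummable_real a s M (fst k) (snd k) ha
    (Rle_trans _ _ _ (fst_le_Cmod k) hk) (Rle_trans _ _ _ (snd_le_Cmod k) hk).
have e1 : fst p + fst k - fst p = fst k by ring.
have e2 : snd p + snd k - snd p = snd k by ring.
rewrite /= e1 e2; split.
  by apply: ex_series_ext h5 => n; rewrite sum_n_rsum.
have := h k hk; rewrite ev_real => -[->].
by apply: is_series_ext h4 => n; rewrite sum_n_rsum.
Qed.

Lemma ev_fst (A : PS) u v :
  RtoC (fst (ev A (RtoC u) (RtoC v))) = ev (fun j k => RtoC (fst (A j k))) (RtoC u) (RtoC v).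
Proof.
rewrite (ev_real (fun j k => fst (A j k))); congr RtoC.
apply: Series_ext => j; apply: Series_ext => k.
rewrite !RtoC_pow' -RtoC_mult /=; ring.
Qed.

Lemma ev_snd (A : PS) u v :
  RtoC (snd (ev A (RtoC u) (RtoC v))) = ev (fun j k => RtoC (snd (A j k))) (RtoC u) (RtoC v).
Proof.
rewrite (ev_real (fun j k => snd (A j k))); congr RtoC.
apply: Series_ext => j; apply: Series_ext => k.
rewrite !RtoC_pow' -RtoC_mult /=; ring.
Qed.

Lemma zan_real_coords G p : zan G p -> exists A s M, 0 < s /\ bnd s M A /\
  forall h, Cmod h <= s -> G (p + h)%C = ev A (RtoC (fst h)) (RtoC (snd h)).
Proof.
move=> [a [s [M [hs [ha h]]]]].
have hs2 : 0 < s / 2 by lra.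
have hs2' : 0 <= s / 2 by lra.
pose U := padd pX (pscal Ci pY); pose V := padd pX (pscal (- Ci)%C pY).
have b1 : bnd (s / 2) s U.
  apply: (bnd_le (s / 2) (s / 2 + Cmod Ci * (s / 2))); first lra.
    by rewrite Cmod_Ci; lra.
  by apply: bnd_padd => //; [apply: bnd_pX|apply: bnd_pscal; apply: bnd_pY].
have b2 : bnd (s / 2) s V.
  apply: (bnd_le (s / 2) (s / 2 + Cmod (- Ci)%C * (s / 2))); first lra.
    by rewrite Cmod_opp Cmod_Ci; lra.
  by apply: bnd_padd => //; [apply: bnd_pX|apply: bnd_pscal; apply: bnd_pY].
exists (Comp a U V), (s / 2), M; split => //; split; first exact: (bnd_Comp _ s).
move=> k hk.
have h1 : Cmod (RtoC (fst k)) <= s / 2 by rewrite Cmod_R; apply: Rle_trans (fst_le_Cmod k) hk.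
have h2 : Cmod (RtoC (snd k)) <= s / 2 by rewrite Cmod_R; apply: Rle_trans (snd_le_Cmod k) hk.
rewrite h; last lra.
rewrite (ev_Comp (s / 2) s M) // /U /V.
rewrite !(ev_padd h1 h2 (bnd_pX _ hs2') (bnd_pscal _ _ _ _ (bnd_pY _ hs2'))).
rewrite !(ev_pscal h1 h2 (bnd_pY _ hs2')) ev_pX ev_pY.
by congr ev; Cring.
Qed.

Lemma ord_pscal d c a : ord d a -> ord d (pscal c a).
Proof. by move=> h j k hjk; rewrite /pscal h //; ring. Qed.

Lemma complex_coords_series (G : C -> C) p A s M : 0 < s -> bnd s M A ->
  (forall h, Cmod h <= s -> G (p + h)%C = ev A (RtoC (fst h)) (RtoC (snd h))) ->
  exists a, (forall d, ord d A -> ord d a) /\ bnd s M a /\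
    forall h, Cmod h <= s -> G (p + h)%C = ev a h (Cconj h).
Proof.
move=> hs hA h; have hs' := Rlt_le _ _ hs.
pose U := pscal (RtoC (/ 2)) (padd pX pY).
pose V := pscal (Ci * RtoC (- / 2))%C (padd pX (pscal (RtoC (-1)) pY)).
have c1 : Cmod (RtoC (-1)) = 1 by rewrite Cmod_R Rabs_left; lra.
have c2 : Cmod (RtoC (/ 2)) = / 2 by rewrite Cmod_R Rabs_pos_eq; lra.
have c3 : Cmod (Ci * RtoC (- / 2))%C = / 2.
  by rewrite Cmod_mult Cmod_Ci Cmod_R Rabs_left; lra.
have bX := bnd_pX s hs'; have bY := bnd_pY s hs'.
have b1 : bnd s s U.
  apply: (bnd_le s (Cmod (RtoC (/ 2)) * (s + s))); [lra|rewrite c2; lra|].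
  by apply: bnd_pscal; apply: bnd_padd.
have b2 : bnd s s V.
  apply: (bnd_le s (Cmod (Ci * RtoC (- / 2))%C * (s + Cmod (RtoC (-1)) * s))); [lra|rewrite c3 c1; lra|].
  by apply: bnd_pscal; apply: bnd_padd => //; apply: bnd_pscal.
exists (Comp A U V); split.
  move=> d hd; apply: ord_Comp => //; apply: ord_pscal; apply: ord_padd; try exact: ord_pX.
    exact: ord_pY.
  by apply: ord_pscal; exact: ord_pY.
split; first exact: (bnd_Comp _ s).
move=> k hk; rewrite h //.
have hk' : Cmod (Cconj k) <= s by rewrite Cmod_conj.
rewrite (ev_Comp s s M) // /U /V.
rewrite (ev_pscal hk hk' (bnd_padd hs' bX bY)).
rewrite (ev_pscal hk hk' (bnd_padd hs' bX (bnd_pscal _ _ (RtoC (-1)) _ bY))).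
rewrite (ev_padd hk hk' bX bY).
rewrite (ev_padd hk hk' bX (bnd_pscal _ _ (RtoC (-1)) _ bY)).
rewrite (ev_pscal hk hk' bY) ev_pX ev_pY.
by congr ev; apply: Ceq => /=; field.
Qed.

Lemma zan_of_real_coords (G : C -> C) p A s M : 0 < s -> bnd s M A ->
  (forall h, Cmod h <= s -> G (p + h)%C = ev A (RtoC (fst h)) (RtoC (snd h))) -> zan G p.
Proof.
move=> hs hA /(complex_coords_series G p A s M hs hA) [a [_ h]].
by exists a, s, M.
Qed.

Lemma jet_series d (G : C -> C) p :
  vanishes_to_order d (fun q => fst (G q)) p -> vanishes_to_order d (fun q => snd (G q)) p ->
  exists a s M, 0 < s /\ bnd s M a /\ ord d a /\
    forall h, Cmod h <= s -> G (p + h)%C = ev a h (Cconj h).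
Proof.
move=> [a [/has_power_series_bnd [s [M [hs [ha h]]]] oa]].
move=> [a' [/has_power_series_bnd [s' [M' [hs' [ha' h']]]] oa']].
pose t := Rmin s s'.
have ht : 0 < t by apply: Rmin_glb_lt.
have bA : bnd t M (fun j k => RtoC (a j k)).
  by apply: bnd_le ha; [split; [lra|exact: Rmin_l]|lra].
have bA' : bnd t M' (fun j k => RtoC (a' j k)).
  by apply: bnd_le ha'; [split; [lra|exact: Rmin_r]|lra].
have bC := bnd_pscal _ _ Ci _ bA'.
have ht' : 0 <= t by lra.
have [k hk|c [oc hc]] := complex_coords_series G p _ t _ ht (bnd_padd ht' bA bC).
  have h1 : Cmod (RtoC (fst k)) <= t by rewrite Cmod_R; apply: Rle_trans (fst_le_Cmod k) hk.
  have h2 : Cmod (RtoC (snd k)) <= t by rewrite Cmod_R; apply: Rle_trans (snd_le_Cmod k) hk.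
  rewrite (ev_padd h1 h2 bA bC) (ev_pscal h1 h2 bA').
  rewrite -h; last by apply: le_Rmin_l hk.
  rewrite -h'; last by apply: le_Rmin_r hk.
  by Cring.
exists c, t, (M + Cmod Ci * M'); split => //; split; first by case: hc.
split; last by case: hc.
apply: oc; apply: ord_padd; first by move=> j k hjk; rewrite oa.
by apply: ord_pscal => j k hjk; rewrite oa'.
Qed.

Lemma analytic_map_zan G p : analytic_map_at G p <-> zan G p.
Proof.
split=> [[[a ha] [a' ha']]|hG].
  have [||c [s [M [hs [hc [_ h]]]]]] := jet_series 0 G p; [by exists a; split => // i j; lia|by exists a'; split => // i j; lia|].
  by exists c, s, M.
have [A [s [M [hs [hA h]]]]] := zan_real_coords G p hG.
have hs' := Rlt_le _ _ hs.
split; apply/analytic_ran.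
  exists (fun j k => fst (A j k)), s, M; split => //; split.
    by apply: bnd_dom hA => // j k; rewrite Cmod_R; apply: fst_le_Cmod.
  by move=> k hk; rewrite h // ev_fst.
exists (fun j k => snd (A j k)), s, M; split => //; split.
  by apply: bnd_dom hA => // j k; rewrite Cmod_R; apply: snd_le_Cmod.
by move=> k hk; rewrite h // ev_snd.
Qed.

Lemma analytic_zan f p : analytic_at f p <-> zan (fun q => RtoC (f q)) p.
Proof.
split=> [/analytic_ran [a [s [M [hs [ha h]]]]]|/analytic_map_zan []] //.
exact: zan_of_real_coords hs ha h.
Qed.

Lemma ev_00 a : ev a (RtoC 0) (RtoC 0) = a 0%nat 0%nat.
Proof.
have hp j : (j <> 0)%nat -> (RtoC 0 ^ j)%C = RtoC 0 by case: j => [|j] // _; rewrite /=; ring.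
rewrite /ev (CS2_fin _ 0); first by rewrite /csq; Cring.
case=> [|j] k hjk; last by rewrite (hp (S j)) //; ring.
by rewrite (hp k); [ring|lia].
Qed.

Lemma zan_radius G p : zan G p -> exists a M s0, 0 < s0 /\ a 0%nat 0%nat = G p /\
  forall s, 0 < s <= s0 -> bnd s M a /\ forall h, Cmod h <= s -> G (p + h)%C = ev a h (Cconj h).
Proof.
move=> [a [s [M [hs [ha h]]]]]; exists a, M, s; split => //; split.
  have := h (RtoC 0); rewrite Cmod_0 Cplus_0_r => -> //; last lra.
  rewrite Cconj_0.
  by rewrite ev_00.
move=> t ht; split; first by apply: bnd_le ha; lra.
by move=> k hk; apply: h; lra.
Qed.

Lemma zan_loc G G' p : (exists s, 0 < s /\ forall h, Cmod h <= s -> G (p + h)%C = G' (p + h)%C) ->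
  zan G p -> zan G' p.
Proof.
move=> [s [hs e]] [a [s' [M [hs' [ha h]]]]].
have ht : 0 < Rmin s s' by apply: Rmin_glb_lt.
exists a, (Rmin s s'), M; split => //; split.
  by apply: bnd_le ha; [split; [lra|exact: Rmin_r]|lra].
move=> k hk; rewrite -e ?h //; [exact: le_Rmin_r hk|exact: le_Rmin_l hk].
Qed.

Lemma zan_ext G G' p : (forall q, G q = G' q) -> zan G p -> zan G' p.
Proof. by move=> e; apply: zan_loc; exists 1; split; [lra|]. Qed.

Lemma zan_const c p : zan (fun _ => c) p.
Proof.
exists (pconst c), 1, (Cmod c); split; first lra.
by split; [apply: bnd_pconst; lra|move=> h _; rewrite ev_pconst].
Qed.

Lemma zan_id p : zan (fun q => q) p.
Proof.
exists (padd (pconst p) pX), 1, (Cmod p + 1); split; first lra.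
have h0 : 0 <= 1 by lra.
split; first by apply: bnd_padd => //; [apply: bnd_pconst|apply: bnd_pX].
move=> h hh; have hh' : Cmod (Cconj h) <= 1 by rewrite Cmod_conj.
by rewrite (ev_padd hh hh' (bnd_pconst _ _ h0) (bnd_pX _ h0)) ev_pconst ev_pX.
Qed.

Section Zan2.
Variables (G G' : C -> C) (p : C).
Hypotheses (hG : zan G p) (hG' : zan G' p).

Lemma zan_common : exists a a' M M' s, 0 < s /\ bnd s M a /\ bnd s M' a' /\
  forall h, Cmod h <= s -> G (p + h)%C = ev a h (Cconj h) /\ G' (p + h)%C = ev a' h (Cconj h).
Proof.
have [a [M [s [hs [_ h]]]]] := zan_radius _ _ hG.
have [a' [M' [s' [hs' [_ h']]]]] := zan_radius _ _ hG'.
have ht : 0 < Rmin s s' by apply: Rmin_glb_lt.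
have [h1 h2] := h (Rmin s s') (conj ht (Rmin_l _ _)).
have [h3 h4] := h' (Rmin s s') (conj ht (Rmin_r _ _)).
exists a, a', M, M', (Rmin s s'); do 3 (split => //).
by move=> k hk; rewrite h2 // h4.
Qed.

Lemma zan_plus : zan (fun q => G q + G' q)%C p.
Proof.
have [a [a' [M [M' [s [hs [h1 [h2 h]]]]]]]] := zan_common.
exists (padd a a'), s, (M + M'); split => //; split; first by apply: bnd_padd => //; lra.
move=> k hk; have hk' : Cmod (Cconj k) <= s by rewrite Cmod_conj.
by have [-> ->] := h k hk; rewrite (ev_padd hk hk' h1 h2).
Qed.

Lemma zan_mult : zan (fun q => G q * G' q)%C p.
Proof.
have [a [a' [M [M' [s [hs [h1 [h2 h]]]]]]]] := zan_common.
exists (pmul a a'), s, (M * M'); split => //; split; first by apply: bnd_pmul => //; lra.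
move=> k hk; have hk' : Cmod (Cconj k) <= s by rewrite Cmod_conj.
by have [-> ->] := h k hk; rewrite (ev_pmul hk hk' h1 h2).
Qed.
End Zan2.

Lemma zan_conj G p : zan G p -> zan (fun q => Cconj (G q)) p.
Proof.
move=> [a [s [M [hs [ha h]]]]]; exists (cj a), s, M; split => //; split.
  by apply: bnd_cj => //; lra.
by move=> k hk; rewrite h // (ev_cj s M).
Qed.

Lemma zan_comp F G p : zan F (G p) -> zan G p -> zan (fun q => F (G q)) p.
Proof.
move=> [b [sF [MF [hsF [hb hF]]]]] /zan_radius [a [M [s [hs [a0 hG]]]]].
have [ba _] := hG s ltac:(lra).
have hM : 0 <= M by apply: bnd_ge0 ba; lra.
pose u := tail a 0.
have ou : forall j k, (j + k < 1)%nat -> u j k = RtoC 0.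
  by move=> j k hjk; rewrite /u /tail; have /Nat.leb_le -> : (j + k <= 0)%nat by lia.
have bu : bnd s M u by apply: bnd_tail => //; lra.
pose t := Rmin s (s * sF / (M + 1)).
have ht : 0 < t.
  apply: Rmin_glb_lt => //; apply: Rdiv_lt_0_compat; last lra.
  exact: Rmult_lt_0_compat.
have hts : t <= s := Rmin_l _ _.
have bu' : bnd t sF u.
  have hts' : 0 <= t <= s by lra.
  apply: bnd_le (bnd_order s M t 1 u hs hts' ou bu); first lra.
  have : t <= s * sF / (M + 1) := Rmin_r _ _.
  move=> h1; have h2 : t * (M + 1) <= s * sF.
    apply: Rle_trans (Rmult_le_compat_r _ _ _ _ h1) _; first lra.
    by apply: Req_le; field; lra.
  apply: (Rmult_le_reg_r s) => //.
  have -> : M * (t / s) ^ 1 * s = M * t by field; lra.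
  nra.
have ht' : 0 <= t by lra.
have [ba' hG'] := hG t (conj ht hts).
exists (Comp b u (cj u)), t, MF; split => //; split.
  by apply: (bnd_Comp t sF) => //; apply: bnd_cj.
move=> k hk; have hk' : Cmod (Cconj k) <= t by rewrite Cmod_conj.
rewrite (ev_Comp t sF MF) //; last exact: bnd_cj.
rewrite (ev_cj t sF) // hG' //.
have e : ev a k (Cconj k) = (G p + ev u k (Cconj k))%C.
  rewrite -a0 -{1}(ev_pconst (a 0%nat 0%nat) k (Cconj k)).
  rewrite -(ev_padd hk hk' (bnd_pconst _ _ ht') bu').
  by apply: ev_ext; case=> [|j] [|i]; rewrite /padd /u /tail /=; ring.
by rewrite e hF //; apply: @ev_bound bu'.
Qed.

Lemma zan_open G p : zan G p -> exists s, 0 < s /\ forall h, Cmod h <= s -> zan G (p + h)%C.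
Proof.
move=> [a [s [M [hs [ha h]]]]]; exists (s / 2); split; first lra.
move=> k hk.
have hs2 : 0 < s / 2 by lra.
have hss : s / 2 + s / 2 <= s by lra.
have hk' : Cmod (Cconj k) <= s / 2 by rewrite Cmod_conj.
exists (recenter a k (Cconj k)), (s / 2), M; split => //; split.
  exact: (bnd_recenter s M (s / 2) (s / 2) a k (Cconj k) hs2 hss hk hk' ha).
move=> l hl; have hl' : Cmod (Cconj l) <= s / 2 by rewrite Cmod_conj.
rewrite (ev_recenter s M (s / 2) (s / 2) a k (Cconj k) hs2 hss hk hk' ha l (Cconj l) hl hl').
rewrite -Cplus_assoc h.
  by congr ev; Cring.
by apply: Rle_trans (Cmod_triangle _ _) _; lra.
Qed.

(* Real differentiability in Wirtinger form. *)
Definition zdiff (G : C -> C) (p al be : C) :=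
  exists K s, 0 < s /\ 0 <= K /\ forall h, Cmod h <= s ->
    Cmod (G (p + h) - (G p + al * h + be * Cconj h))%C <= K * Cmod h ^ 2.

Lemma zdiff_ev s M a p (G : C -> C) : 0 < s -> bnd s M a ->
  (forall h, Cmod h <= s -> G h = ev a h (Cconj h)) -> Cmod p < s / 2 ->
  zdiff G p (ev (pd1 a) p (Cconj p)) (ev (pd2 a) p (Cconj p)).
Proof.
move=> hs ha h hp.
have hM : 0 <= M by apply: bnd_ge0 ha; lra.
exists (M / (s / 2) ^ 2), (s / 2); split; first lra.
split; first by apply: Rdiv_le_0_compat => //; apply: pow_lt; lra.
move=> k hk; rewrite !h; try lra; last by apply: Rle_trans (Cmod_triangle _ _) _; lra.
have -> : Cconj (p + k)%C = (Cconj p + Cconj k)%C by Cring.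
have -> : M / (s / 2) ^ 2 * Cmod k ^ 2 = M * (Cmod k / (s / 2)) ^ 2 by field; lra.
apply: (ev_diff s M) => //; rewrite ?Cmod_conj; try lra.
by split=> //; exact: Cmod_ge_0.
Qed.

Lemma zan_zdiff G p : zan G p -> exists al be, zdiff G p al be.
Proof.
move=> [a [s [M [hs [ha h]]]]].
have [K [t [ht [hK hz]]]] := zdiff_ev s M a (RtoC 0) (fun h => G (p + h)%C) hs ha h
  ltac:(rewrite Cmod_0; lra).
eexists; eexists; exists K, t; split => //; split => // k hk.
by have := hz k hk; rewrite Cplus_0_l Cplus_0_r; apply.
Qed.

(** * Derivatives along vectors and curves *)

Definition ld (f : R * R -> R) (p v : R * R) : R := lie_derivative (fun _ => v) f p.
Definition Dmap (G : R * R -> R * R) (p v : R * R) : C :=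
  (ld (fun q => fst (G q)) p v, ld (fun q => snd (G q)) p v).

Lemma ld_val f p v lx ly :
  differentiable_pt_lim (fun x y => f (x, y)) (fst p) (snd p) lx ly ->
  ld f p v = fst v * lx + snd v * ly.
Proof.
move=> /differentiable_pt_lim_unique [h1 h2].
by rewrite /ld /lie_derivative h1 h2.
Qed.

Arguments ld_val {f p v lx ly}.
Lemma zdiff_lim G p al be (pr : C -> R) : (forall z w, pr (z + w)%C = pr z + pr w) ->
  (forall r z, pr (RtoC r * z)%C = r * pr z) -> (forall z, Rabs (pr z) <= Cmod z) ->
  zdiff G p al be ->
  differentiable_pt_lim (fun x y => pr (G (x, y))) (fst p) (snd p)
    (pr (al + be)%C) (pr (Ci * (al - be))%C).
Proof.
move=> hadd hscal hle [K [s [hs [hK h]]]] eps.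
have he := cond_pos eps.
have hd : 0 < Rmin (s / 2) (eps / (4 * K + 1)).
  by apply: Rmin_glb_lt; [lra|apply: Rdiv_lt_0_compat; lra].
exists (mkposreal _ hd) => u v /= hu hv.
pose k : C := (u - fst p, v - snd p).
set m := Rmax _ _.
have hm0 : 0 <= m := Rle_trans _ _ _ (Rabs_pos _) (Rmax_l _ _).
have hm : m < Rmin (s / 2) (eps / (4 * K + 1)) by apply: Rmax_lub_lt.
have hkm : Cmod k <= 2 * m.
  apply: Rle_trans (Cmod_le_sum k) _.
  have := Rmax_l (Rabs (u - fst p)) (Rabs (v - snd p)).
  have := Rmax_r (Rabs (u - fst p)) (Rabs (v - snd p)).
  rewrite -/m /=; lra.
have hms : m < s / 2 := lt_Rmin_l hm.
have hme : m < eps / (4 * K + 1) := lt_Rmin_r hm.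
have hme' : m * (4 * K + 1) <= eps.
  apply: (Rle_trans _ (eps / (4 * K + 1) * (4 * K + 1))).
    by apply: Rmult_le_compat_r; lra.
  by apply: Req_le; field; lra.
have hk : Cmod k <= s by lra.
have e1 : (u, v) = (p + k)%C by Cring.
have e2 : p = (fst p, snd p) :> C by apply: Ceq.
rewrite e1 -e2.
have -> : pr (G (p + k)%C) - pr (G p) -
   (pr (al + be)%C * (u - fst p) + pr (Ci * (al - be))%C * (v - snd p)) =
   pr (G (p + k) - (G p + al * k + be * Cconj k))%C.
  have -> : (G (p + k) - (G p + al * k + be * Cconj k) = G (p + k) +
    (RtoC (-1) * G p + (RtoC (- (u - fst p)) * (al + be) + RtoC (- (v - snd p)) * (Ci * (al - be)))))%C.
    move: (G (p + k)%C) (G p) => g1 g0; by Cring.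
  rewrite !hadd !hscal ?hadd; ring.
apply: Rle_trans (hle _) _; apply: Rle_trans (h k hk) _.
have h1 : Cmod k ^ 2 <= (2 * m) ^ 2 by apply: pow_incr; split; [exact: Cmod_ge_0|].
have h2 : K * Cmod k ^ 2 <= K * (2 * m) ^ 2 by apply: Rmult_le_compat_l.
have h3 : m * (4 * K + 1) * m <= eps * m by apply: Rmult_le_compat_r.
nra.
Qed.

Lemma zdiff_fst G p al be : zdiff G p al be ->
  differentiable_pt_lim (fun x y => fst (G (x, y))) (fst p) (snd p)
    (fst (al + be)%C) (fst (Ci * (al - be))%C).
Proof.
apply: (zdiff_lim G p al be (fun z => fst z)) => //; last exact: fst_le_Cmod.
by move=> r z /=; ring.
Qed.

Lemma zdiff_snd G p al be : zdiff G p al be ->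
  differentiable_pt_lim (fun x y => snd (G (x, y))) (fst p) (snd p)
    (snd (al + be)%C) (snd (Ci * (al - be))%C).
Proof.
apply: (zdiff_lim G p al be (fun z => snd z)) => //; last exact: snd_le_Cmod.
by move=> r z /=; ring.
Qed.

Lemma D_zdiff G p al be v : zdiff G p al be -> Dmap G p v = (al * v + be * Cconj v)%C.
Proof.
move=> h; apply: Ceq.
  by rewrite /Dmap /= (ld_val (zdiff_fst _ _ _ _ h)) /=; ring.
by rewrite /Dmap /= (ld_val (zdiff_snd _ _ _ _ h)) /=; ring.
Qed.

Arguments D_zdiff {G p al be v}.
Lemma analytic_differentiable f p : analytic_at f p ->
  exists lx ly, differentiable_pt_lim (fun x y => f (x, y)) (fst p) (snd p) lx ly.
Proof.
move=> /analytic_zan /zan_zdiff [al [be /zdiff_fst h]].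
by eexists; eexists; exact: h.
Qed.

Lemma is_derive_pair (c : R -> R * R) t (v : R * R) : is_derive c t v <->
  is_derive (fun s => fst (c s)) t (fst v) /\ is_derive (fun s => snd (c s)) t (snd v).
Proof.
split=> [h|[h1 h2]].
  split.
    apply: (filterdiff_comp' c (fun z => fst z) t _ (fun z => fst z) h).
    exact: (filterdiff_linear (fun z : R * R => fst z) is_linear_fst).
  apply: (filterdiff_comp' c (fun z => snd z) t _ (fun z => snd z) h).
  exact: (filterdiff_linear (fun z : R * R => snd z) is_linear_snd).
apply: (filterdiff_ext (fun s => (fst (c s), snd (c s)))) => [s|].
  by case: (c s).
have := filterdiff_comp'_2 (fun s => fst (c s)) (fun s => snd (c s)) (fun x y => (x, y)) t
  _ _ (fun x y => (x, y)) h1 h2 _; apply.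
apply: (filterdiff_ext (fun u => u)) => [[] //|].
apply: (filterdiff_ext_lin _ (fun u => u)); first exact: filterdiff_id.
by case.
Qed.

Lemma chain_real f (c : R -> R * R) t v : analytic_at f (c t) -> is_derive c t v ->
  is_derive (fun s => f (c s)) t (ld f (c t) v).
Proof.
move=> /analytic_differentiable [lx [ly h]] /is_derive_pair [/is_derive_Reals h1 /is_derive_Reals h2].
rewrite (ld_val h); apply/is_derive_Reals.
have := derivable_pt_lim_comp_2d _ _ _ _ _ _ _ _ h h1 h2.
have -> : lx * fst v + ly * snd v = fst v * lx + snd v * ly by ring.
apply: derivable_pt_lim_ext => s.
by case: (c s).
Qed.

Lemma chain_map G (c : R -> R * R) t v : analytic_map_at G (c t) -> is_derive c t v ->
  is_derive (fun s => G (c s)) t (Dmap G (c t) v).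
Proof.
by move=> [h1 h2] hc; apply/is_derive_pair; split; [apply: (chain_real (fun q => fst (G q)))|
  apply: (chain_real (fun q => snd (G q)))].
Qed.

Definition line (p v : C) (t : R) : R * R := (p + RtoC t * v)%C.

Lemma is_derive_line p v t : is_derive (line p v) t v.
Proof.
apply/is_derive_pair; rewrite /line; split => /=.
  auto_derive => //; ring.
auto_derive => //; ring.
Qed.

Lemma line0 p v : line p v 0 = p.
Proof. by rewrite /line; Cring. Qed.

Lemma is_derive_pair_unique (c : R -> R * R) t (v w : R * R) :
  is_derive c t v -> is_derive c t w -> v = w.
Proof.
move=> /is_derive_pair [h1 h2] /is_derive_pair [h3 h4].
apply: Ceq; [rewrite -(is_derive_unique _ _ _ h1)|rewrite -(is_derive_unique _ _ _ h2)];
  exact: is_derive_unique.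
Qed.

Lemma is_derive_loc (c c' : R -> R * R) t v :
  (exists e, 0 < e /\ forall s, Rabs (s - t) < e -> c s = c' s) ->
  is_derive c t v -> is_derive c' t v.
Proof.
move=> [e [he h]] hc; apply: is_derive_ext_loc hc.
exists (mkposreal e he) => s hs; apply: h; exact: hs.
Qed.

Lemma analytic_map_comp F G p : analytic_map_at F (G p) -> analytic_map_at G p ->
  analytic_map_at (fun q => F (G q)) p.
Proof. by move=> /analytic_map_zan h1 /analytic_map_zan h2; apply/analytic_map_zan; apply: zan_comp. Qed.

Lemma analytic_comp f G p : analytic_at f (G p) -> analytic_map_at G p ->
  analytic_at (fun q => f (G q)) p.
Proof.
move=> /analytic_zan h1 /analytic_map_zan h2; apply/analytic_zan.
exact: (zan_comp (fun q => RtoC (f q)) G p).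
Qed.

Lemma D_comp F G p v : analytic_map_at F (G p) -> analytic_map_at G p ->
  Dmap (fun q => F (G q)) p v = Dmap F (G p) (Dmap G p v).
Proof.
move=> hF hG; have hFG := analytic_map_comp F G p hF hG.
have hl := is_derive_line p v 0.
have h1 : is_derive (fun s => F (G (line p v s))) 0 (Dmap (fun q => F (G q)) p v).
  by have := chain_map (fun q => F (G q)) _ 0 v _ hl; rewrite line0; apply.
apply: (is_derive_pair_unique _ _ _ _ h1).
have h2 : is_derive (fun s => G (line p v s)) 0 (Dmap G p v).
  by have := chain_map G _ 0 v _ hl; rewrite line0; apply.
by have := chain_map F _ 0 _ _ h2; rewrite line0; apply.
Qed.

Lemma D_linear G p v w r r' : analytic_map_at G p ->
  Dmap G p (RtoC r * v + RtoC r' * w)%C = (RtoC r * Dmap G p v + RtoC r' * Dmap G p w)%C.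
Proof.
move=> /analytic_map_zan /zan_zdiff [al [be h]].
rewrite !(D_zdiff h); by Cring.
Qed.

Lemma D_loc G G' p v : (exists s, 0 < s /\ forall h, Cmod h <= s -> G (p + h)%C = G' (p + h)%C) ->
  analytic_map_at G p -> Dmap G p v = Dmap G' p v.
Proof.
move=> hl hG.
have /analytic_map_zan hG' := zan_loc _ _ _ hl (proj1 (analytic_map_zan _ _) hG).
have hd := is_derive_line p v 0.
have h1 : is_derive (fun s => G (line p v s)) 0 (Dmap G p v).
  by have := chain_map G _ 0 v _ hd; rewrite line0; apply.
have h2 : is_derive (fun s => G' (line p v s)) 0 (Dmap G' p v).
  by have := chain_map G' _ 0 v _ hd; rewrite line0; apply.
apply: (is_derive_pair_unique _ _ _ _ _ h2).
apply: is_derive_loc h1.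
move: hl => [s [hs hl]].
exists (s / (Cmod v + 1)); split.
  by apply: Rdiv_lt_0_compat => //; have := Cmod_ge_0 v; lra.
move=> t; rewrite Rminus_0_r => ht.
apply: hl; rewrite Cmod_mult Cmod_R.
have hv := Cmod_ge_0 v; have ht0 := Rabs_pos t.
have : Rabs t * (Cmod v + 1) <= s.
  apply: (Rle_trans _ (s / (Cmod v + 1) * (Cmod v + 1))).
    by apply: Rmult_le_compat_r; lra.
  by apply: Req_le; field; lra.
nra.
Qed.

Lemma D_id p v : Dmap (fun q => q) p v = v.
Proof.
rewrite (@D_zdiff _ p (RtoC 1) (RtoC 0)); first by ring.
exists 0, 1; split; first lra.
split; first lra.
move=> h _; have -> : (p + h - (p + 1 * h + 0 * Cconj h))%C = RtoC 0 by ring.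
rewrite Cmod_0; lra.
Qed.

Lemma analytic_cont G p : analytic_map_at G p -> forall eps, 0 < eps ->
  exists s, 0 < s /\ forall h, Cmod h <= s -> Cmod (G (p + h) - G p)%C < eps.
Proof.
move=> /analytic_map_zan /zan_zdiff [al [be [K [s [hs [hK h]]]]]] eps he.
pose A := Cmod al + Cmod be + K * s + 1.
have h1 := Cmod_ge_0 al. have h2 := Cmod_ge_0 be.
have hKs : 0 <= K * s by apply: Rmult_le_pos; lra.
have hA : 0 < A by rewrite /A; lra.
have ht : 0 < Rmin s (eps / (2 * A)).
  by apply: Rmin_glb_lt => //; apply: Rdiv_lt_0_compat; lra.
exists (Rmin s (eps / (2 * A))); split => // k hk.
have hks : Cmod k <= s := le_Rmin_l hk.
have hke : Cmod k <= eps / (2 * A) := le_Rmin_r hk.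
have hkA : Cmod k * A <= eps / 2.
  apply: (Rle_trans _ (eps / (2 * A) * A)); first by apply: Rmult_le_compat_r; lra.
  by apply: Req_le; field; lra.
have -> : (G (p + k) - G p = (G (p + k) - (G p + al * k + be * Cconj k)) + (al * k + be * Cconj k))%C by ring.
apply: (Rle_lt_trans _ (K * Cmod k ^ 2 + (Cmod al * Cmod k + Cmod be * Cmod k))); last first.
  have h3 := Cmod_ge_0 k.
  have h4 : Cmod k * Cmod k <= s * Cmod k by apply: Rmult_le_compat_r.
  have h5 := Rmult_le_compat_l _ _ _ hK h4.
  by move: hkA; rewrite /A; lra.
apply: Rle_trans (Cmod_triangle _ _) _; apply: Rplus_le_compat; first exact: h.
apply: Rle_trans (Cmod_triangle _ _) _; rewrite !Cmod_mult Cmod_conj; lra.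
Qed.

(** * The normal form as a statement on analytic maps *)

Lemma Cmod2_mult_conj z : (z * Cconj z)%C = RtoC (Cmod z ^ 2).
Proof. by rewrite -Cmod2_conj. Qed.

Lemma Cpow_mult (z w : C) n : (z ^ n * w ^ n)%C = ((z * w) ^ n)%C.
Proof. by elim: n => [|n IH] /=; [ring|rewrite -IH; ring]. Qed.

Lemma ev_diagp (b : nat -> R) z : ev (diagp b) z (Cconj z) = RtoC (PSeries b (Cmod z ^ 2)).
Proof.
rewrite /ev /CS2 (CS_ext _ (fun j => RtoC (b j * (Cmod z ^ 2) ^ j))).
  apply: Ceq => //=.
  by rewrite (Series_ext _ (fun _ => 0 * 0)); [rewrite Series_scal_l; ring|move=> n; ring].
move=> j; rewrite (CS_fin _ j).
  rewrite (csum_single _ _ j) //.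
    rewrite /diagp Nat.eqb_refl Cpow_mult Cmod2_mult_conj RtoC_pow'.
    by rewrite RtoC_mult.
  by move=> k hk hne; rewrite /diagp; have /Nat.eqb_neq -> : j <> k by [lia]; ring.
by move=> k hk; rewrite /diagp; have /Nat.eqb_neq -> : j <> k by [lia]; ring.
Qed.

Lemma diagp_rsum s M b N : 0 <= s -> bnd s M (diagp b) -> rsum (fun j => Rabs (b j) * (s ^ 2) ^ j) N <= M.
Proof.
move=> hs hb; apply: Rle_trans (hb N); apply: rsum_le => j hj.
have h0 k : 0 <= Cmod (diagp b j k) * s ^ (j + k).
  by apply: Rmult_le_pos; [exact: Cmod_ge_0|apply: pow_le].
apply: Rle_trans (rsum_term _ j N h0 hj); apply: Req_le.
rewrite /diagp Nat.eqb_refl Cmod_R -pow_mult; congr (_ * s ^ _); lia.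
Qed.

Lemma least_nonzero (e : nat -> R) : (forall j, e j = 0) \/
  exists m, e m <> 0 /\ forall j, (j < m)%nat -> e j = 0.
Proof.
case: (classic (exists m, e m <> 0)) => [[m hm]|h]; last first.
  by left=> j; case: (Req_dec (e j) 0) => // hj; case: h; exists j.
right; elim/(well_founded_induction Nat.lt_wf_0): m hm => m IH hm.
case: (classic (exists j, (j < m)%nat /\ e j <> 0)) => [[j [hj hne]]|h]; first exact: IH hj hne.
exists m; split => // j hj; case: (Req_dec (e j) 0) => // hne.
by case: h; exists j.
Qed.

Lemma PSeries_sign (e : nat -> R) rad : 0 < rad ->
  (forall N, rsum (fun j => Rabs (e j) * rad ^ j) N <= 1) ->
  (forall t, PSeries e t = 0) \/
  exists sg d, (sg = 1 \/ sg = -1) /\ 0 < d /\ forall t, 0 < t < d -> 0 < sg * PSeries e t.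
Proof.
move=> hr hb; case: (least_nonzero e) => [h0|[m [hm hz]]].
  by left=> t; rewrite (PSeries_ext _ _ _ h0) PSeries_const_0.
right; pose b := PS_decr_n e m.
have hrm : 0 < rad ^ m by apply: pow_lt.
have hex : ex_series (fun n => Rabs (e n) * rad ^ n).
  apply: (ex_series_bounded _ 1) => // n.
  by apply: Rmult_le_pos; [exact: Rabs_pos|apply: pow_le; lra].
have hcv : Rbar_lt (Rabs 0) (CV_radius b).
  apply: (Rbar_lt_le_trans _ rad); first by rewrite Rabs_R0.
  apply: (proj1 (Lub_Rbar_correct (CV_disk b))).
  have e1 n : / rad ^ m * (Rabs (e (m + n)%nat) * rad ^ (m + n)) = Rabs (b n * rad ^ n).
    rewrite /b /PS_decr_n Rabs_mult (Rabs_pos_eq (rad ^ n)); last by apply: pow_le; lra.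
    by rewrite pow_add; field; lra.
  exact: ex_series_ext e1 (ex_series_scal_l (/ rad ^ m) _ (proj1 (ex_series_incr_n _ m) hex)).
have hem : 0 < Rabs (e m) by apply: Rabs_pos_lt.
have [d [hd hcont]] := PSeries_continuity b 0 hcv (Rabs (e m)) hem.
rewrite /= /R_dist PSeries_0 /b /PS_decr_n Nat.add_0_r in hcont.
have [sg [hsg hsge]] : exists sg, (sg = 1 \/ sg = -1) /\ sg * e m = Rabs (e m).
  case: (Rle_lt_dec 0 (e m)) => h; first by exists 1; rewrite Rabs_pos_eq //; split; [left|ring].
  by exists (-1); rewrite Rabs_left //; split; [right|ring].
exists sg, d; split => //; split => // t [ht htd].
rewrite (PSeries_decr_n_aux e m t hz).
have := hcont t ltac:(split; [split; [done|lra]|rewrite Rminus_0_r Rabs_pos_eq; lra]).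
move=> /Rabs_def2 [h1 h2].
have -> : sg * (t ^ m * PSeries (PS_decr_n e m) t) = t ^ m * (sg * PSeries (PS_decr_n e m) t) by ring.
apply: Rmult_lt_0_compat; first exact: pow_lt.
by move: h1 h2; rewrite /PS_decr_n -hsge; case: hsg hsge => ->; lra.
Qed.

Definition dot (v w : C) : R := fst v * fst w + snd v * snd w.

Lemma dot_le v w : Rabs (dot v w) <= Cmod v * Cmod w.
Proof.
have -> : dot v w = fst (Cconj v * w)%C by rewrite /dot /=; ring.
by apply: Rle_trans (fst_le_Cmod _) _; rewrite Cmod_mult Cmod_conj; lra.
Qed.

Lemma dot_self v : dot v v = Cmod v ^ 2.
Proof. by rewrite Cmod2_alt /dot /Re /Im; ring. Qed.

Record normal_form (X Psi Phi : R * R -> R * R) (a e : R -> R) (r : R) : Prop := NormalForm {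
  nf_r : 0 < r;
  nf_analytic_X : forall y : C, Cmod y < r -> analytic_map_at X y;
  nf_analytic_Psi : forall y : C, Cmod y < r -> analytic_map_at Psi y;
  nf_analytic_Phi : forall y : C, Cmod y < r -> analytic_map_at Phi y;
  nf_PhiPsi : forall y : C, Cmod y < r -> Phi (Psi y) = y;
  nf_PsiPhi : forall y : C, Cmod y < r -> Psi (Phi y) = y;
  nf_Psi0 : Psi origin = origin;
  nf_Phi0 : Phi origin = origin;
  nf_analytic_a : analytic_at (fun y => a (Cmod y ^ 2)) origin;
  nf_a_pos : forall y : C, Cmod y < r -> 0 < a (Cmod y ^ 2);
  nf_eq : forall y : C, Cmod y < r ->
    Dmap Psi y (RtoC (a (Cmod y ^ 2)%R) * rotation_field y)%C =
    (X (Psi y) + RtoC (e (Cmod y ^ 2)%R) * y)%C;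
  nf_Phi_pos : forall x v : C, Cmod x < r -> v <> RtoC 0 -> 0 < dot v (Dmap Phi x v);
  nf_sign : (forall y : C, Cmod y < r -> e (Cmod y ^ 2) = 0) \/
    exists sg, (sg = 1 \/ sg = -1) /\
      forall y : C, Cmod y < r -> y <> RtoC 0 -> 0 < sg * e (Cmod y ^ 2)
}.

Arguments nf_r {X Psi Phi a e r}.
Arguments nf_analytic_X {X Psi Phi a e r}.
Arguments nf_analytic_Psi {X Psi Phi a e r}.
Arguments nf_analytic_Phi {X Psi Phi a e r}.
Arguments nf_PhiPsi {X Psi Phi a e r}.
Arguments nf_PsiPhi {X Psi Phi a e r}.
Arguments nf_Psi0 {X Psi Phi a e r}.
Arguments nf_Phi0 {X Psi Phi a e r}.
Arguments nf_analytic_a {X Psi Phi a e r}.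
Arguments nf_a_pos {X Psi Phi a e r}.
Arguments nf_eq {X Psi Phi a e r}.
Arguments nf_Phi_pos {X Psi Phi a e r}.
Arguments nf_sign {X Psi Phi a e r}.

Lemma near_id_zan s h : 0 < s -> bnd s s h -> ord 2 h ->
  let G := fun z : C => (z + ev h z (Cconj z))%C in
  G (RtoC 0) = RtoC 0 /\ (exists t, 0 < t /\ forall z, Cmod z <= t -> analytic_map_at G z) /\
  forall z, Cmod z < s / 2 ->
    zdiff G z (1 + ev (pd1 h) z (Cconj z))%C (ev (pd2 h) z (Cconj z)).
Proof.
move=> hs bh oh G; have hs' := Rlt_le _ _ hs.
have hp : forall h0, Cmod h0 <= s -> G h0 = ev (padd pX h) h0 (Cconj h0).
  move=> z hz; have hz' : Cmod (Cconj z) <= s by rewrite Cmod_conj.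
  by rewrite (ev_padd hz hz' (bnd_pX _ hs') bh) ev_pX.
have bp := bnd_padd hs' (bnd_pX _ hs') bh.
split; first by rewrite /G Cconj_0 ev_00 oh; [ring|lia].
split.
  have : zan G (RtoC 0).
    by exists (padd pX h), s, (s + s); split => //; split => // k hk; rewrite Cplus_0_l hp.
  move=> /zan_open [t [ht hz]]; exists t; split => // z hzt; apply/analytic_map_zan.
  by have := hz z hzt; rewrite Cplus_0_l.
move=> z hz.
have := zdiff_ev s _ _ z G hs bp hp hz.
have hz1 : Cmod z <= s / 2 by lra.
have hz1' : Cmod (Cconj z) <= s / 2 by rewrite Cmod_conj.
have b1 := bnd_pd1 s s h hs bh. have b2 := bnd_pd2 s s h hs bh.
have -> : ev (pd1 (padd pX h)) z (Cconj z) = (1 + ev (pd1 h) z (Cconj z))%C.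
  have hs2 : 0 <= s / 2 by lra.
  rewrite -{1}(ev_pconst (RtoC 1) z (Cconj z)).
  rewrite -(ev_padd hz1 hz1' (bnd_pconst _ (RtoC 1) hs2) b1).
  apply: ev_ext => j k; rewrite /pd1 /padd.
  case: j => [|j]; case: k => [|k]; rewrite /pX /pconst ?[INR 1]/=; ring.
have -> // : ev (pd2 (padd pX h)) z (Cconj z) = ev (pd2 h) z (Cconj z).
apply: ev_ext => j k; rewrite /pd2 /padd.
by case: j => [|[|j]]; rewrite /pX; ring.
Qed.

Lemma ev_small s M a eps : 0 < s -> bnd s M a -> ord 1 a -> 0 < eps ->
  exists t, 0 < t /\ t <= s /\ forall z w, Cmod z <= t -> Cmod w <= t -> Cmod (ev a z w) <= eps.
Proof.
move=> hs ha oa he.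
have hM : 0 <= M by apply: bnd_ge0 ha; lra.
have ht : 0 < Rmin s (eps * s / (M + 1)).
  apply: Rmin_glb_lt => //; apply: Rdiv_lt_0_compat; [exact: Rmult_lt_0_compat|lra].
exists (Rmin s (eps * s / (M + 1))); split => //; split; first exact: Rmin_l.
set t := Rmin _ _ in ht *.
have h1 : t <= s := Rmin_l _ _.
have h2 : t <= eps * s / (M + 1) := Rmin_r _ _.
have h3 : t * (M + 1) <= eps * s.
  apply: Rle_trans (Rmult_le_compat_r (M + 1) _ _ _ h2) _; first lra.
  by apply: Req_le; field; lra.
move=> z w hz hw.
have h4 : 0 <= t <= s by lra.
apply: Rle_trans (ev_bound hz hw (bnd_order s M t 1 a hs h4 oa ha)) _.
apply: (Rmult_le_reg_r s) => //.
have -> : M * (t / s) ^ 1 * s = M * t by field; lra.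
nra.
Qed.

Lemma ord_pd1 a : ord 2 a -> ord 1 (pd1 a).
Proof. by move=> h j k hjk; rewrite /pd1 h; [ring|lia]. Qed.

Lemma ord_pd2 a : ord 2 a -> ord 1 (pd2 a).
Proof. by move=> h j k hjk; rewrite /pd2 h; [ring|lia]. Qed.

Lemma near_id_inverse s h : 0 < s -> bnd s s h -> ord 2 h ->
  exists s1 k t, 0 < s1 /\ bnd s1 s1 k /\ ord 2 k /\ 0 < t /\
  let Psi := fun z : C => (z + ev h z (Cconj z))%C in
  let Phi := fun z : C => (z + ev k z (Cconj z))%C in
  forall z, Cmod z <= t -> Phi (Psi z) = z /\ Psi (Phi z) = z.
Proof.
move=> hs bh oh.
have [s1 [k [hs1 [hss1 [bk [ok hk]]]]]] := inverse_series s s h hs bh oh.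
have [s2 [l [hs2 [hss2 [bl [ol hl]]]]]] := inverse_series s1 s1 k hs1 bk ok.
exists s1, k, s2; split; first exact: hs1.
split; first exact: bk.
split; first exact: ok.
split; first exact: hs2.
move=> Psi Phi z hz.
have hz1 : Cmod z <= s1 by lra.
have [_ e1] := hk z hz1.
split; last exact: e1.
have [h2 e2] := hl z hz.
set y := (z + ev l z (Cconj z))%C in h2 e2.
have [_ e3] := hk y ltac:(lra).
rewrite e2 in e3.
by rewrite /Psi /Phi e3 e2.
Qed.

Lemma Forall_lower_bound (l : list R) : List.Forall (fun t => 0 < t) l ->
  exists r, 0 < r /\ List.Forall (fun t => r <= t) l.
Proof.
elim=> [|t l' ht _ [r [hr hl]]]; first by exists 1; split; [lra|constructor].
exists (Rmin t r); split; first exact: Rmin_glb_lt.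
constructor; first exact: Rmin_l.
apply: List.Forall_impl hl => u hu; apply: Rle_trans (Rmin_r _ _) hu.
Qed.

Lemma normal_form_exists X : analytic_map_at X origin -> has_first_jet X rotation_field ->
  exists Psi Phi a e r, normal_form X Psi Phi a e r.
Proof.
move=> hX [hj1 hj2].
have [c [s0 [M [hs0 [bc [oc hc]]]]]] :=
  jet_series 2 (fun q => X q - rotation_field q)%C origin hj1 hj2.
have bF := bnd_pscal _ _ Ci _ bc.
have oF := ord_pscal 2 Ci c oc.
have [s [h [b [e [hs [hss [bh [oh [bb [be [b0 [e0 hnf]]]]]]]]]]]] := normal_form_series s0 _ _ hs0 bF oF.
have [s1 [k [t1 [hs1 [bk [ok [ht1 hinv]]]]]]] := near_id_inverse s h hs bh oh.
have [P0 [[t2 [ht2 hP]] dP]] := near_id_zan s h hs bh oh.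
have [Q0 [[t3 [ht3 hQ]] dQ]] := near_id_zan s1 k hs1 bk ok.
have /analytic_map_zan/zan_open [t4 [ht4 hX4]] := hX.
have h4 : 0 < / 4 by lra.
have hs12 : 0 < s1 / 2 by lra.
have [t5 [ht5 [ht5s q1]]] := ev_small _ _ _ _ hs12 (bnd_pd1 _ _ _ hs1 bk) (ord_pd1 _ ok) h4.
have [t6 [ht6 [ht6s q2]]] := ev_small _ _ _ _ hs12 (bnd_pd2 _ _ _ hs1 bk) (ord_pd2 _ ok) h4.
have [t7 [ht7 [ht7s q3]]] := ev_small _ _ _ _ hs bb (ord_diagp _ b0) (Rinv_0_lt_compat _ Rlt_0_2).
have hs2 : 0 < s ^ 2 by apply: pow_lt.
have sgn : exists t8, 0 < t8 /\ ((forall y : C, Cmod y < t8 -> PSeries e (Cmod y ^ 2) = 0) \/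
    exists sg, (sg = 1 \/ sg = -1) /\
      forall y : C, Cmod y < t8 -> y <> RtoC 0 -> 0 < sg * PSeries e (Cmod y ^ 2)).
  have [|h0|[sg [d [hsg [hd h0]]]]] := PSeries_sign e (s ^ 2) hs2.
  - by move=> N; apply: diagp_rsum => //; lra.
  - by exists 1; split; [lra|left].
  exists (sqrt d); split; first exact: sqrt_lt_R0.
  right; exists sg; split => // y hy hy0; apply: h0; split.
    by apply: pow_lt; apply/Cmod_gt_0.
  rewrite -(pow2_sqrt d); last lra.
  have h9 := Cmod_ge_0 y; have h10 := sqrt_pos d; nra.
have [t8 [ht8 hsg]] := sgn.
have [r [hr hl]] : exists r, 0 < r /\ List.Forall (fun t => r <= t)
    (t1 :: t2 :: t3 :: t4 :: t5 :: t6 :: t7 :: t8 :: s / 2 :: s1 / 2 :: nil)%list.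
  by apply: Forall_lower_bound; repeat constructor; lra.
do 10 (move: hl => /List.Forall_cons_iff [? hl]).
have hXc (y : C) : Cmod y <= s0 -> (Ci * (X y - rotation_field y))%C = ev (pscal Ci c) y (Cconj y).
  move=> hy; have hy' : Cmod (Cconj y) <= s0 by rewrite Cmod_conj.
  rewrite (ev_pscal hy hy' bc) -hc //.
  by rewrite Cplus_origin.
exists (fun z : C => z + ev h z (Cconj z))%C, (fun z : C => z + ev k z (Cconj z))%C,
  (fun t => 1 + PSeries b t), (PSeries e), r; split => //.
- by move=> y hy; apply/analytic_map_zan; have := hX4 y ltac:(lra); rewrite Cplus_0_l.
- by move=> y hy; apply: hP; lra.
- by move=> y hy; apply: hQ; lra.
- by move=> y hy; have [] := hinv y ltac:(lra).
- by move=> y hy; have [] := hinv y ltac:(lra).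
- apply/analytic_zan; exists (padd (pconst (RtoC 1)) (diagp b)), s, (Cmod (RtoC 1) + 1).
  have hs' := Rlt_le _ _ hs.
  split => //; split; first by apply: bnd_padd => //; apply: bnd_pconst.
  move=> y hy; have hy' : Cmod (Cconj y) <= s by rewrite Cmod_conj.
  rewrite (ev_padd hy hy' (bnd_pconst _ _ hs') bb) ev_pconst ev_diagp.
  rewrite Cplus_origin.
  by rewrite RtoC_plus.
- move=> y hy; have := q3 y (Cconj y) ltac:(lra) ltac:(rewrite Cmod_conj; lra).
  by rewrite ev_diagp Cmod_R /Rabs; case: Rcase_abs; lra.
- move=> y hy.
  rewrite (D_zdiff (dP y ltac:(lra))).
  have hy2 : Cmod y <= s / 2 by lra.
  have := hnf y hy2; rewrite /= !ev_diagp.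
  have [_ hy3] := ev_near_id s s0 (Cmod Ci * M) (pscal Ci c) h y hs hss bF bh ltac:(lra).
  have [hy4 _] := ev_near_id s s0 (Cmod Ci * M) (pscal Ci c) h y hs hss bF bh ltac:(lra).
  rewrite -hXc; last lra.
  set y' := (y + ev h y (Cconj y))%C.
  set A := ev (pd1 h) y (Cconj y); set B := ev (pd2 h) y (Cconj y).
  move: (X y') (PSeries b (Cmod y ^ 2)) (PSeries e (Cmod y ^ 2)) => Xy bt et E.
  have rotE (z : C) : rotation_field z = (- Ci * z)%C by apply: Ceq; rewrite /= /rotation_field /=; ring.
  rewrite !rotE in E *.
  have cjE : Cconj (RtoC (1 + bt) * (- Ci * y))%C = (RtoC (1 + bt) * (Ci * Cconj y))%C.
    by Cring.
  rewrite cjE RtoC_plus.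
  have -> : ((1 + A) * ((1 + bt) * (- Ci * y)) + B * ((1 + bt) * (Ci * Cconj y)) =
    - Ci * ((1 + bt) * (y + (y * A - Cconj y * B))))%C by ring.
  rewrite E.
  have ci2 : (Ci * Ci = - RtoC 1)%C by Cring.
  have -> : (- Ci * (y' + Ci * (Xy - - Ci * y') + Ci * (y * et)) =
    - (Ci * Ci) * Xy - (Ci * Ci + RtoC 1) * Ci * y' - (Ci * Ci) * (et * y))%C by ring.
  rewrite ci2; ring.
- move=> x v hx hv.
  rewrite (D_zdiff (dQ x ltac:(lra))).
  set A := ev (pd1 k) x _; set B := ev (pd2 k) x _.
  have hA : Cmod A <= / 4 by apply: q1; rewrite ?Cmod_conj; lra.
  have hB : Cmod B <= / 4 by apply: q2; rewrite ?Cmod_conj; lra.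
  have -> : dot v ((1 + A) * v + B * Cconj v)%C = Cmod v ^ 2 + dot v (A * v + B * Cconj v)%C.
    by rewrite -dot_self /dot /=; ring.
  have h1 := dot_le v (A * v + B * Cconj v)%C.
  have h2 : Cmod (A * v + B * Cconj v)%C <= Cmod v / 2.
    apply: Rle_trans (Cmod_triangle _ _) _; rewrite !Cmod_mult Cmod_conj.
    have := Cmod_ge_0 v; nra.
  have h3 : 0 < Cmod v by apply/Cmod_gt_0.
  have : - (Cmod v * Cmod (A * v + B * Cconj v)%C) <= dot v (A * v + B * Cconj v)%C.
    by move: h1; rewrite /Rabs; case: Rcase_abs; lra.
  nra.
- case: hsg => [hsg|[sg [hsg h0]]]; [left|right; exists sg; split => //].
    by move=> y hy; apply: hsg; lra.
  by move=> y hy hy0; apply: h0 => //; lra.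
Qed.

(** * Tools for orbits *)

Lemma disk_gauge (rad : R) (K : C -> Prop) (P : C -> R -> Prop) :
  (forall y, K y -> Cmod y <= rad) ->
  (forall y d d', P y d' -> 0 < d <= d' -> P y d) ->
  (forall u, exists d, 0 < d /\ forall y, Cmod (y - u)%C <= d -> K y -> P y d) ->
  exists d, 0 < d /\ forall y, K y -> P y d.
Proof.
move=> hK hP hloc.
pose dl (u v : R) : R := proj1_sig (constructive_indefinite_description _ (hloc (u, v))).
have hdl u v : 0 < dl u v / 2.
  by rewrite /dl; case: constructive_indefinite_description => d [hd _] /=; lra.
have [d hd] := compactness_value_2d (- rad) rad (- rad) rad (fun u v => mkposreal _ (hdl u v)).
exists d; split; first exact: cond_pos.
move=> y hy.
have box z : Rabs z <= Cmod y -> - rad <= z <= rad.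
  by move=> hz; have := hK y hy; move: hz; rewrite /Rabs; case: Rcase_abs; lra.
have [u [v [_ [_ [h1 [h2 h3]]]]]] := NNPP _ (hd (fst y) (snd y) (box _ (fst_le_Cmod y)) (box _ (snd_le_Cmod y))).
move: h1 h2 h3; rewrite /= /dl; case: constructive_indefinite_description => e [he hE] /= h1 h2 h3.
apply: (hP _ _ e); last by split; [exact: cond_pos|lra].
apply: hE => //; apply: Rle_trans (Cmod_le_sum _) _ => /=.
rewrite -/(Rminus (fst y) u) -/(Rminus (snd y) v); lra.
Qed.

Lemma disk_max (rad : R) (K : C -> Prop) (f : C -> R) y0 :
  K y0 -> (forall y, K y -> Cmod y <= rad) ->
  (forall u, ~ K u -> exists d, 0 < d /\ forall y, Cmod (y - u)%C <= d -> ~ K y) ->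
  (forall u eps, K u -> 0 < eps -> exists d, 0 < d /\
     forall y, Cmod (y - u)%C <= d -> K y -> f y < f u + eps) ->
  exists y, K y /\ forall z, K z -> f z <= f y.
Proof.
move=> h0 hK hcl hf.
have [B [hB hBf]] : exists d, 0 < d /\ forall y, K y -> f y <= / d.
  apply: (disk_gauge rad) => // [y d d' h [h1 h2]|u].
    by apply: Rle_trans h _; apply: Rinv_le_contravar.
  case: (classic (K u)) => hu; last first.
    by have [d [hd h]] := hcl u hu; exists d; split => // y hy /(h y hy).
  have [d [hd h]] := hf u 1 hu Rlt_0_1.
  have hp : 0 < Rabs (f u) + 1 by have := Rabs_pos (f u); lra.
  exists (Rmin d (/ (Rabs (f u) + 1))); split.
    by apply: Rmin_glb_lt => //; apply: Rinv_0_lt_compat.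
  move=> y hy hKy.
  have h1 := h y (le_Rmin_l hy) hKy.
  apply: (Rle_trans _ (Rabs (f u) + 1)); first by have := Rle_abs (f u); lra.
  rewrite -{1}(Rinv_inv (Rabs (f u) + 1)); apply: Rinv_le_contravar; last exact: Rmin_r.
  by apply: Rmin_glb_lt => //; apply: Rinv_0_lt_compat.
have [m [hm1 hm2]] := completeness (fun x => exists y, K y /\ f y = x)
  ltac:(exists (/ B); move=> x [y [hy <-]]; exact: hBf) ltac:(by exists (f y0), y0).
have hfm y : K y -> f y <= m by move=> hy; apply: hm1; exists y.
apply: NNPP => hne.
have hlt y : K y -> f y < m.
  move=> hy; case: (Rle_lt_or_eq_dec _ _ (hfm y hy)) => // e.
  by case: hne; exists y; split => // z hz; rewrite e; apply: hfm.
have [d [hd h]] : exists d, 0 < d /\ forall y, K y -> f y <= m - d.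
  apply: (disk_gauge rad) => // [y d d' h [h1 h2]|u]; first lra.
  case: (classic (K u)) => hu; last first.
    by have [d [hd h]] := hcl u hu; exists d; split => // y hy /(h y hy).
  have hu' := hlt u hu.
  have [d [hd h]] := hf u ((m - f u) / 2) hu ltac:(lra).
  exists (Rmin d ((m - f u) / 2)); split; first by apply: Rmin_glb_lt; lra.
  move=> y hy hKy.
  have := h y (le_Rmin_l hy) hKy.
  have := Rmin_r d ((m - f u) / 2); lra.
have : m <= m - d by apply: hm2 => x [y [hy <-]]; apply: h.
lra.
Qed.

Lemma is_derive_norm2 (c : R -> R * R) t (v : R * R) : is_derive c t v ->
  is_derive (fun s => Cmod (c s) ^ 2) t (2 * dot (c t) v).
Proof.
move=> /is_derive_pair [h1 h2].
apply: (is_derive_ext (fun s => fst (c s) * fst (c s) + snd (c s) * snd (c s))).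
  by move=> s; rewrite -dot_self.
have -> : 2 * dot (c t) v = (fst v * fst (c t) + fst (c t) * fst v) + (snd v * snd (c t) + snd (c t) * snd v).
  by rewrite /dot; ring.
apply: (is_derive_plus (fun s => fst (c s) * fst (c s)) (fun s => snd (c s) * snd (c s)));
  by apply: is_derive_mult => // n m; rewrite /mult /= Rmult_comm.
Qed.

Lemma deriv_increase (g : R -> R) l : is_derive g 0 l -> 0 < l ->
  exists d, 0 < d /\ forall t, 0 < t < d -> g 0 < g t.
Proof.
move=> /is_derive_Reals h hl; have [d hd] := h (l / 2) ltac:(lra).
exists d; split; first exact: cond_pos.
move=> t [ht htd].
have := hd t ltac:(lra) ltac:(rewrite Rabs_pos_eq; lra).
rewrite Rplus_0_l => /Rabs_def2 [_ h2].
have h3 : l / 2 < (g t - g 0) / t by lra.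
have h4 := Rmult_lt_compat_r t _ _ ht h3.
have e : (g t - g 0) / t * t = g t - g 0 by field; lra.
have : 0 < l / 2 * t by apply: Rmult_lt_0_compat; lra.
lra.
Qed.

Lemma is_derive_comp_scal (g : R -> R) k l : is_derive g 0 l -> is_derive (fun t => g (k * t)) 0 (k * l).
Proof.
move=> h; apply: (is_derive_comp g (fun t => k * t) 0 l k).
  by rewrite Rmult_0_r.
by auto_derive => //; ring.
Qed.

Lemma deriv_decrease (g : R -> R) l : is_derive g 0 l -> l <> 0 -> forall eps, 0 < eps ->
  exists t, Rabs t < eps /\ g t < g 0.
Proof.
move=> h hl eps he.
have hk : 0 < (- l) * (- l) by nra.
have h1 : is_derive (fun t => - g (- l * t)) 0 (- (- l * l)).
  by apply: is_derive_opp; apply: is_derive_comp_scal.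
have [d [hd hlt]] := deriv_increase _ _ h1 ltac:(lra).
have hla : 0 < Rabs l by apply: Rabs_pos_lt.
pose t := Rmin (d / 2) (eps / (2 * Rabs l)).
have ht : 0 < t by apply: Rmin_glb_lt; [lra|apply: Rdiv_lt_0_compat; lra].
have htd : t < d by apply: (Rle_lt_trans _ _ _ (Rmin_l _ _)); lra.
have hte : t <= eps / (2 * Rabs l) := Rmin_r _ _.
exists (- l * t); split.
  rewrite Rabs_mult Rabs_Ropp (Rabs_pos_eq t); last lra.
  have := Rmult_le_compat_l _ _ _ (Rlt_le _ _ hla) hte.
  have -> : Rabs l * (eps / (2 * Rabs l)) = eps / 2 by field; lra.
  lra.
have := hlt t (conj ht htd); rewrite Rmult_0_r; lra.
Qed.

Lemma is_derive_cont (c : R -> R * R) t (v : R * R) : is_derive c t v -> forall eps, 0 < eps ->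
  exists d, 0 < d /\ forall s, Rabs (s - t) < d -> Cmod (c s - c t)%C < eps.
Proof.
move=> /is_derive_pair [h1 h2] eps he.
have c1 := ex_derive_continuous _ _ (ex_intro _ _ h1).
have c2 := ex_derive_continuous _ _ (ex_intro _ _ h2).
have he2 : 0 < eps / 2 by lra.
have [d1 hd1] := proj1 (filterlim_locally _ _) c1 (mkposreal _ he2).
have [d2 hd2] := proj1 (filterlim_locally _ _) c2 (mkposreal _ he2).
exists (Rmin d1 d2); split; first by apply: Rmin_glb_lt; apply: cond_pos.
move=> s hs; apply: Rle_lt_trans (Cmod_le_sum _) _.
have k1 := hd1 s (lt_Rmin_l hs).
have k2 := hd2 s (lt_Rmin_r hs).
rewrite /ball /= /AbsRing_ball /abs /minus /plus /opp /= in k1 k2.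
rewrite /=; lra.
Qed.

Lemma integral_curve_exists X p (U : R * R -> Prop) : analytic_map_at X p -> open U -> U p ->
  exists (a b : R) c, a < 0 < b /\ integral_curve X U a b c /\ c 0 = p.
Proof.
move=> /analytic_map_zan [F [s [M [hs [hF h]]]]] hU hp.
have [e [u [he [bu [ou hu]]]]] := ode_series s M F hs hF.
pose u0 : PS := fun j k => match k with 0%nat => u j 0%nat | _ => RtoC 0 end.
have evu0 (c c0 : PS) z w : (forall j, c0 j 0%nat = c j 0%nat) -> (forall j k, c0 j (S k) = RtoC 0) ->
    ev c0 z w = ev c z (RtoC 0).
  move=> h0 h1; apply: CS_ext => j; rewrite !(CS_fin _ 0); first by rewrite /csum /= h0.
    by case=> [|k] hk; [lia|rewrite /=; ring].
  by case=> [|k] hk; [lia|rewrite h1; ring].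
pose G z := (p + ev u0 z (Cconj z))%C.
have bu0 : bnd e s u0.
  apply: bnd_dom bu; first lra.
  by move=> j [|k]; rewrite /u0; [lra|rewrite Cmod_0; apply: Cmod_ge_0].
have [e1 [he1 aG]] : exists e1, 0 < e1 /\ forall h, Cmod h <= e1 -> zan G (RtoC 0 + h)%C.
  apply: zan_open; apply: (zan_plus (fun _ => p)); first exact: zan_const.
  by exists u0, e, s; split => //; split => // k hk; rewrite Cplus_0_l.
pose c (t : R) : R * R := G (line (RtoC 0) (RtoC 1) t).
have lt t : line (RtoC 0) (RtoC 1) t = RtoC t by Cring.
have c0 : c 0 = p.
  rewrite /c lt /G Cconj_0 ev_00 /u0 ou; [by Cring|lia].
have hd t : Rabs t < Rmin (e / 2) e1 -> is_derive c t (X (c t)).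
  move=> ht.
  have ht1 := lt_Rmin_l ht.
  have ht2 := lt_Rmin_r ht.
  have hte : Cmod (RtoC t) <= e by rewrite Cmod_R; lra.
  have h00 : Cmod (RtoC 0) <= e by rewrite Cmod_0; lra.
  have ez : zdiff G (RtoC t) (ev (pd1 u) (RtoC t) (RtoC 0)) (RtoC 0).
    have [K [t0 [ht0 [hK hz]]]] := zdiff_ev e s u0 (RtoC t) (fun z => ev u0 z (Cconj z)) he bu0
      (fun _ _ => eq_refl) ltac:(by rewrite Cmod_R).
    exists K, t0; split => //; split => // k hk; move: (hz k hk).
    rewrite (evu0 (pd1 u) (pd1 u0)); [|by []|by move=> j i; rewrite /pd1 /u0; ring].
    have -> z w : ev (pd2 u0) z w = RtoC 0.
      rewrite /ev (CS2_fin _ 0); first by rewrite /pd2 /u0; Cring.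
      by move=> j i _; rewrite /pd2 /u0; ring.
    rewrite /G; congr (_ <= _); congr Cmod; ring.
  have hct : X (c t) = ev (pd1 u) (RtoC t) (RtoC 0).
    rewrite hu; last lra.
    rewrite /c lt /G (evu0 u) // h //.
    exact: (ev_bound hte h00 bu).
  have := chain_map G (line (RtoC 0) (RtoC 1)) t (RtoC 1) _ (is_derive_line _ _ _).
  rewrite lt (D_zdiff ez) hct.
  have -> : (ev (pd1 u) t 0 * 1 + 0 * Cconj 1)%C = ev (pd1 u) t 0 by ring.
  apply; apply/analytic_map_zan; rewrite -(Cplus_0_l (RtoC t)); apply: aG.
  by rewrite Cmod_R; lra.
have hm : 0 < Rmin (e / 2) e1 by apply: Rmin_glb_lt; lra.
have hUp : @locally (prod_UniformSpace R_UniformSpace R_UniformSpace) p U := hU p hp.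
have [d [hd0 hdU]] := proj1 (locally_Cmod _ _) hUp.
have [d' [hd' hcd]] := is_derive_cont c 0 _ (hd 0 ltac:(by rewrite Rabs_R0)) d hd0.
exists (- Rmin (Rmin (e / 2) e1) d'), (Rmin (Rmin (e / 2) e1) d'), c.
have hb : 0 < Rmin (Rmin (e / 2) e1) d' by apply: Rmin_glb_lt.
split; first lra.
split => // t /= h1 h2.
have htb : Rabs t < Rmin (Rmin (e / 2) e1) d' by apply: Rabs_def1.
split; last by apply: hd; apply: lt_Rmin_l htb.
rewrite (Csub_add (c t) p) Cplus_comm; apply: hdU; apply: Rlt_le; rewrite -{1}c0; apply: hcd.
by rewrite Rminus_0_r; apply: lt_Rmin_r htb.
Qed.

(** * Strict monotonicity excludes closed orbits *)

Lemma is_derive_affine (c : R -> R * R) t k (v : R * R) s : is_derive c (t + k * s) v ->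
  is_derive (fun s => c (t + k * s)) s (RtoC k * v)%C.
Proof.
have ha : is_derive (fun s => t + k * s) s k by auto_derive => //; ring.
move=> /is_derive_pair [h1 h2]; apply/is_derive_pair; split.
  have -> : fst (RtoC k * v)%C = k * fst v by rewrite /=; ring.
  exact: (is_derive_comp (fun s => fst (c s)) (fun s => t + k * s) s _ k h1 ha).
have -> : snd (RtoC k * v)%C = k * snd v by rewrite /=; ring.
exact: (is_derive_comp (fun s => snd (c s)) (fun s => t + k * s) s _ k h2 ha).
Qed.

Lemma Rbar_interval_open (a b : Rbar) (t : R) : Rbar_lt a t -> Rbar_lt t b ->
  exists d, 0 < d /\ forall s, Rabs s < d -> Rbar_lt a (t + s) /\ Rbar_lt (t + s) b.
Proof.
move=> ha hb.
have [d1 [hd1 h1]] : exists d, 0 < d /\ forall s, Rabs s < d -> Rbar_lt a (t + s).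
  case: a ha => [a||] //= ha; last by exists 1; split; [lra|].
  exists (t - a); split; first lra.
  by move=> s /Rabs_def2 [_ h]; lra.
have [d2 [hd2 h2]] : exists d, 0 < d /\ forall s, Rabs s < d -> Rbar_lt (t + s) b.
  case: b hb => [b||] //= hb; last by exists 1; split; [lra|].
  exists (b - t); split; first lra.
  by move=> s /Rabs_def2 [h _]; lra.
exists (Rmin d1 d2); split; first exact: Rmin_glb_lt.
move=> s hs; split; [apply: h1; apply: lt_Rmin_l hs|
  apply: h2; apply: lt_Rmin_r hs].
Qed.

(* Gronwall: the equilibrium is not reached in finite time. *)
Lemma zero_backward (c : R -> R * R) (v : R -> R * R) T L d : 0 <= T -> 0 <= L -> 0 < d ->
  (forall s, 0 <= s <= T -> is_derive c s (v s)) ->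
  (forall s, 0 <= s <= T -> Cmod (c s) <= d -> Cmod (v s) <= L * Cmod (c s)) ->
  c T = origin -> c 0 = origin.
Proof.
move=> hT hL hd hc hv hcT; apply: NNPP => h0.
pose E s := 0 <= s <= T /\ c s <> origin.
have [m [hm1 hm2]] := completeness E ltac:(by exists T => s [[_ h] _])
  ltac:(by exists 0; split; [lra|]).
have hmT : m <= T by apply: hm2 => s [[_ h] _].
have hm0 : 0 <= m by apply: hm1; split; [lra|].
have hcm : c m = origin.
  apply: NNPP => hne.
  have hmT' : m < T by case: (Rle_lt_or_eq_dec _ _ hmT) => // e; case: hne; rewrite e.
  have hpos : 0 < Cmod (c m) by apply/Cmod_gt_0.
  have [eta [heta hcont]] := is_derive_cont c m _ (hc m ltac:(lra)) (Cmod (c m)) hpos.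
  pose s := Rmin (m + eta / 2) T.
  have hs1 : m < s by apply: Rmin_glb_lt; lra.
  have hs2 : s <= m + eta / 2 := Rmin_l _ _.
  have hs3 : s <= T := Rmin_r _ _.
  have : s <= m.
    apply: hm1; split; first lra.
    move=> hcs; have := hcont s ltac:(rewrite Rabs_pos_eq; lra).
    rewrite hcs; have -> : (origin - c m)%C = (- c m)%C by Cring.
    rewrite Cmod_opp; lra.
  lra.
have [eta [heta hcont]] := is_derive_cont c m _ (hc m ltac:(lra)) d hd.
have [s0 [[hs0 hne] [hs0m hs0e]]] : exists s, E s /\ s < m /\ m - eta < s.
  apply: NNPP => hno.
  have : m <= m - eta; last lra.
  apply: hm2 => s hs; case: (Rle_lt_dec s (m - eta)) => // hlt.
  case: hno; exists s; split => //; split => //.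
  by case: (Rle_lt_or_eq_dec _ _ (hm1 s hs)) => // e; case: hs => _; rewrite e hcm.
pose g s := Cmod (c s) ^ 2 * exp (2 * L * s).
pose dg s := (2 * dot (c s) (v s) + 2 * L * Cmod (c s) ^ 2) * exp (2 * L * s).
have hg s : 0 <= s <= T -> is_derive g s (dg s).
  move=> hs.
  have h1 := is_derive_norm2 c s (v s) (hc s hs).
  have h2 : is_derive (fun s => exp (2 * L * s)) s (2 * L * exp (2 * L * s)).
    by auto_derive => //; ring.
  have -> : dg s = plus (mult (2 * dot (c s) (v s)) (exp (2 * L * s)))
      (mult (Cmod (c s) ^ 2) (2 * L * exp (2 * L * s))).
    by rewrite /dg /plus /mult /=; ring.
  apply: is_derive_mult => // n k; exact: Rmult_comm.
have [x [hx hgx]] := MVT_gen g s0 m dg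
  ltac:(rewrite Rmin_left ?Rmax_right; try lra; move=> x hx; apply: hg; lra)
  ltac:(rewrite Rmin_left ?Rmax_right; try lra; move=> x hx; apply/continuity_pt_filterlim;
    apply: (ex_derive_continuous g); exists (dg x); apply: hg; lra).
rewrite Rmin_left ?Rmax_right in hx; try lra.
have hxd : Cmod (c x) <= d.
  have := hcont x ltac:(rewrite Rabs_left1; lra); rewrite hcm.
  have -> : (c x - origin)%C = c x by Cring.
  lra.
have hdg : 0 <= dg x.
  apply: Rmult_le_pos; last by apply: Rlt_le; apply: exp_pos.
  have h1 := hv x ltac:(lra) hxd; have h2 := dot_le (c x) (v x).
  have h3 := Cmod_ge_0 (c x).
  have h4 := Rmult_le_compat_l _ _ _ h3 h1.
  have : - (Cmod (c x) * Cmod (v x)) <= dot (c x) (v x).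
    by move: h2; rewrite /Rabs; case: Rcase_abs; lra.
  nra.
have hgm : g m = 0 by rewrite /g hcm Cmod_0; ring.
have hgs : 0 < g s0.
  apply: Rmult_lt_0_compat; last exact: exp_pos.
  by apply: pow_lt; apply/Cmod_gt_0.
have : 0 <= dg x * (m - s0) by apply: Rmult_le_pos; lra.
lra.
Qed.

Lemma small_near_origin G r d : 0 < r -> analytic_map_at G origin -> G origin = origin -> 0 < d ->
  exists rho, 0 < rho < r /\ forall y : C, Cmod y <= rho -> Cmod (G y) < d.
Proof.
move=> hr aG G0 hd; have [s [hs h]] := analytic_cont G origin aG d hd.
exists (Rmin s (r / 2)); split.
  by split; [apply: Rmin_glb_lt; lra|apply: Rle_lt_trans (Rmin_r _ _) _; lra].
move=> y hy; have := h y (le_Rmin_l hy).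
rewrite G0 Cplus_origin.
by have -> : (G y - origin)%C = G y by Cring.
Qed.

Section NormalForm.
Variables (X Psi Phi : R * R -> R * R) (a e : R -> R) (r : R).
Hypothesis H : normal_form X Psi Phi a e r.

Lemma nf_Phi_drift (y : C) : Cmod y < r -> Cmod (Psi y) < r ->
  Dmap Phi (Psi y) (X (Psi y)) =
  (RtoC (a (Cmod y ^ 2)%R) * rotation_field y - RtoC (e (Cmod y ^ 2)%R) * Dmap Phi (Psi y) y)%C.
Proof.
move=> hy hPy.
have aPhi := nf_analytic_Phi H _ hPy.
have aPsi := nf_analytic_Psi H _ hy.
have hid v : Dmap Phi (Psi y) (Dmap Psi y v) = v.
  rewrite -(D_comp Phi Psi) // -[RHS](D_id y); apply: D_loc; last exact: analytic_map_comp.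
  exists ((r - Cmod y) / 2); split; first lra.
  move=> h hh; apply: (nf_PhiPsi H).
  by apply: Rle_lt_trans (Cmod_triangle _ _) _; lra.
have -> : X (Psi y) = (RtoC 1 * (Dmap Psi y (RtoC (a (Cmod y ^ 2)%R) * rotation_field y)) +
    RtoC (- e (Cmod y ^ 2)%R) * y)%C.
  by rewrite (nf_eq H _ hy) RtoC_opp; Cring.
rewrite D_linear // hid RtoC_opp; ring.
Qed.

Lemma nf_radial (y : C) : Cmod y < r -> Cmod (Psi y) < r ->
  dot y (Dmap Phi (Psi y) (X (Psi y))) = - e (Cmod y ^ 2) * dot y (Dmap Phi (Psi y) y).
Proof.
by move=> hy hPy; rewrite nf_Phi_drift // /dot /rotation_field /=; ring.
Qed.

Lemma nf_Psi_small d : 0 < d -> exists rho, 0 < rho < r /\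
  forall y : C, Cmod y <= rho -> Cmod (Psi y) < d.
Proof.
apply: small_near_origin; [exact: nf_r H| |exact: nf_Psi0 H].
by apply: (nf_analytic_Psi H); rewrite Cmod_0; exact: nf_r H.
Qed.

Lemma nf_Phi_small d : 0 < d -> exists rho, 0 < rho < r /\
  forall y : C, Cmod y <= rho -> Cmod (Phi y) < d.
Proof.
apply: small_near_origin; [exact: nf_r H| |exact: nf_Phi0 H].
by apply: (nf_analytic_Phi H); rewrite Cmod_0; exact: nf_r H.
Qed.

Lemma nf_X0 : X origin = origin.
Proof.
have h0 : Cmod (RtoC 0) < r by rewrite Cmod_0; exact: (nf_r H).
have := nf_eq H (RtoC 0) h0.
have -> : Psi (RtoC 0) = origin by exact: (nf_Psi0 H).
have -> : (RtoC (a (Cmod (RtoC 0) ^ 2)%R) * rotation_field (RtoC 0))%C =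
   (RtoC 0 * RtoC 0 + RtoC 0 * RtoC 0)%C by rewrite /rotation_field; Cring.
rewrite D_linear; last exact: (nf_analytic_Psi H).
move=> h; have -> : X origin = (X origin + RtoC (e (Cmod (RtoC 0) ^ 2)%R) * RtoC 0)%C by Cring.
by rewrite -h; Cring.
Qed.

Lemma nf_Lipschitz0 : exists L d, 0 <= L /\ 0 < d /\ forall p : C, Cmod p <= d -> Cmod (X p) <= L * Cmod p.
Proof.
have h0 : Cmod (RtoC 0) < r by rewrite Cmod_0; exact: (nf_r H).
have /analytic_map_zan/zan_zdiff [al [be [K [s [hs [hK h]]]]]] := nf_analytic_X H _ h0.
exists (K * s + (Cmod al + Cmod be)), s.
have h1 := Cmod_ge_0 al; have h2 := Cmod_ge_0 be.
have hKs : 0 <= K * s by apply: Rmult_le_pos; lra.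
split; first lra.
split => // p hp; have := h p hp.
have -> : (RtoC 0 + p)%C = p by ring.
have -> : X (RtoC 0) = RtoC 0 by exact: nf_X0.
have -> : (RtoC 0 + al * p + be * Cconj p = RtoC 0 + (al * p + be * Cconj p))%C by ring.
move=> h3.
have e1 (z w : C) : z = (z - (0 + w) + w)%C by ring.
rewrite (e1 (X p) (al * p + be * Cconj p)%C).
apply: Rle_trans (Cmod_triangle _ _) _.
have h4 : Cmod (al * p + be * Cconj p)%C <= (Cmod al + Cmod be) * Cmod p.
  by apply: Rle_trans (Cmod_triangle _ _) _; rewrite !Cmod_mult Cmod_conj; lra.
have h5 := Cmod_ge_0 p.
have h6 : K * Cmod p ^ 2 <= K * s * Cmod p.
  have : Cmod p * Cmod p <= s * Cmod p by apply: Rmult_le_compat_r.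
  move/(Rmult_le_compat_l _ _ _ hK); lra.
lra.
Qed.

Lemma orbit_avoids_origin U p : p <> origin -> ~ orbit X U p origin.
Proof.
move=> hp [al [be [c [t [ha [hb [hat [htb [hc [c0 ct]]]]]]]]]].
have [L [d [hL [hd hX]]]] := nf_Lipschitz0.
have inI s : Rmin 0 t <= s <= Rmax 0 t -> is_derive c s (X (c s)).
  move=> hs; apply: (proj2 (hc s _ _)).
    case: al ha hat {hc} => [al||] //= h1 h2.
    by apply: Rlt_le_trans (proj1 hs); apply: Rmin_glb_lt.
  case: be hb htb {hc} => [be||] //= h1 h2.
  by apply: Rle_lt_trans (proj2 hs) _; apply: Rmax_lub_lt.
apply: hp; rewrite -c0.
have [k [hk1 [hk2 hrange]]] : exists k, 0 + k * Rabs t = t /\ Rabs k = 1 /\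
    forall s, 0 <= s <= Rabs t -> Rmin 0 t <= 0 + k * s <= Rmax 0 t.
  case: (Rle_lt_dec 0 t) => ht.
    exists 1; rewrite Rabs_R1 (Rabs_pos_eq t) // Rmin_left // Rmax_right //.
    by split; [ring|split => // s hs; lra].
  exists (-1); rewrite !Rabs_left; try lra; rewrite Rmin_right ?Rmax_left; try lra.
  by split; [ring|split => [|s hs]; lra].
have e0 : c 0 = (fun s => c (0 + k * s)) 0 by congr c; ring.
rewrite e0.
apply: (zero_backward (fun s => c (0 + k * s)) (fun s => RtoC k * X (c (0 + k * s)%R))%C (Rabs t) L d) => //.
- exact: Rabs_pos.
- by move=> s hs; apply: is_derive_affine; apply: inI; apply: hrange.
- by move=> s hs hcs; rewrite Cmod_mult Cmod_R hk2 Rmult_1_l; apply: hX.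
- by rewrite hk1.
Qed.

Section Lyapunov.
Variable sg : R.
Hypothesis hsg : sg = 1 \/ sg = -1.
Hypothesis he : forall y : C, Cmod y < r -> y <> RtoC 0 -> 0 < sg * e (Cmod y ^ 2).

Lemma nf_radial_neg (y : C) : Cmod y < r -> Cmod (Psi y) < r -> y <> RtoC 0 ->
  sg * dot y (Dmap Phi (Psi y) (X (Psi y))) < 0.
Proof.
move=> hy hPy hne; rewrite nf_radial //.
have h1 := he y hy hne; have h2 := nf_Phi_pos H (Psi y) y hPy hne.
have := Rmult_lt_0_compat _ _ h1 h2; lra.
Qed.

Lemma no_closed_orbit (O : R * R -> Prop) rho : 0 < rho < r ->
  (forall y : C, Cmod y <= rho -> Cmod (Psi y) < r) ->
  (forall y : C, Cmod y <= rho -> ~ O (Psi y) ->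
     exists d, 0 < d /\ forall h : C, Cmod h < d -> ~ O (Psi y + h)%C) ->
  ~ O origin ->
  (forall q, O q -> exists (c : R -> R * R) d, 0 < d /\ c 0 = q /\ is_derive c 0 (X q) /\
     forall t, Rabs t < d -> O (c t)) ->
  (exists y : C, Cmod y <= rho /\ O (Psi y)) -> False.
Proof.
move=> hrho hPsi hcl hO0 hcurve [y0 [hy0 hOy0]].
have [y [[hy hOy] hmax]] : exists y, (Cmod y <= rho /\ O (Psi y)) /\
    forall z, (Cmod z <= rho /\ O (Psi z)) -> - Cmod z <= - Cmod y.
  apply: (disk_max rho (fun y : C => Cmod y <= rho /\ O (Psi y)) (fun y => - Cmod y) y0) => //.
  - by move=> y [].
  - move=> u hu; case: (Rle_lt_dec (Cmod u) rho) => hur; last first.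
      exists ((Cmod u - rho) / 2); split; first lra.
      move=> y hy [hy' _].
      by have := Cmod_le_dist y u; lra.
    have hOu : ~ O (Psi u) by move=> h; apply: hu.
    have [d [hd hdO]] := hcl u hur hOu.
    have [s [hs hsc]] := analytic_cont Psi u (nf_analytic_Psi H u ltac:(lra)) d hd.
    exists s; split => // y hy [_ hOy].
    apply: (hdO (Psi y - Psi u)%C); last by have -> : (Psi u + (Psi y - Psi u))%C = Psi y by ring.
    by have := hsc _ hy; have -> : (u + (y - u))%C = y by ring.
  - move=> u eps _ heps; exists (eps / 2); split; first lra.
    move=> y hy _.
    by have := Cmod_le_dist y u; lra.
have hyr : Cmod y < r by lra.
have hPy := hPsi y hy.
have hy0' : y <> RtoC 0.
  by move=> hy00; apply: hO0; rewrite -(nf_Psi0 H); rewrite hy00 in hOy.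
have [c [d [hd [c0 [hc hOc]]]]] := hcurve _ hOy.
have aPhi := nf_analytic_Phi H (Psi y) hPy.
have hz : is_derive (fun t => Phi (c t)) 0 (Dmap Phi (Psi y) (X (Psi y))).
  by have := chain_map Phi c 0 (X (Psi y)); rewrite c0; apply.
have hn := is_derive_norm2 _ _ _ hz.
rewrite c0 (nf_PhiPsi H y hyr) in hn.
have hneg := nf_radial_neg y hyr hPy hy0'.
have [d' [hd' hcont]] := is_derive_cont c 0 _ hc (r - Cmod (Psi y)) ltac:(lra).
have [t [ht hlt]] := deriv_decrease _ _ hn ltac:(by case: hsg => h; rewrite h in hneg; lra)
  (Rmin d d') ltac:(by apply: Rmin_glb_lt).
rewrite c0 (nf_PhiPsi H y hyr) in hlt.
have hct : Cmod (c t) < r.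
  have := hcont t ltac:(rewrite Rminus_0_r; apply: lt_Rmin_r ht).
  rewrite c0 => h1.
  rewrite (Csub_add (c t) (Psi y)).
  by apply: Rle_lt_trans (Cmod_triangle _ _) _; lra.
have hlt' : Cmod (Phi (c t)) < Cmod y.
  apply: Rnot_le_lt => hle.
  have := pow_incr (Cmod y) (Cmod (Phi (c t))) 2 (conj (Cmod_ge_0 y) hle); lra.
have := hmax (Phi (c t)); rewrite (nf_PsiPhi H _ hct) => hm.
have hle : Cmod (Phi (c t)) <= rho by lra.
have := hm (conj hle (hOc t (lt_Rmin_l ht))); lra.
Qed.
End Lyapunov.
End NormalForm.

Arguments nf_Phi_drift {X Psi Phi a e r}.
Arguments nf_radial {X Psi Phi a e r}.
Arguments nf_Psi_small {X Psi Phi a e r}.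
Arguments nf_Phi_small {X Psi Phi a e r}.
Arguments nf_X0 {X Psi Phi a e r}.
Arguments nf_Lipschitz0 {X Psi Phi a e r}.
Arguments orbit_avoids_origin {X Psi Phi a e r}.
Arguments nf_radial_neg {X Psi Phi a e r}.
Arguments no_closed_orbit {X Psi Phi a e r}.

Lemma open_Cmod (U : R * R -> Prop) (p : C) : open U -> U p ->
  exists s, 0 < s /\ forall h, Cmod h <= s -> U (p + h)%C.
Proof. by move=> hU hp; apply: (proj1 (locally_Cmod U p)); apply: hU. Qed.

Lemma closed_avoid (F : R * R -> Prop) (p : C) : closed F -> ~ F p ->
  exists s, 0 < s /\ forall h, Cmod h <= s -> ~ F (p + h)%C.
Proof.
move=> hF hp; apply: (proj1 (locally_Cmod (fun q => ~ F q) p)); apply: NNPP => hn; apply: hp; exact: hF.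
Qed.

Lemma Cmod_RtoC_pos (s : R) : 0 < s -> Cmod (RtoC s) = s.
Proof. by move=> hs; rewrite Cmod_R Rabs_pos_eq; lra. Qed.

Lemma periodic_image_avoid (c : R -> R * R) (v : R -> R * R) T (q : C) : 0 < T ->
  (forall t, is_derive c t (v t)) -> (forall t, c (t + T) = c t) -> (forall t, c t <> q) ->
  exists d, 0 < d /\ forall h : C, Cmod h < d -> forall t, c t <> (q + h)%C.
Proof.
move=> hT hc hper hq.
pose g t := Cmod (c t - q)%C ^ 2.
have hgc t : continuity_pt g t.
  apply/continuity_pt_filterlim; apply: (ex_derive_continuous g).
  exists (2 * dot (c t - q)%C (v t)).
  apply: (is_derive_norm2 (fun s => (c s - q)%C)).
  have [h1 h2] := proj1 (is_derive_pair _ _ _) (hc t).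
  apply/is_derive_pair; split => /=.
    have -> : fst (v t) = plus (fst (v t)) 0 by rewrite /plus /=; ring.
    by apply: (is_derive_plus (fun s => fst (c s)) (fun _ => - fst q)) => //; apply: is_derive_const.
  have -> : snd (v t) = plus (snd (v t)) 0 by rewrite /plus /=; ring.
  by apply: (is_derive_plus (fun s => snd (c s)) (fun _ => - snd q)) => //; apply: is_derive_const.
have [m [hm _]] := continuity_ab_min g 0 T (Rlt_le _ _ hT) (fun t _ => hgc t).
have hpos : 0 < Cmod (c m - q)%C.
  apply/Cmod_gt_0 => h0; apply: (hq m).
  by rewrite (Csub_add (c m) q) h0; Cring.
have hperN n t : c (t + INR n * T) = c t.
  elim: n t => [|n IH] t; first by congr c; rewrite /=; ring.
  rewrite S_INR -(IH t) -(hper (t + INR n * T)); congr c; ring.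
have hredu t : exists s, 0 <= s <= T /\ c s = c t.
  have [n hn] : exists n, 0 <= t + INR n * T.
    have [n hn] := INR_unbounded (- t / T).
    exists n; have := Rmult_lt_compat_r _ _ _ hT hn.
    have -> : - t / T * T = - t by field; lra.
    lra.
  rewrite -(hperN n t); move: (t + INR n * T) hn => u hu.
  have [k hk] := INR_unbounded (u / T).
  have huk : u < INR k * T.
    have := Rmult_lt_compat_r _ _ _ hT hk.
    by have -> : u / T * T = u by field; lra.
  elim: k u hu huk {hk} => [|k IH] u hu huk; first by move: huk; rewrite /=; lra.
  case: (Rle_lt_dec u T) => huT; first by exists u.
  have [|| s [hs hcs]] := IH (u - T); first lra.
    by move: huk; rewrite S_INR; lra.
  by exists s; split => //; rewrite hcs -(hper (u - T)); congr c; ring.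
exists (Cmod (c m - q)%C); split => // h hh t ht.
have [s [hs hcs]] := hredu t.
have := hm s hs; rewrite /g hcs ht.
have -> : (q + h - q)%C = h by ring.
move=> h1; have := Cmod_ge_0 h; nra.
Qed.

Section Strict.
Variables (X Psi Phi : R * R -> R * R) (a e : R -> R) (r sg : R).
Hypothesis H : normal_form X Psi Phi a e r.
Hypothesis hsg : sg = 1 \/ sg = -1.
Hypothesis he : forall y : C, Cmod y < r -> y <> RtoC 0 -> 0 < sg * e (Cmod y ^ 2).

Lemma nf_Psi_neq0 (y : C) : Cmod y < r -> y <> RtoC 0 -> Psi y <> origin.
Proof.
move=> hy hne h; apply: hne.
by rewrite -(nf_PhiPsi H y hy) h (nf_Phi0 H).
Qed.

Lemma nf_Psi_into (U : R * R -> Prop) : open U -> U origin -> exists rho, 0 < rho < r /\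
  (forall y : C, Cmod y <= rho -> Cmod (Psi y) < r) /\
  forall y : C, Cmod y <= rho -> U (Psi y).
Proof.
move=> oU U0; have hr := nf_r H.
have [d [hd hU]] := open_Cmod U origin oU U0.
have [rho [hrho hPsi]] := nf_Psi_small H (Rmin r d) ltac:(by apply: Rmin_glb_lt).
exists rho; split => //; split => y hy; first exact: lt_Rmin_l (hPsi y hy).
rewrite -(Cplus_origin (Psi y)); apply: hU; apply: Rlt_le.
exact: lt_Rmin_r (hPsi y hy).
Qed.

Lemma strict_not_orbits_closed : ~ orbits_closed X.
Proof.
move=> [U [[oU [U0 aU]] hcl]].
have [rho [hrho [hPr hPU]]] := nf_Psi_into U oU U0.
have hC : Cmod (RtoC rho) = rho by apply: Cmod_RtoC_pos; lra.
pose p := Psi (RtoC rho).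
have hp : p <> origin.
  apply: nf_Psi_neq0; first by rewrite hC; lra.
  by apply: RtoC_neq0; lra.
have Up : U p by apply: hPU; rewrite hC; lra.
apply: (no_closed_orbit H sg hsg he (orbit X U p) rho) => //.
- move=> y hy hO.
  have [F [hF hOF]] := hcl p Up.
  have hnF : ~ F (Psi y) by move=> hFy; apply: hO; apply/hOF; split => //; apply: hPU.
  have [s [hs hsF]] := closed_avoid F (Psi y) hF hnF.
  exists s; split => // h hh /hOF [_ hFh].
  by apply: (hsF h) => //; lra.
- exact: (orbit_avoids_origin H).
- move=> q [al [be [c [t [ha [hb [hat [htb [hc [c0 ct]]]]]]]]]].
  have [d' [hd' hI]] := Rbar_interval_open al be t hat htb.
  exists (fun s => c (t + 1 * s)), d'; split => //; split.
    by rewrite -ct; congr c; ring.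
  split.
    have -> : X q = (RtoC 1 * X q)%C by Cring.
    apply: is_derive_affine; rewrite Rmult_0_r Rplus_0_r -ct.
    exact: (proj2 (hc t hat htb)).
  move=> s hs; rewrite Rmult_1_l.
  have [h1 h2] := hI s hs.
  by exists al, be, c, (t + s).
- exists (RtoC rho); split; first by rewrite hC; lra.
  have [al [be [c [hab [hc c0]]]]] := integral_curve_exists X p U (aU p Up) oU Up.
  exists al, be, c, 0; split; first exact: (proj1 hab).
  split; first exact: (proj2 hab).
  split; first exact: (proj1 hab).
  split; first exact: (proj2 hab).
  by split.
Qed.

Lemma strict_not_center : ~ center X.
Proof.
move=> [U [[oU [U0 aU]] hcen]].
have [rho [hrho [hPr hPU]]] := nf_Psi_into U oU U0.
have hC : Cmod (RtoC rho) = rho by apply: Cmod_RtoC_pos; lra.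
pose p := Psi (RtoC rho).
have hrho0 : RtoC rho <> RtoC 0 by apply: RtoC_neq0; lra.
have hp : p <> origin by apply: nf_Psi_neq0 => //; rewrite hC; lra.
have Up : U p by apply: hPU; rewrite hC; lra.
have hXp : X p <> (0, 0).
  move=> hX0.
  have hPr' : Cmod (Psi (RtoC rho)) < r by apply: hPr; rewrite hC; lra.
  have := nf_radial_neg H sg he (RtoC rho) ltac:(rewrite hC; lra) hPr' hrho0.
  rewrite -/p hX0.
  have -> : ((0, 0) : R * R) = (RtoC 0 * RtoC 0 + RtoC 0 * RtoC 0)%C by Cring.
  rewrite D_linear; last exact: (nf_analytic_Phi H).
  rewrite /dot /=; lra.
have [c [T [hc [c0 [hT hper]]]]] := hcen p (conj Up hp) hXp.
have hcd t : is_derive c t (X (c t)) by apply: (proj2 (hc t I I)).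
apply: (no_closed_orbit H sg hsg he (fun q => exists t, c t = q) rho) => //.
- move=> y hy hO.
  have [|d' [hd' hav]] := periodic_image_avoid c (fun t => X (c t)) T (Psi y) hT hcd hper.
    by move=> t ht; apply: hO; exists t.
  by exists d'; split => // h hh [t ht]; apply: (hav h hh t).
- by move=> [t ht]; have [[_ h] _] := hc t I I; apply: h.
- move=> q [t ht]; exists (fun s => c (t + 1 * s)), 1; split; first lra.
  split; first by rewrite -ht; congr c; ring.
  split; last by move=> s _; exists (t + 1 * s).
  have -> : X q = (RtoC 1 * X q)%C by Cring.
  by apply: is_derive_affine; rewrite Rmult_0_r Rplus_0_r -ht.
- exists (RtoC rho); split; first by rewrite hC; lra.
  by exists 0.
Qed.

(* A maximum of [k f - eps |y|^2] over a disk can only be at the origin, since along [+-X] the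
   function [f] is stationary while [|y|] decreases strictly. *)
Lemma strict_first_integral_le f k rho eps : 0 < eps -> 0 < rho < r ->
  (forall y : C, Cmod y <= rho -> Cmod (Psi y) < r /\ analytic_at f (Psi y) /\ ld f (Psi y) (X (Psi y)) = 0) ->
  forall z : C, Cmod z <= rho -> k * f (Psi z) <= k * f origin + eps * Cmod z ^ 2.
Proof.
move=> heps hrho hf.
pose G (y : C) := k * f (Psi y) - eps * Cmod y ^ 2.
have aG (y : C) : Cmod y <= rho -> forall et, 0 < et -> exists s, 0 < s /\
    forall h, Cmod h <= s -> G (y + h)%C < G y + et.
  move=> hy et het.
  have [_ [af _]] := hf y hy.
  have ag : analytic_at (fun y => f (Psi y)) y.
    by apply: analytic_comp => //; apply: (nf_analytic_Psi H); lra.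
  have /analytic_map_zan az : zan (fun y => RtoC k * RtoC (f (Psi y)) + RtoC (- eps) * (y * Cconj y))%C y.
    apply: zan_plus.
      by apply: zan_mult; [exact: zan_const|apply/analytic_zan].
    apply: zan_mult; first exact: zan_const.
    apply: zan_mult; first exact: zan_id.
    by apply: (zan_conj (fun y => y)); exact: zan_id.
  have [s [hs h]] := analytic_cont _ _ az et het.
  exists s; split => // u hu; have := h u hu.
  have eG (w : C) : (RtoC k * RtoC (f (Psi w)) + RtoC (- eps) * (w * Cconj w))%C = RtoC (G w).
    by rewrite Cmod2_mult_conj /G -!RtoC_mult -RtoC_plus; congr RtoC; ring.
  rewrite !eG -RtoC_minus Cmod_R => /Rabs_def2; lra.
have [y [hy hmax]] : exists y : C, Cmod y <= rho /\ forall z : C, Cmod z <= rho -> G z <= G y.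
  apply: (disk_max rho (fun y : C => Cmod y <= rho) G (RtoC 0)) => //.
  - by rewrite Cmod_0; lra.
  - move=> u hu; exists ((Cmod u - rho) / 2); split; first lra.
    move=> y hy hy'.
    by have := Cmod_le_dist y u; lra.
  - move=> u et hu het; have [s [hs h]] := aG u hu et het.
    exists s; split => // y hy _; have := h _ hy.
    by have -> : (u + (y - u))%C = y by ring.
suff y0 : y = RtoC 0.
  move=> z hz; have := hmax z hz; rewrite /G y0.
  have -> : Psi (RtoC 0) = origin by exact: (nf_Psi0 H).
  rewrite Cmod_0; lra.
apply: NNPP => hne.
have hyr : Cmod y < r by lra.
have [hPy [af hfX]] := hf y hy.
pose x := line (Psi y) (RtoC sg * X (Psi y))%C.
have x0 : x 0 = Psi y by exact: line0.
have hx : is_derive x 0 (RtoC sg * X (Psi y))%C by exact: is_derive_line.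
have aPhi := nf_analytic_Phi H (Psi y) hPy.
have hz : is_derive (fun t => Phi (x t)) 0 (Dmap Phi (Psi y) (RtoC sg * X (Psi y)))%C.
  by have := chain_map Phi x 0 _ _ hx; rewrite x0; apply.
have elin : Dmap Phi (Psi y) (RtoC sg * X (Psi y))%C = (RtoC sg * Dmap Phi (Psi y) (X (Psi y)))%C.
  have -> : (RtoC sg * X (Psi y))%C = (RtoC sg * X (Psi y) + RtoC 0 * X (Psi y))%C by ring.
  by rewrite D_linear //; ring.
rewrite elin in hz.
have hn := is_derive_norm2 _ _ _ hz.
rewrite x0 (nf_PhiPsi H y hyr) in hn.
have hneg := nf_radial_neg H sg he y hyr hPy hne.
set w := Dmap Phi (Psi y) (X (Psi y)) in hn hneg.
have ew : 2 * dot y (RtoC sg * w)%C = 2 * (sg * dot y w) by rewrite /dot /=; ring.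
rewrite ew in hn.
have hfx : is_derive (fun t => f (x t)) 0 0.
  have [lx [ly hl]] := analytic_differentiable f (Psi y) af.
  have e0 : ld f (Psi y) (RtoC sg * X (Psi y))%C = 0.
    move: hfX; rewrite !(ld_val hl); move: (X (Psi y)) => v h0.
    transitivity (sg * (fst v * lx + snd v * ly)); last by rewrite h0; ring.
    by rewrite /=; ring.
  by have := chain_real f x 0 _ _ hx; rewrite x0 e0; apply.
have h1 : is_derive (fun t => - Cmod (Phi (x t)) ^ 2) 0 (- (2 * (sg * dot y w))).
  exact: is_derive_opp.
have h2 : is_derive (fun t => k * f (x t) - eps * Cmod (Phi (x t)) ^ 2) 0 (k * 0 - eps * (2 * (sg * dot y w))).
  by apply: (is_derive_minus (fun t => k * f (x t))); apply: is_derive_scal.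
have [d1 [hd1 g1]] := deriv_increase _ _ h1 ltac:(lra).
have [d2 [hd2 g2]] := deriv_increase _ _ h2 ltac:(nra).
have [d3 [hd3 g3]] := is_derive_cont x 0 _ hx (r - Cmod (Psi y)) ltac:(lra).
have [t [ht hl]] := Forall_lower_bound (d1 :: d2 :: d3 :: nil)%list ltac:(repeat constructor; lra).
do 3 (move: hl => /List.Forall_cons_iff [? hl]).
have k1 := g1 (t / 2) ltac:(lra).
have k2 := g2 (t / 2) ltac:(lra).
have k3 := g3 (t / 2) ltac:(rewrite Rminus_0_r Rabs_pos_eq; lra).
rewrite x0 (nf_PhiPsi H y hyr) in k1 k2.
have hxt : Cmod (x (t / 2)) < r.
  rewrite (Csub_add (x (t / 2)) (Psi y)); rewrite x0 in k3.
  by apply: Rle_lt_trans (Cmod_triangle _ _) _; lra.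
have hle : Cmod (Phi (x (t / 2))) <= rho.
  apply: Rnot_lt_le => hlt.
  have hle : Cmod y <= Cmod (Phi (x (t / 2))) by lra.
  have := pow_incr (Cmod y) (Cmod (Phi (x (t / 2)))) 2 (conj (Cmod_ge_0 y) hle); lra.
have := hmax _ hle; rewrite /G (nf_PsiPhi H _ hxt); lra.
Qed.

Lemma strict_not_first_integral f : ~ analytic_first_integral X f.
Proof.
move=> [af [hne /locally_Cmod [d [hd hX]]]]; apply: hne.
have hr := nf_r H.
have /analytic_zan/zan_open [d2 [hd2 hf]] := af.
have [rho [hrho hPsi]] := nf_Psi_small H (Rmin r (Rmin d d2))
  ltac:(by repeat apply: Rmin_glb_lt).
have h1 (y : C) : Cmod y <= rho -> Cmod (Psi y) < r /\ analytic_at f (Psi y) /\ ld f (Psi y) (X (Psi y)) = 0.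
  move=> hy; have h0 := hPsi y hy.
  have l1 := Rmin_l r (Rmin d d2); have l2 := Rmin_r r (Rmin d d2).
  have l3 := Rmin_l d d2; have l4 := Rmin_r d d2.
  split; first lra.
  rewrite -(Cplus_origin (Psi y)); split; first by apply/analytic_zan; apply: hf; lra.
  by apply: hX; lra.
have hconst (y : C) : Cmod y <= rho -> f (Psi y) = f origin.
  move=> hy.
  have key k : k * f (Psi y) <= k * f origin.
    apply: le_epsilon => eps heps.
    have hy1 : 0 < Cmod y ^ 2 + 1 by have := pow2_ge_0 (Cmod y); lra.
    have := strict_first_integral_le f k rho (eps / (Cmod y ^ 2 + 1)) ltac:(by apply: Rdiv_lt_0_compat) hrho h1 y hy.
    have -> : eps / (Cmod y ^ 2 + 1) * Cmod y ^ 2 = eps - eps / (Cmod y ^ 2 + 1) by field; lra.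
    have := Rdiv_lt_0_compat _ _ heps hy1; lra.
  have := key 1; have := key (-1); lra.
have [s [hs hPhi]] := nf_Phi_small H rho ltac:(lra).
apply/locally_Cmod; exists s; split; first lra.
move=> h hh; rewrite Cplus_origin.
rewrite -(nf_PsiPhi H h ltac:(lra)); apply: hconst.
by apply: Rlt_le; apply: hPhi.
Qed.
End Strict.

(** * The case of a vanishing counterterm *)

Lemma analytic_norm2 G p : analytic_map_at G p -> analytic_at (fun q => Cmod (G q) ^ 2) p.
Proof.
move=> /analytic_map_zan h; apply/analytic_zan.
apply: (zan_ext (fun q => G q * Cconj (G q))%C); first by move=> q; apply: Cmod2_mult_conj.
by apply: zan_mult => //; apply: zan_conj.
Qed.

Lemma ld_norm2 G p v : analytic_map_at G p ->
  ld (fun q => Cmod (G q) ^ 2) p v = 2 * dot (G p) (Dmap G p v).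
Proof.
move=> h; have hl := is_derive_line p v 0.
have h1 : is_derive (fun s => Cmod (G (line p v s)) ^ 2) 0 (ld (fun q => Cmod (G q) ^ 2) p v).
  have := chain_real (fun q => Cmod (G q) ^ 2) _ 0 v _ hl; rewrite line0; apply.
  exact: analytic_norm2.
have h2 : is_derive (fun s => G (line p v s)) 0 (Dmap G p v).
  by have := chain_map G _ 0 v _ hl; rewrite line0; apply.
have := is_derive_norm2 _ _ _ h2; rewrite line0 => h3.
by rewrite -(is_derive_unique _ _ _ h1) (is_derive_unique _ _ _ h3).
Qed.

Lemma norm2_not_const G : G origin = origin ->
  (exists s, 0 < s /\ forall x : C, Cmod x <= s -> G x = origin -> x = origin) ->
  ~ locally origin (fun p => Cmod (G p) ^ 2 = Cmod (G origin) ^ 2).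
Proof.
move=> G0 [s [hs h]] /locally_Cmod [d [hd hc]].
have ht : 0 < Rmin s d by apply: Rmin_glb_lt.
have hC := Cmod_RtoC_pos _ ht.
have := hc (RtoC (Rmin s d)) ltac:(rewrite hC; exact: Rmin_r).
rewrite Cplus_origin G0 => e0.
have e1 : Cmod (G (RtoC (Rmin s d))) = 0.
  have := Cmod_ge_0 (G (RtoC (Rmin s d))).
  have : Cmod (G (RtoC (Rmin s d))) ^ 2 = 0 by rewrite e0 Cmod_0; ring.
  nra.
have := h (RtoC (Rmin s d)) ltac:(rewrite hC; exact: Rmin_l) (Cmod_eq_0 _ e1).
by apply: RtoC_neq0; lra.
Qed.

Lemma angle_exists c s : c ^ 2 + s ^ 2 = 1 -> exists t, cos t = c /\ sin t = s.
Proof.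
move=> h.
have hc : -1 <= c <= 1 by nra.
have hs : sqrt (1 - c²) = Rabs s.
  have -> : 1 - c² = s² by rewrite /Rsqr; lra.
  exact: sqrt_Rsqr_abs.
case: (Rle_lt_dec 0 s) => h0.
  by exists (acos c); rewrite cos_acos // sin_acos // hs Rabs_pos_eq.
exists (- acos c); rewrite cos_neg sin_neg cos_acos // sin_acos // hs Rabs_left //.
by split; [|ring].
Qed.

Definition rotate (t : R) (y : C) : C :=
  (cos t * fst y + sin t * snd y, - sin t * fst y + cos t * snd y).

Lemma Cmod_rotate t y : Cmod (rotate t y) = Cmod y.
Proof.
rewrite /Cmod /rotate /=; congr sqrt.
have := sin2_cos2 t; rewrite /Rsqr => h.
transitivity ((sin t * sin t + cos t * cos t) * (fst y * (fst y * 1) + snd y * (snd y * 1))); first ring.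
by rewrite h; ring.
Qed.

Lemma rotate_transitive (y z : C) : Cmod y = Cmod z -> exists t, rotate t y = z.
Proof.
move=> h.
have h2 : fst y ^ 2 + snd y ^ 2 = fst z ^ 2 + snd z ^ 2.
  by have := Cmod2_alt y; have := Cmod2_alt z; rewrite h /Re /Im => -> ->.
case: (Req_dec (Cmod y) 0) => hy0.
  have hz0 : Cmod z = 0 by rewrite -h.
  exists 0; rewrite (Cmod_eq_0 _ hy0) (Cmod_eq_0 _ hz0) /rotate; Cring.
have h0 : fst y ^ 2 + snd y ^ 2 <> 0.
  by have := Cmod2_alt y; rewrite /Re /Im => <-; apply: pow_nonzero.
set n := fst y ^ 2 + snd y ^ 2 in h0 h2.
have [|t [hc hs]] := angle_exists ((fst y * fst z + snd y * snd z) / n) ((snd y * fst z - fst y * snd z) / n).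
  transitivity (n * (fst z ^ 2 + snd z ^ 2) / n ^ 2); first by rewrite /n; field; exact: h0.
  by rewrite -h2; field.
exists t; rewrite /rotate hc hs; apply: Ceq => /=.
  transitivity (n * fst z / n); first by rewrite /n; field; exact: h0.
  by field.
transitivity (n * snd z / n); first by rewrite /n; field; exact: h0.
by field.
Qed.

Lemma is_derive_rotate k y t :
  is_derive (fun s => rotate (k * s) y) t (RtoC k * rotation_field (rotate (k * t) y))%C.
Proof.
apply/is_derive_pair; rewrite /rotate /rotation_field /=; split.
  auto_derive => //; ring.
auto_derive => //; ring.
Qed.

Section Linear.
Variables (X Psi Phi : R * R -> R * R) (a e : R -> R) (r : R).
Hypothesis H : normal_form X Psi Phi a e r.
Hypothesis he : forall y : C, Cmod y < r -> e (Cmod y ^ 2) = 0.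

Lemma linear_rotation (x : C) : Cmod x < r -> Cmod (Phi x) < r ->
  Dmap Phi x (X x) = (RtoC (a (Cmod (Phi x) ^ 2)%R) * rotation_field (Phi x))%C.
Proof.
move=> hx hPx; have ex := nf_PsiPhi H x hx.
have := nf_Phi_drift H (Phi x) hPx; rewrite ex => -> //.
by rewrite he //; ring.
Qed.

Lemma linear_almost_linearizable : almost_linearizable X.
Proof.
have hr := nf_r H.
have [s [hs hPhi]] := nf_Phi_small H r hr.
have h0 : Cmod origin < r by rewrite Cmod_0.
exists Phi, rotation_field, (fun y => a (Cmod y ^ 2)); split.
  split; first exact: (nf_analytic_Phi H).
  split; first exact: (nf_Phi0 H).
  exists Psi; split; first exact: (nf_analytic_Psi H).
  split; first exact: (nf_Psi0 H).
  split; apply/locally_Cmod; exists (r / 2); (split; first lra) => h hh; rewrite Cplus_origin.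
    by apply: (nf_PsiPhi H); lra.
  by apply: (nf_PhiPsi H); lra.
split.
  split.
  - move=> x y; rewrite /rotation_field /plus /= /prod_plus /=; congr pair.
    by rewrite /plus /=; ring.
  - move=> k x; rewrite /rotation_field /scal /= /prod_scal /=; congr pair.
    by rewrite /scal /= /mult /=; ring.
  - exists 1; split; first lra.
    move=> x; rewrite Rmult_1_l /norm /= /prod_norm /= /norm /= /abs /= Rabs_Ropp.
    by apply: Req_le; congr sqrt; ring.
split; first exact: (nf_analytic_a H).
apply/locally_Cmod; exists s; split; first lra.
move=> h hh; rewrite Cplus_origin.
transitivity (RtoC (a (Cmod (Phi h) ^ 2)%R) * rotation_field (Phi h))%C.
  exact: (linear_rotation h ltac:(lra) (hPhi h hh)).
by apply: Ceq; rewrite /scal /= /scal /= /mult /=; ring.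
Qed.

Lemma linear_first_integral : exists f, analytic_first_integral X f.
Proof.
have hr := nf_r H.
have [s [hs hPhi]] := nf_Phi_small H r hr.
have h0 : Cmod origin < r by rewrite Cmod_0.
exists (fun q => Cmod (Phi q) ^ 2); split.
  by apply: analytic_norm2; apply: (nf_analytic_Phi H).
split.
  apply: norm2_not_const; first exact: (nf_Phi0 H).
  exists (r / 2); split; first lra.
  move=> x hx hPx; rewrite -(nf_PsiPhi H x ltac:(lra)) hPx.
  exact: (nf_Psi0 H).
apply/locally_Cmod; exists s; split; first lra.
move=> x hx; rewrite Cplus_origin.
change (ld (fun q => Cmod (Phi q) ^ 2) x (X x) = 0).
rewrite ld_norm2; last by apply: (nf_analytic_Phi H); lra.
rewrite linear_rotation; [|lra|exact: hPhi].
by rewrite /dot /rotation_field /=; ring.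
Qed.

Variable rho : R.
Hypothesis hrho : 0 < rho < r.
Hypothesis hPsi : forall y : C, Cmod y <= rho -> Cmod (Psi y) < r.

Definition saturated (x : R * R) : Prop := Cmod x < r /\ Cmod (Phi x) < rho.

Lemma saturated_near x : saturated x -> exists s, 0 < s /\ forall h : C, Cmod h <= s ->
  saturated (x + h)%C.
Proof.
move=> [hx hPx].
have aPhi := nf_analytic_Phi H x hx.
have [s [hs hc]] := analytic_cont Phi x aPhi (rho - Cmod (Phi x)) ltac:(lra).
exists (Rmin s ((r - Cmod x) / 2)); split; first by apply: Rmin_glb_lt; lra.
move=> h hh; have h1 := le_Rmin_l hh.
have h2 := le_Rmin_r hh.
split; first by apply: Rle_lt_trans (Cmod_triangle _ _) _; lra.
have := hc h h1.
rewrite {2}(Csub_add (Phi (x + h)%C) (Phi x)) => h3.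
by apply: Rle_lt_trans (Cmod_triangle _ _) _; lra.
Qed.

Lemma saturated_open : open saturated.
Proof.
move=> x hx; apply: (proj2 (locally_Cmod saturated x)).
have [s [hs h]] := saturated_near x hx.
by exists s.
Qed.

Lemma saturated_domain : germ_domain X saturated.
Proof.
split; first exact: saturated_open.
split; first by split; rewrite ?(nf_Phi0 H) Cmod_0; lra.
by move=> p [hp _]; apply: (nf_analytic_X H).
Qed.

Lemma linear_curve p : saturated p ->
  let k := a (Cmod (Phi p) ^ 2) in let c := fun t => Psi (rotate (k * t) (Phi p)) in
  integral_curve X saturated m_infty p_infty c /\ c 0 = p /\ 0 < k.
Proof.
move=> [hp hPp] k c.
have hk : 0 < k by apply: (nf_a_pos H); lra.
split; last first.
  split => //; rewrite /c Rmult_0_r.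
  have -> : rotate 0 (Phi p) = Phi p by rewrite /rotate cos_0 sin_0; Cring.
  exact: (nf_PsiPhi H).
move=> t _ _.
have hm : Cmod (rotate (k * t) (Phi p)) = Cmod (Phi p) by exact: Cmod_rotate.
have hr : Cmod (rotate (k * t) (Phi p)) < r by rewrite hm; lra.
split.
  split; first by apply: hPsi; rewrite hm; lra.
  by rewrite /c (nf_PhiPsi H) // hm.
have := chain_map Psi (fun s => rotate (k * s) (Phi p)) t _
  (nf_analytic_Psi H _ hr) (is_derive_rotate k (Phi p) t).
have -> : RtoC k = RtoC (a (Cmod (rotate (k * t) (Phi p)) ^ 2)) by rewrite hm.
rewrite (nf_eq H _ hr) he //.
have -> // : (X (Psi (rotate (k * t) (Phi p))) + 0 * rotate (k * t) (Phi p))%C = X (c t).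
by rewrite /c; ring.
Qed.

Lemma linear_center : center X.
Proof.
exists saturated; split; first exact: saturated_domain.
move=> V p [hp hne] _.
have [hc [c0 hk]] := linear_curve p hp.
set k := a _ in hc c0 hk; set c := (fun t => _) in hc c0.
have hPI := PI_RGT_0.
exists c, (2 * PI / k); split; last first.
  split => //; split; first by apply: Rdiv_lt_0_compat; lra.
  move=> t; rewrite /c; congr Psi.
  have -> : k * (t + 2 * PI / k) = k * t + 2 * INR 1 * PI by rewrite /=; field; lra.
  by rewrite /rotate cos_period sin_period.
move=> t h1 h2; have [h3 h4] := hc t h1 h2; split => //; split => // h0.
have [hpr hPr] := hp.
have hm : Cmod (rotate (k * t) (Phi p)) = Cmod (Phi p) by exact: Cmod_rotate.
have h5 : rotate (k * t) (Phi p) = origin.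
  rewrite -(nf_PhiPsi H (rotate (k * t) (Phi p))); last by rewrite hm; lra.
  by rewrite -/(c t) h0 (nf_Phi0 H).
have h6 : Phi p = origin.
  by apply: Cmod_eq_0; rewrite -hm h5 Cmod_0.
apply: hne; rewrite -(nf_PsiPhi H p hpr) h6.
exact: (nf_Psi0 H).
Qed.

Lemma saturated_orbit p q : saturated p ->
  orbit X saturated p q <-> saturated q /\ Cmod (Phi q) ^ 2 = Cmod (Phi p) ^ 2.
Proof.
move=> hp; split.
  move=> [al [be [c [t [ha [hb [hat [htb [hc [c0 ct]]]]]]]]]].
  have [hq _] := hc t hat htb; rewrite ct in hq; split => //.
  pose g s := Cmod (Phi (c s)) ^ 2.
  have hg (s : R) : Rbar_lt al s -> Rbar_lt s be -> is_derive g s 0.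
    move=> h1 h2; have [[h3 h4] h5] := hc s h1 h2.
    have aPhi := nf_analytic_Phi H (c s) h3.
    have := is_derive_norm2 _ _ _ (chain_map Phi c s _ aPhi h5).
    rewrite linear_rotation //; last lra.
    have -> // : 2 * dot (Phi (c s)) (RtoC (a (Cmod (Phi (c s)) ^ 2)%R) * rotation_field (Phi (c s)))%C = 0.
    by rewrite /dot /rotation_field /=; ring.
  rewrite -c0 -ct -/(g t) -/(g 0).
  case: (Rtotal_order 0 t) => [h|[<- //|h]].
    symmetry; apply: (eq_is_derive g 0 t) => // s hs; apply: hg.
      by case: al ha {hat hc} => [al||] //= ha; lra.
    by case: be htb {hb hc} => [be||] //= htb; lra.
  apply: (eq_is_derive g t 0) => // s hs; apply: hg.
    by case: al hat {ha hc} => [al||] //= hat; lra.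
  by case: be hb {htb hc} => [be||] //= hb; lra.
move=> [hq e2].
have e1 : Cmod (Phi p) = Cmod (Phi q).
  have h1 := Cmod_ge_0 (Phi p); have h2 := Cmod_ge_0 (Phi q); nra.
have [th hth] := rotate_transitive _ _ e1.
have [hc [c0 hk]] := linear_curve p hp.
set k := a _ in hc c0 hk.
exists m_infty, p_infty, (fun t => Psi (rotate (k * t) (Phi p))), (th / k).
do 4 (split => //); split; first exact: hc.
split; first exact: c0.
have -> : k * (th / k) = th by field; lra.
by rewrite hth (nf_PsiPhi H) //; case: hq.
Qed.

Lemma linear_orbits_closed : orbits_closed X.
Proof.
exists saturated; split; first exact: saturated_domain.
move=> p hp.
exists (fun q => ~ (saturated q /\ Cmod (Phi q) ^ 2 <> Cmod (Phi p) ^ 2)); split; last first.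
  move=> q; split.
    by move=> /(saturated_orbit p q hp) [h1 h2]; split => // -[_ h3].
  move=> [h1 h2]; apply/(saturated_orbit p q hp); split => //.
  by apply: NNPP => h3; apply: h2.
move=> q hq [hs hne]; apply: hq; apply: (proj2 (locally_Cmod _ q)).
have [s [hs0 hsat]] := saturated_near q hs.
have af := analytic_norm2 Phi q (nf_analytic_Phi H q (proj1 hs)).
have /analytic_zan/analytic_map_zan az := af.
have hpos : 0 < Rabs (Cmod (Phi q) ^ 2 - Cmod (Phi p) ^ 2) by apply: Rabs_pos_lt; lra.
have [s' [hs' hc]] := analytic_cont _ _ az _ hpos.
exists (Rmin s s'); split; first exact: Rmin_glb_lt.
move=> h hh hn; apply: hn; split; first by apply: hsat; apply: le_Rmin_l hh.
move=> e0; have := hc h (le_Rmin_r hh).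
rewrite -RtoC_minus Cmod_R e0 Rabs_minus_sym; lra.
Qed.
End Linear.

Definition wirt (la mu q : C) : C := (la * q + mu * Cconj q)%C.

Lemma wirt_zdiff la mu p : zdiff (wirt la mu) p la mu.
Proof.
exists 0, 1; split; first lra.
split; first lra.
move=> h _.
have -> : (wirt la mu (p + h) - (wirt la mu p + la * h + mu * Cconj h))%C = RtoC 0.
  by rewrite /wirt; Cring.
rewrite Cmod_0; lra.
Qed.

Lemma wirt_analytic la mu p : analytic_map_at (wirt la mu) p.
Proof.
apply/analytic_map_zan; apply: zan_plus; apply: zan_mult; try exact: zan_const; try exact: zan_id.
by apply: (zan_conj (fun q => q)); exact: zan_id.
Qed.

Lemma is_linear_wirt (L : R * R -> R * R) : is_linear L ->
  exists la mu, forall q, L q = wirt la mu q.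
Proof.
move=> hL; pose L1 : C := L (1, 0); pose L2 : C := L (0, 1).
exists ((L1 - Ci * L2) * RtoC (/ 2))%C, ((L1 + Ci * L2) * RtoC (/ 2))%C => -[x y].
have -> : (x, y) = plus (scal x ((1, 0) : R * R)) (scal y ((0, 1) : R * R)).
  by rewrite /plus /= /prod_plus /scal /= /prod_scal /= /plus /scal /= /mult /=; congr pair; ring.
rewrite (linear_plus _ hL) !(linear_scal _ hL).
rewrite -/L1 -/L2; move: L1 L2 => [u v] [w z].
rewrite /plus /= /prod_plus /scal /= /prod_scal /= /plus /scal /= /mult /= /wirt.
by apply: Ceq => /=; field.
Qed.

Lemma zdiff_series s M a p (G : C -> C) : 0 < s -> bnd s M a ->
  (forall h, Cmod h <= s -> G (p + h)%C = ev a h (Cconj h)) ->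
  zdiff G p (a 1%nat 0%nat) (a 0%nat 1%nat).
Proof.
move=> hs ha h.
have hM : 0 <= M by apply: bnd_ge0 ha; lra.
have G0 : G p = a 0%nat 0%nat.
  have := h (RtoC 0); rewrite Cmod_0 Cplus_0_r => -> //; last lra.
  rewrite Cconj_0.
  exact: ev_00.
exists (M / s ^ 2), s; split => //; split; first by apply: Rdiv_le_0_compat => //; apply: pow_lt.
move=> k hk; rewrite h // G0.
have -> : M / s ^ 2 * Cmod k ^ 2 = M * (Cmod k / s) ^ 2 by field; lra.
apply: (ev_linear s M) => //; rewrite ?Cmod_conj; try lra.
by split => //; exact: Cmod_ge_0.
Qed.

Lemma D_mult0 F G p v : analytic_map_at F p -> analytic_map_at G p -> G p = origin ->
  Dmap (fun q => F q * G q)%C p v = (F p * Dmap G p v)%C.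
Proof.
move=> /analytic_map_zan hF /analytic_map_zan hG G0.
have [a [b [M [M' [s [hs [ha [hb h]]]]]]]] := zan_common F G p hF hG.
have hs' := Rlt_le _ _ hs.
have h0 := h (RtoC 0) ltac:(rewrite Cmod_0; lra).
rewrite Cplus_0_r Cconj_0 !ev_00 in h0.
have [Fa Gb] := h0.
have dG := zdiff_series s M' b p G hs hb (fun k hk => proj2 (h k hk)).
have hFG k : Cmod k <= s -> (F (p + k) * G (p + k))%C = ev (pmul a b) k (Cconj k).
  move=> hk; have hk' : Cmod (Cconj k) <= s by rewrite Cmod_conj.
  by have [-> ->] := h k hk; rewrite (ev_pmul hk hk' ha hb).
have dFG := zdiff_series s (M * M') (pmul a b) p (fun q => F q * G q)%C hs (bnd_pmul hs' ha hb) hFG.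
rewrite (D_zdiff dFG) (D_zdiff dG) pmul_10 pmul_01 -Gb G0 Fa.
have -> : origin = RtoC 0 by [].
ring.
Qed.

Lemma D_plus F G p v : analytic_map_at F p -> analytic_map_at G p ->
  Dmap (fun q => F q + G q)%C p v = (Dmap F p v + Dmap G p v)%C.
Proof.
move=> /analytic_map_zan hF /analytic_map_zan hG.
have [a [b [M [M' [s [hs [ha [hb h]]]]]]]] := zan_common F G p hF hG.
have hs' := Rlt_le _ _ hs.
have dF := zdiff_series s M a p F hs ha (fun k hk => proj1 (h k hk)).
have dG := zdiff_series s M' b p G hs hb (fun k hk => proj2 (h k hk)).
have hFG k : Cmod k <= s -> (F (p + k) + G (p + k))%C = ev (padd a b) k (Cconj k).
  move=> hk; have hk' : Cmod (Cconj k) <= s by rewrite Cmod_conj.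
  by have [-> ->] := h k hk; rewrite (ev_padd hk hk' ha hb).
have dFG := zdiff_series s (M + M') (padd a b) p (fun q => F q + G q)%C hs (bnd_padd hs' ha hb) hFG.
by rewrite (D_zdiff dFG) (D_zdiff dF) (D_zdiff dG) /padd; ring.
Qed.

Lemma D_coefficients G : analytic_map_at G origin -> exists al be s, 0 < s /\
  analytic_map_at al origin /\ analytic_map_at be origin /\
  forall x : C, Cmod x <= s -> zdiff G x (al x) (be x).
Proof.
move=> /analytic_map_zan [a [s [M [hs [ha h]]]]].
have ha1 := bnd_pd1 s M a hs ha; have ha2 := bnd_pd2 s M a hs ha.
exists (fun x : C => ev (pd1 a) x (Cconj x)), (fun x : C => ev (pd2 a) x (Cconj x)), (s / 4).
split; first lra.
split.
  apply/analytic_map_zan; exists (pd1 a), (s / 2), (M / (s / 2)); split; first lra.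
  by split => // k hk; rewrite Cplus_origin.
split.
  apply/analytic_map_zan; exists (pd2 a), (s / 2), (M / (s / 2)); split; first lra.
  by split => // k hk; rewrite Cplus_origin.
move=> x hx; apply: (zdiff_ev s M) => //; last lra.
by move=> k hk; rewrite -(Cplus_origin k); rewrite h // Cplus_origin.
Qed.

Lemma jet_D X : has_first_jet X rotation_field ->
  X origin = origin /\ forall v, Dmap X origin v = rotation_field v.
Proof.
move=> [hj1 hj2].
have [c [s [M [hs [bc [oc hc]]]]]] := jet_series 2 (fun q => X q - rotation_field q)%C origin hj1 hj2.
have hd := zdiff_series s M c origin (fun q => X q - rotation_field q)%C hs bc hc.
rewrite !oc in hd; try lia.
have X0 : X origin = origin.
  have := hc (RtoC 0); rewrite Cmod_0 => /(_ (Rlt_le _ _ hs)).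
  rewrite Cconj_0.
  rewrite ev_00 oc; last lia.
  rewrite Cplus_origin => e0.
  rewrite (Csub_add (X origin) (rotation_field origin)) [X in (X + _)%C]e0 /rotation_field.
  by Cring.
split => // v.
have hX : zdiff X origin (- Ci)%C (RtoC 0).
  have [K [t [ht [hK h]]]] := hd; exists K, t; split => //; split => // k hk.
  have -> : (X (origin + k) - (X origin + - Ci * k + 0 * Cconj k))%C =
    (X (origin + k) - rotation_field (origin + k)%C -
      ((X origin - rotation_field origin) + 0 * k + 0 * Cconj k))%C.
    move: (X (origin + k)%C) (X origin) => u w; rewrite /rotation_field.
    by Cring.
  exact: h.
rewrite (D_zdiff hX) /rotation_field; by Cring.
Qed.

Lemma almost_linearizable_first_integral X : analytic_map_at X origin ->
  has_first_jet X rotation_field -> almost_linearizable X -> exists f, analytic_first_integral X f.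
Proof.
move=> hX hjet [phi [L [g [[aphi [phi0 [psi [apsi [psi0 [hpp1 hpp2]]]]]] [/is_linear_wirt [la [mu hL]] [ag hlie]]]]]].
have [X0 hJ] := jet_D X hjet.
have /locally_Cmod [s1 [hs1 e1]] := hpp1.
have /locally_Cmod [s2 [hs2 e2]] := hpp2.
have /locally_Cmod [s3 [hs3 e3]] := hlie.
have apsi' : analytic_map_at psi (phi origin) by rewrite phi0.
have aphi' : analytic_map_at phi (psi origin) by rewrite psi0.
pose A v := Dmap phi origin v; pose B v := Dmap psi origin v.
have BA v : B (A v) = v.
  rewrite /A /B -{1}phi0 -D_comp // -[RHS](D_id origin).
  by apply: D_loc; [exists s1|apply: analytic_map_comp].
have AB v : A (B v) = v.
  rewrite /A /B -{1}psi0 -D_comp // -[RHS](D_id origin).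
  by apply: D_loc; [exists s2|apply: analytic_map_comp].
have [bl [bm hB]] : exists bl bm, forall v, B v = wirt bl bm v.
  have /analytic_map_zan/zan_zdiff [bl [bm hz]] := apsi.
  by exists bl, bm => v; rewrite /B (D_zdiff hz).
have A0 : A origin = origin.
  have /analytic_map_zan/zan_zdiff [al [am hz]] := aphi.
  by rewrite /A (D_zdiff hz); Cring.
have B0 : B origin = origin by rewrite hB /wirt; Cring.
pose ga := g origin.
have key v : A (rotation_field v) = (RtoC ga * L (A v))%C.
  have [al [be [s4 [hs4 [aal [abe hz]]]]]] := D_coefficients phi aphi.
  have aXc : analytic_map_at (fun x => Cconj (X x)) origin.
    by apply/analytic_map_zan; apply: zan_conj; apply/analytic_map_zan.
  pose M1 x := (al x * X x + be x * Cconj (X x))%C.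
  pose M2 x := (RtoC (g (phi x)) * L (phi x))%C.
  have aLphi : analytic_map_at (fun x => L (phi x)) origin.
    apply/analytic_map_zan; apply: (zan_ext (fun x => wirt la mu (phi x))); first by move=> q; rewrite hL.
    by apply/analytic_map_zan; apply: analytic_map_comp => //; apply: wirt_analytic.
  have agphi : analytic_map_at (fun x => RtoC (g (phi x))) origin.
    apply/analytic_map_zan/analytic_zan; apply: analytic_comp => //; by rewrite phi0.
  have am1 : analytic_map_at (fun x => al x * X x)%C origin.
    by apply/analytic_map_zan; apply: zan_mult; apply/analytic_map_zan.
  have am2 : analytic_map_at (fun x => be x * Cconj (X x))%C origin.
    by apply/analytic_map_zan; apply: zan_mult; apply/analytic_map_zan.
  have aM1 : analytic_map_at M1 origin.
    by apply/analytic_map_zan; apply: zan_plus; apply/analytic_map_zan.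
  have L0 : L (phi origin) = origin.
    by rewrite phi0 hL /wirt; Cring.
  have d2 : Dmap M2 origin v = (RtoC ga * L (A v))%C.
    rewrite /M2 D_mult0 // phi0 -/ga; congr Cmult.
    transitivity (Dmap (fun x => wirt la mu (phi x)) origin v).
      by apply: D_loc => //; exists 1; split; [lra|move=> h _; rewrite hL].
    rewrite (D_comp (wirt la mu)) //; last exact: wirt_analytic.
    by rewrite (D_zdiff (wirt_zdiff la mu _)) hL.
  have Xc0 : Cconj (X origin) = origin by rewrite X0; Cring.
  have d1 : Dmap M1 origin v = A (rotation_field v).
    rewrite /M1 D_plus // D_mult0 // (D_mult0 be) // hJ.
    have -> : Dmap (fun x => Cconj (X x)) origin v = Cconj (rotation_field v).
      transitivity (Dmap (fun x => wirt (RtoC 0) (RtoC 1) (X x)) origin v).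
        by apply: D_loc => //; exists 1; split; [lra|move=> h _; apply: Ceq; rewrite /wirt /=; ring].
      rewrite (D_comp (wirt _ _)) //; last exact: wirt_analytic.
      by rewrite (D_zdiff (wirt_zdiff _ _ _)) hJ; ring.
    by rewrite /A (D_zdiff (hz origin ltac:(rewrite Cmod_0; lra))).
  rewrite -d1 -d2; apply: D_loc => //.
  exists (Rmin s3 s4); split; first exact: Rmin_glb_lt.
  move=> h hh; have := e3 h (le_Rmin_l hh).
  rewrite !Cplus_origin => e4.
  have := @D_zdiff _ _ _ _ (X h) (hz h (le_Rmin_r hh)).
  rewrite /M1 /M2 => <-.
  transitivity (scal (g (phi h)) (L (phi h))); first exact: e4.
  by apply: Ceq; rewrite /scal /= /scal /= /mult /=; ring.
have ga0 : ga <> 0.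
  move=> g0; have k1 := key (RtoC 1); rewrite g0 in k1.
  have : rotation_field (RtoC 1) = origin.
    by rewrite -(BA (rotation_field (RtoC 1))) k1 -[RHS]B0; congr B; Cring.
  rewrite /rotation_field => -[]; lra.
have BL v : B (L v) = (RtoC (/ ga) * rotation_field (B v))%C.
  have k1 := key (B v); rewrite AB in k1.
  have -> : L v = (RtoC (/ ga) * A (rotation_field (B v)))%C.
    rewrite k1 Cmult_assoc -RtoC_mult Rinv_l; last exact: ga0.
    by move: (L v) => w; Cring.
  rewrite hB.
  have -> : wirt bl bm (RtoC (/ ga) * A (rotation_field (B v)))%C = (RtoC (/ ga) * wirt bl bm (A (rotation_field (B v))))%C.
    by rewrite /wirt; Cring.
  by rewrite -hB BA.
have aBphi p : analytic_map_at phi p -> analytic_map_at (fun x => wirt bl bm (phi x)) p.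
  by move=> h; apply: analytic_map_comp => //; apply: wirt_analytic.
exists (fun x => Cmod (wirt bl bm (phi x)) ^ 2); split.
  by apply: analytic_norm2; apply: aBphi.
split.
  apply: norm2_not_const; first by rewrite phi0 -hB B0.
  exists s1; split => // x hx; rewrite -hB => h0.
  have p0 : phi x = origin by rewrite -(AB (phi x)) h0 A0.
  by have := e1 x hx; rewrite Cplus_origin p0 psi0 => <-.
have /analytic_map_zan/zan_open [s5 [hs5 a5]] := aphi.
apply/locally_Cmod; exists (Rmin s3 s5); split; first exact: Rmin_glb_lt.
move=> h hh; rewrite Cplus_origin.
have ah : analytic_map_at phi h.
  by rewrite -(Cplus_origin h); apply/analytic_map_zan; apply: a5; apply: le_Rmin_r hh.
change (ld (fun x => Cmod (wirt bl bm (phi x)) ^ 2) h (X h) = 0).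
rewrite ld_norm2; last exact: aBphi.
rewrite (D_comp (wirt bl bm)) //; last exact: wirt_analytic.
rewrite (D_zdiff (wirt_zdiff bl bm _)).
have := e3 h (le_Rmin_l hh); rewrite Cplus_origin => e4.
have e5 : Dmap phi h (X h) = (RtoC (g (phi h)) * L (phi h))%C.
  transitivity (scal (g (phi h)) (L (phi h))); first exact: e4.
  by apply: Ceq; rewrite /scal /= /scal /= /mult /=; ring.
rewrite e5 -/(wirt bl bm _).
have -> : wirt bl bm (RtoC (g (phi h)) * L (phi h))%C = (RtoC (g (phi h)) * wirt bl bm (L (phi h)))%C.
  by rewrite /wirt; Cring.
rewrite -!hB BL; move: (B (phi h)) => w.
by rewrite /dot /rotation_field /=; ring.
Qed.

Theorem corollary1p3 (X : R * R -> R * R)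
    (hX : analytic_map_at X origin)
    (hjet : has_first_jet X rotation_field) :
  (orbits_closed X <-> center X) /\
  (center X <-> exists f : R * R -> R, analytic_first_integral X f) /\
  ((exists f : R * R -> R, analytic_first_integral X f) <-> almost_linearizable X).
Proof.
have [Psi [Phi [a [e [r H]]]]] := normal_form_exists X hX hjet.
case: (nf_sign H) => [he|[sg [hsg he]]].
  have [rho [hrho hPsi]] := nf_Psi_small H r (nf_r H).
  have h1 := linear_orbits_closed X Psi Phi a e r H he rho hrho hPsi.
  have h2 := linear_center X Psi Phi a e r H he rho hrho hPsi.
  have h3 := linear_first_integral X Psi Phi a e r H he.
  have h4 := linear_almost_linearizable X Psi Phi a e r H he.
  by split; [|split].
have h1 := strict_not_orbits_closed X Psi Phi a e r sg H hsg he.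
have h2 := strict_not_center X Psi Phi a e r sg H hsg he.
have h3 : ~ exists f, analytic_first_integral X f.
  by move=> [f]; apply: (strict_not_first_integral X Psi Phi a e r sg H he).
have h4 : ~ almost_linearizable X.
  by move=> h; apply: h3; apply: almost_linearizable_first_integral.
by split; [|split]; split.
Qed.
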